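(* Let $G(n)$ denote the number of subgroups (counted as sets) of $(\mathbb{Z}/n\mathbb{Z})^\times$. The order of magnitude of the maximal order of $\log G(n)$ is $(\log x)^2/\log\log x$. More precisely, as $x\to\infty$, $$\frac1{16}\frac{(\log x)^2}{\log\log x}+O\bigg(\frac{(\log x)^2\log\log\log x}{(\log\log x)^2}\bigg)\le\max_{n\le x}\big(\log G(n)\big)\le\frac14\frac{(\log x)^2}{\log\log x}+O\bigg(\frac{(\log x)^2}{(\log\log x)^2}\bigg).$$
   Context: The maximum is over positive integers $n\le x$; the implied constants are absolute and the estimates are for $x$ sufficiently large. *)

(* Defs.v *)
From HB Require Import structures.
From mathcomp Require Import all_boot all_order all_algebra all_fingroup.
From mathcomp Require Import all_classical all_reals all_analysis.
Set Implicit Arguments.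
Unset Strict Implicit.
Unset Printing Implicit Defensive.
Import Order.TTheory GRing.Theory Num.Theory.
Import numFieldNormedType.Exports.
Local Open Scope classical_set_scope.
Local Open Scope ring_scope.

(* For n <= 1 the ring 'Z_n is Z/2Z; as its unit group is trivial, G 1 = 1,
   which is the right value for the zero ring Z/1Z. *)
Definition G (n : nat) : nat := #|subgroups (units_Zp n)|.

(* The default value ln (G 1) of the iterated maximum is its first term, so
   for x >= 1 this is the maximum over the integers 1 <= n <= x. *)
Definition maxlogG (R : realType) (x : R) : R :=
  \big[Num.max/ln (G 1)%:R]_(1 <= n < (Num.truncn x).+1) ln (G n)%:R.

(* Lets the Landau notations be used at +oo. *)
Canonical pinfty_nbhs_filter_on (R : numFieldType) :=
  FilterType (pinfty_nbhs R) _.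

(* Main.v *)
Require Import Defs.
From mathcomp Require Import all_boot all_order all_algebra all_fingroup.
From mathcomp Require Import all_solvable all_field.
From mathcomp Require Import zify.

(** Write omega(n) for the number of primes dividing n.

Upper bound. For a finite abelian group A and a prime p, a subgroup H is
determined by pH together with the subspace H / pH of B / pH, where B is the
preimage of pH under multiplication by p, and B / pH has the same order p ^ r
as the p-torsion of A ([card_subgroups_power]). As F_p ^ r has at most
2 ^ r p ^ (r ^ 2 / 4) subspaces, iterating gives
log #Sub(A) <= (1 + rho / 4) log |A| whenever every p-torsion has order at most
p ^ rho ([card_subgroups_upper]). For the units modulo n one may take
rho = omega(n) + 2, so that log G(n) <= (omega(n) + 6) / 4 * log n, and
Chebyshev's bounds give omega(n) <= log x / log log x
+ O(log x / (log log x) ^ 2) for n <= x ([omega_le]).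

Lower bound. If n is a product of r primes q = 1 mod p, the units modulo n
contain F_p ^ r, which has at least p ^ ((r ^ 2 - 1) / 4) subspaces of
dimension r / 2. If all these q are at most y then r can be
log x / log y, and the best result comes from p = y ^ (1/2 + o(1)). What is
needed is thus a prime p equal to sqrt y up to powers of log y such that at
least sqrt y / (log y) ^ c primes q <= y are 1 mod p, with y about
(log x) ^ 2 ([primes_in_progression]); powers of log y only affect the error
term.

Such a p is found by averaging, in the manner of the Bombieri-Vinogradov
theorem. Let e_p(n) be the indicator of n = 1 mod p minus 1 / (p - 1) times
that of p not dividing n ([dev_one]); it suffices that the sum over p of
|sum of Lambda(n) e_p(n) over n <= y| be smaller than the sum of the main terms
y / p. Since p is prime and large, the small moduli of that theorem do not occur. Vaughan's
identity ([vaughan_bound]) reduces the sums over n to sums of e_p over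
multiples of small integers, which are bounded, and to bilinear sums of
a_m b_k e_p(m k) with both m and k at least a power of log y. On functions of
mean zero, convolution with e_p is the inversion u -> 1 / u of residues
([dev_one_inversion]), so that on a rectangle the large sieve can be applied to each
variable ([bilinear_rect]); the region m k <= y is reduced to rectangles by
cutting it dyadically and then repeatedly in halves ([bilinear_staircase]).
The large sieve is proved in dual form ([dual_large_sieve]), with real
trigonometric sums and the spacing of the fractions h / p, losing a logarithm
that does no harm here. *)

Set Implicit Arguments.
Unset Strict Implicit.
Unset Printing Implicit Defensive.

Local Open Scope nat_scope.

(** * Subgroups of elementary abelian groups *)

Section CountSubgroups.
Import GroupScope.
Variable gT : finGroupType.
Implicit Types (A E M H K : {group gT}).

Definition count_subgroups (p s : nat) (E : {set gT}) : nat :=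
  #|[set H : {group gT} | (H \subset E) && (#|H| == p ^ s)%N]|.

Section Hyperplane.
Variables (p : nat) (E M : {group gT}) (r : nat).
Hypothesis p_pr : prime p.
Hypothesis abE : p.-abelem E.
Hypothesis sME : M \subset E.
Hypothesis oE : #|E| = (p ^ r.+1)%N.
Hypothesis oM : #|M| = (p ^ r)%N.

Let cE x y : x \in E -> y \in E -> x * y = y * x.
Proof.
by move=> xE yE; apply: (centsP (abelem_abelian abE)).
Qed.

(** E is a p-group in which M has index p, so nothing lies strictly between M and E. *)
Lemma mul_hyperplane H : H \subset E -> ~~ (H \subset M) -> H * M = E.
Proof.
move=> sHE nHM.
have cHM : M \subset 'C(H).
  by rewrite (subset_trans sME) // (subset_trans (abelem_abelian abE)) // centS.
rewrite -(cent_joinEr cHM); apply/eqP; rewrite eqEcard join_subG sHE sME /=.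
have sJ : H <*> M \subset E by rewrite join_subG sHE.
have pJ : p.-group (H <*> M) := pgroupS sJ (abelem_pgroup abE).
rewrite (card_pgroup pJ) oE leq_exp2l ?prime_gt1 //.
have : #|M| < #|H <*> M|.
  apply: proper_card; apply/andP; split; first exact: joing_subr.
  apply: contra nHM => h; exact: subset_trans (joing_subl H M) h.
by rewrite oM {1}(card_pgroup pJ) ltn_exp2l ?(prime_gt1 p_pr).
Qed.

Lemma card_inter_hyperplane H s : H \subset E -> ~~ (H \subset M) ->
  #|H| = (p ^ s.+1)%N -> #|H :&: M| = (p ^ s)%N.
Proof.
move=> sHE nHM oH; have := mul_cardG H M.
rewrite (mul_hyperplane sHE nHM) oE oM oH => e; apply/eqP.
have p0 : 0 < p ^ r.+1 by rewrite expn_gt0 prime_gt0.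
by rewrite -(eqn_pmul2l p0) -e !expnS -!mulnA [(p ^ s * _)%N]mulnC.
Qed.

(** Fix y in E outside M. Every such H is generated by K and one
element of the coset y M, which is unique modulo K; hence the H correspond to
the elements of M / K. *)
Lemma card_extensions K s : K \subset M -> #|K| = (p ^ s)%N ->
  #|[set H : {group gT} | [&& H \subset E, #|H| == (p ^ s.+1)%N, ~~ (H \subset M)
       & H :&: M == K]]| = (p ^ (r - s))%N.
Proof.
move=> sKM oK.
have sKE := subset_trans sKM sME.
have [y yE yM] : exists2 y, y \in E & y \notin M.
  apply/subsetPn; apply/negP => /subset_leq_card.
  by rewrite oE oM leq_exp2l ?prime_gt1 // ltnn.
have nKM : K <| M by rewrite -(sub_abelian_normal _ (abelianS sME (abelem_abelian abE))).
have oMK : #|M / K| = (p ^ (r - s))%N.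
  rewrite card_quotient ?normal_norm // -divgS // oM oK.
  by rewrite expnB ?prime_gt0 // -(leq_exp2l _ _ (prime_gt1 p_pr)) -oK -oM subset_leq_card.
have reprM c : c \in M / K -> repr c \in M.
  move=> cM; rewrite -(quotientGK nKM); apply/morphpreP.
  by split; [exact: repr_coset_norm | rewrite /= coset_reprK].
pose phi (c : coset_of K) := (K <*> <[y * repr c]>)%G.
have phiP c : c \in M / K -> [/\ phi c \subset E, #|phi c| = (p ^ s.+1)%N,
    ~~ (phi c \subset M) & phi c :&: M = K].
  move=> /reprM rM; set x := y * repr c.
  have xE : x \in E by rewrite groupM // (subsetP sME).
  have xM : x \notin M by rewrite groupMr.
  have xphi : x \in phi c by rewrite (subsetP (joing_subr _ _)) // cycle_id.
  have sphi : phi c \subset E by rewrite join_subG sKE cycle_subG.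
  have nphi : ~~ (phi c \subset M) by apply: contra xM => /subsetP; apply.
  have ox : #[x] = p.
    apply: nt_prime_order => //; first by case/(abelemP p_pr): abE => _; apply.
    by apply: contra xM => /eqP ->; exact: group1.
  have tx : K :&: <[x]> = 1.
    rewrite setIC; apply: prime_TIg; first by rewrite -orderE ox.
    by rewrite cycle_subG; apply: contra xM; exact: (subsetP sKM).
  have cx : <[x]> \subset 'C(K).
    rewrite cycle_subG; apply: (subsetP _ _ xE).
    by rewrite (subset_trans (abelem_abelian abE)) // centS.
  have ophi : #|phi c| = (p ^ s.+1)%N.
    by rewrite /= cent_joinEr // TI_cardMg // oK -orderE ox expnSr.
  split=> //; apply/eqP; rewrite eq_sym eqEcard subsetI joing_subl sKM /=.
  by rewrite oK (card_inter_hyperplane sphi nphi ophi).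
rewrite -oMK -(card_in_imset (f := phi)); last first.
  move=> c c' cM cM' e; have [_ _ _ eK] := phiP c cM.
  have x1 : y * repr c \in phi c by rewrite (subsetP (joing_subr _ _)) // cycle_id.
  have x2 : y * repr c' \in phi c by rewrite e (subsetP (joing_subr _ _)) // cycle_id.
  have kK : repr c' * (repr c)^-1 \in K.
    suff h : repr c' * (repr c)^-1 \in phi c :&: M by rewrite eK in h.
    rewrite inE; apply/andP; split; last by rewrite groupM ?groupV ?reprM.
    have -> : repr c' * (repr c)^-1 = (y * repr c') * (y * repr c)^-1.
      have rE := subsetP sME _ (reprM c cM); have rE' := subsetP sME _ (reprM c' cM').
      rewrite (cE yE rE) (cE yE rE') invMg !mulgA; congr (_ * _).
      by rewrite -mulgA mulgV mulg1.
    by rewrite groupM // groupV.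
  rewrite -[c]coset_reprK -[c']coset_reprK.
  by rewrite -(coset_kerl (repr c) kK) mulgKV.
congr #|pred_of_set _|; apply/setP => H; rewrite inE; apply/idP/imsetP.
  move=> /and4P[sHE /eqP oH nHM /eqP eHM].
  have sKH : K \subset H by rewrite -eHM subsetIl.
  move: yE; rewrite -(mul_hyperplane sHE nHM) => /mulsgP[h m hH mM ey].
  have hE := subsetP sHE _ hH; have mE := subsetP sME _ mM.
  have mc : coset K m^-1 \in M / K by rewrite mem_quotient // groupV.
  exists (coset K m^-1) => //.
  have [sP oP _ _] := phiP _ mc.
  apply/eqP; rewrite eq_sym -val_eqE eqEcard oP oH leqnn andbT /=.
  rewrite join_subG sKH cycle_subG.
  have mN : m^-1 \in 'N(K) by rewrite groupV (subsetP (normal_norm nKM)).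
  have : repr (coset K m^-1) \in K :* m^-1.
    by rewrite -val_coset //; exact: mem_repr_coset.
  case/rcosetP => k kK ->.
  have kE := subsetP sKE _ kK.
  have -> : y * (k * m^-1) = k * h.
    rewrite mulgA (cE _ kE); last by rewrite ey groupM.
    by rewrite ey -!mulgA mulgV mulg1.
  by rewrite groupM // (subsetP sKH).
case=> c cM ->; have [-> -> -> ->] := phiP c cM.
by rewrite !eqxx.
Qed.

(** The q-Pascal rule for Gaussian binomial coefficients, obtained by
sorting the subgroups H by whether they lie in the hyperplane M, and by H :&: M
if they do not. *)
Lemma count_subgroups_hyperplane s :
  count_subgroups p s.+1 E = (count_subgroups p s.+1 M + p ^ (r - s) * count_subgroups p s M)%N.
Proof.
rewrite /count_subgroups -!sum1_card (bigID (fun H : {group gT} => H \subset M)) /=.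
congr (_ + _)%N.
  apply: eq_bigl => H; rewrite !inE; case: (boolP (H \subset M)) => sHM; rewrite ?andbF ?andbT //.
  by rewrite (subset_trans sHM sME).
rewrite (partition_big (fun H : {group gT} => (H :&: M)%G)
  (fun K : {group gT} => K \in [set K : {group gT} | (K \subset M) && (#|K| == p ^ s)%N])) /=.
  rewrite big_distrr /=; apply: eq_bigr => K; rewrite inE => /andP[sKM /eqP oK].
  rewrite muln1 -(card_extensions sKM oK) -sum1_card; apply: eq_bigl => H.
  by rewrite !inE -!andbA.
move=> H; rewrite !inE => /andP[/andP[sHE /eqP oH] nHM].
by rewrite subsetIr (card_inter_hyperplane sHE nHM oH) eqxx.
Qed.

End Hyperplane.

Lemma count_subgroups0 p E : count_subgroups p 0 E = 1%N.
Proof.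
rewrite /count_subgroups (_ : [set _ | _] = [set 1%G]) ?cards1 //; apply/setP => H.
rewrite !inE expn0 -trivg_card1; apply/idP/eqP => [/andP[_ /eqP H1]|->].
  exact: group_inj.
by rewrite sub1G eqxx.
Qed.

Lemma count_subgroups_gt p s r E : prime p -> #|E| = (p ^ r)%N -> r < s -> count_subgroups p s E = 0%N.
Proof.
move=> pr oE rs; apply/eqP; rewrite cards_eq0; apply/eqP/setP => H; rewrite !inE.
apply/negbTE/negP => /andP[/subset_leq_card + /eqP oH].
by rewrite oE oH leq_exp2l ?prime_gt1 // leqNgt rs.
Qed.

Lemma hyperplane_exists p r E : prime p -> p.-abelem E -> #|E| = (p ^ r.+1)%N ->
  exists M : {group gT}, [/\ M \subset E, p.-abelem M & #|M| = (p ^ r)%N].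
Proof.
move=> pr ab oE.
have [|M [sM _ oM]] := @normal_pgroup p gT r E E (abelem_pgroup ab) (normal_refl E).
  by rewrite oE pfactorK.
by exists M; rewrite (abelemS sM).
Qed.

(** The number of possible sets of pivots of an echelon form, times the largest
number of choices for its free entries. *)
Lemma count_subgroups_upper p r s E : prime p -> p.-abelem E -> #|E| = (p ^ r)%N ->
  count_subgroups p s E <= 'C(r, s) * p ^ (s * (r - s)).
Proof.
move=> pr; elim: r s E => [|r IH] [|s] E ab oE; rewrite ?count_subgroups0 ?bin0 //.
  by rewrite (count_subgroups_gt pr oE).
have [M [sM abM oM]] := hyperplane_exists pr ab oE.
rewrite (count_subgroups_hyperplane pr ab sM oE oM).
have [rs|sr] := ltnP r s; first by rewrite !(count_subgroups_gt pr oM) ?muln0 // ltnW // ltnS ltnW.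
rewrite subSS binS mulnDl; apply: leq_add.
  apply: leq_trans (IH s.+1 M abM oM) _.
  by rewrite leq_mul2l leq_exp2l ?prime_gt1 // leq_mul2l leq_sub2l ?orbT //.
apply: leq_trans (leq_mul (leqnn _) (IH s M abM oM)) _.
by rewrite mulnCA -expnD mulSn.
Qed.

(** The bound keeps one of the two terms of the q-Pascal rule, which corresponds
to the echelon forms whose pivots come first. *)
Lemma count_subgroups_lower p r s E : prime p -> p.-abelem E -> #|E| = (p ^ r)%N -> s <= r ->
  p ^ (s * (r - s)) <= count_subgroups p s E.
Proof.
move=> pr; elim: r s E => [|r IH] [|s] E ab oE; rewrite ?count_subgroups0 ?bin0 //.
move=> sr.
have [M [sM abM oM]] := hyperplane_exists pr ab oE.
rewrite (count_subgroups_hyperplane pr ab sM oE oM).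
apply: leq_trans (leq_addl _ _).
rewrite subSS mulSn expnD leq_mul2l IH ?orbT //.
Qed.

Lemma card_subgroups_abelem_sum p r E : prime p -> p.-abelem E -> #|E| = (p ^ r)%N ->
  #|subgroups E| <= \sum_(s < r.+1) count_subgroups p s E.
Proof.
move=> pr ab oE; rewrite /subgroups -sum1_card.
rewrite (partition_big (fun H : {group gT} => inord (logn p #|H|) : 'I_r.+1) xpredT) //=.
apply: leq_sum => s _; rewrite sum1_card subset_leq_card //; apply/subsetP => H.
rewrite unfold_in /= inE => /andP[sH /eqP <-]; rewrite inE sH /=.
have pH := pgroupS sH (abelem_pgroup ab).
rewrite inordK -?(card_pgroup pH) // ltnS -(pfactorK r pr) -oE.
by rewrite dvdn_leq_log ?cardG_gt0 // cardSg.
Qed.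

(** s (r - s) is at most r ^ 2 / 4, and the binomial coefficients add up to 2 ^ r. *)
Lemma card_subgroups_abelem p r E : prime p -> p.-abelem E -> #|E| = (p ^ r)%N ->
  #|subgroups E| <= 2 ^ r * p ^ (r ^ 2 %/ 4).
Proof.
move=> pr ab oE; apply: leq_trans (card_subgroups_abelem_sum pr ab oE) _.
rewrite -[2%N]/(1 + 1)%N Pascal big_distrl /=; apply: leq_sum => s _.
rewrite !exp1n !muln1; apply: leq_trans (count_subgroups_upper s pr ab oE) _.
rewrite leq_mul2l leq_exp2l ?prime_gt1 // leq_divRL //.
have sr : s <= r by rewrite -ltnS.
have := nat_AGM2 s (r - s); rewrite subnKC // => h.
by rewrite mulnC h orbT.
Qed.

End CountSubgroups.

(** * Subgroups of finite abelian groups *)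

Section AbelianSubgroups.
Import GroupScope.
Variable gT : finGroupType.
Implicit Types (A E M H K : {group gT}).

Definition power_torsion (p : nat) (A : {set gT}) : {set gT} := [set x in A | x ^+ p == 1].

Section Power.
Variables (A : {group gT}) (p : nat).
Hypothesis cAA : abelian A.
Hypothesis pr : prime p.

Lemma powerM : {in A &, {morph (fun x => x ^+ p) : x y / x * y}}.
Proof. by move=> x y xA yA; rewrite expgMn //; apply: (centsP cAA). Qed.

Definition power_morphism := Morphism powerM.
Local Notation f := power_morphism.

Lemma power_image_sub H : H \subset A -> f @* H \subset H.
Proof.
move=> sHA; apply/subsetP => _ /morphimP[x xA xH ->] /=.
exact: groupX.
Qed.

Lemma ker_power : 'ker f = power_torsion p A.
Proof. by apply/setP => x; rewrite !inE. Qed.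

Lemma power_torsion_abelem : p.-abelem ('ker f).
Proof.
apply/(abelemP pr); split; first exact: abelianS (subsetIl _ _) cAA.
move=> x xK; have : x \in 'ker f := xK.
by rewrite ker_power inE => /andP[_ /eqP].
Qed.

Lemma card_power_torsion : #|power_torsion p A| = (p ^ logn p #|power_torsion p A|)%N.
Proof. by rewrite -ker_power {1}(card_pgroup (abelem_pgroup power_torsion_abelem)). Qed.

(** All H with p-th power image K contain K and lie in the preimage B
of K, and B / K is elementary abelian of the same order as the p-torsion. *)
Lemma card_fiber K r : #|power_torsion p A| = (p ^ r)%N -> K \subset f @* A ->
  #|[set H : {group gT} | (H \subset A) && ((f @* H)%G == K)]| <=
  2 ^ r * p ^ (r ^ 2 %/ 4).
Proof.
move=> or sKfA; set F := [set _ | _].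
have [->|[H0]] := set_0Vmem F; first by rewrite cards0.
rewrite inE => /andP[sH0 /eqP e0].
have sKA : K \subset A by apply: subset_trans sKfA (power_image_sub (subxx A)).
pose B := (f @*^-1 K)%G.
have sBA : B \subset A by exact: subsetIl.
have cBB : abelian B := abelianS sBA cAA.
have sHB H : H \in F -> [/\ H \subset B, K \subset H & K <| H].
  rewrite inE => /andP[sH /eqP e].
  have sKH : K \subset H by rewrite -e; exact: power_image_sub.
  split=> //; last by rewrite -(sub_abelian_normal _ (abelianS sH cAA)).
  by rewrite -sub_morphim_pre // -e.
have sKB : K \subset B.
  have [|h1 h2 _] := sHB H0; first by rewrite inE sH0 e0 eqxx.
  exact: subset_trans h2 h1.
have nKB : K <| B by rewrite -(sub_abelian_normal _ cBB).
have abQ : p.-abelem (B / K).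
  apply/(abelemP pr); split; first exact: quotient_abelian.
  move=> _ /morphimP[x xN xB ->] /=; rewrite -morphX //; apply: coset_id.
  by move: xB; rewrite !inE => /andP[].
have oQ : #|B / K| = (p ^ r)%N.
  rewrite card_quotient ?normal_norm // -divgS //= card_morphpre //.
  by rewrite ker_power or mulnK.
apply: leq_trans (card_subgroups_abelem pr abQ oQ).
rewrite -(card_in_imset (f := fun H : {group gT} => (H / K)%G)).
  apply: subset_leq_card; apply/subsetP => _ /imsetP[H HF ->].
  by rewrite inE quotientS //; case: (sHB H HF).
move=> H1 H2 H1F H2F /(congr1 val) /= e.
apply: (@quotient_injG _ K) => //.
  by case: (sHB H1 H1F).
by case: (sHB H2 H2F).
Qed.

Lemma card_subgroups_power r : #|power_torsion p A| = (p ^ r)%N ->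
  #|subgroups A| <= 2 ^ r * p ^ (r ^ 2 %/ 4) * #|subgroups (f @* A)|.
Proof.
move=> or; rewrite -[#|subgroups A|]sum1_card.
rewrite (partition_big (fun H : {group gT} => (f @* H)%G)
   (fun K : {group gT} => K \in subgroups (f @* A))) /=; last first.
  by move=> H; rewrite !inE => sH; exact: morphimS.
rewrite mulnC -sum_nat_const; apply: leq_sum => K; rewrite inE => sK.
apply: leq_trans (card_fiber or sK).
rewrite sum1_card subset_leq_card //; apply/subsetP => H.
by rewrite unfold_in /= => /andP[]; rewrite !inE => -> ->.
Qed.

Lemma card_subgroups_lower r s : p ^ r <= #|power_torsion p A| -> s <= r ->
  p ^ (s * (r - s)) <= #|subgroups A|.
Proof.
move=> rt sr; have := card_power_torsion; set r' := logn p _ => or.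
have rr : r <= r' by move: rt; rewrite or leq_exp2l ?prime_gt1.
have or' : #|'ker f| = (p ^ r')%N by rewrite ker_power.
apply: (@leq_trans (p ^ (s * (r' - s)))).
  by rewrite leq_exp2l ?prime_gt1 // leq_mul2l leq_sub2r ?orbT.
apply: leq_trans (count_subgroups_lower pr power_torsion_abelem or' (leq_trans sr rr)) _.
apply: subset_leq_card; apply/subsetP => H; rewrite !inE => /andP[sH _].
exact: subset_trans sH (subsetIl _ _).
Qed.

End Power.

(** Induction on A through the image of the p-th power map, for a prime p
dividing #|A|. The exponent rho + 4 of the order of the p-torsion pays for
16 ^ r (4 units, as 16 is at most p ^ 4) and for p ^ (r ^ 2) (rho units, as
r is at most rho). Fourth powers avoid the fractional exponent r ^ 2 / 4. *)
Lemma card_subgroups_upper A rho : abelian A ->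
  (forall p, prime p -> #|power_torsion p A| <= p ^ rho) ->
  #|subgroups A| ^ 4 <= #|A| ^ (rho + 4).
Proof.
elim: {A}_.+1 {-2}A (ltnSn #|A|) => // n IH A; rewrite ltnS => leA cAA ht.
have [A1|ntA] := eqVneq #|A| 1%N.
  rewrite A1 exp1n (_ : #|subgroups A| = 1%N) ?exp1n //.
  rewrite (_ : subgroups A = [set 1%G]) ?cards1 //; apply/setP => H.
  rewrite !inE; have /eqP -> : A :==: 1 by rewrite trivg_card1 A1.
  by rewrite subG1 -val_eqE.
have A_gt1 : 1 < #|A| by rewrite ltn_neqAle eq_sym ntA cardG_gt0.
pose p := pdiv #|A|; have pr : prime p by exact: pdiv_prime.
pose f := power_morphism p cAA.
have := card_power_torsion cAA pr; set r := logn p _ => or.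
have [x xA ox] := Cauchy pr (pdiv_dvd #|A|).
have r_gt0 : 0 < r.
  rewrite lt0n; apply/eqP => r0; move: or; rewrite r0 expn0 => /eqP.
  rewrite -(ker_power p cAA) -trivg_card1 => /eqP k1.
  have xp : x ^+ p = 1 by have := expg_order x; rewrite ox.
  have : x \in 'ker f by rewrite ker_power inE xA xp eqxx.
  rewrite k1 inE => /eqP x1; move: ox; rewrite x1 order1 => p1.
  by have := prime_gt1 pr; rewrite -p1.
have oA : #|A| = (p ^ r * #|f @* A|)%N.
  have := @card_morphpre _ _ _ f (f @* A)%G (subxx (f @* A)) => /=; rewrite ker_power or => <-.
  by rewrite morphimGK ?subsetIl.
have sfA : f @* A \subset A by exact: power_image_sub.
have rrho : r <= rho.
  by have := ht p pr; rewrite or leq_exp2l ?prime_gt1.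
have IHf : #|subgroups (f @* A)| ^ 4 <= #|f @* A| ^ (rho + 4).
  apply: (IH (f @* A)%G).
  - apply: leq_trans leA; rewrite oA ltn_Pmull ?cardG_gt0 //.
    by rewrite -{1}(expn0 p) ltn_exp2l ?prime_gt1.
  - exact: abelianS sfA cAA.
  move=> q prq; apply: leq_trans (ht q prq); apply: subset_leq_card.
  by apply/subsetP => z; rewrite !inE => /andP[/(subsetP sfA) -> ->].
have step := card_subgroups_power cAA pr or.
apply: (@leq_trans ((2 ^ r * p ^ (r ^ 2 %/ 4) * #|subgroups (f @* A)|) ^ 4)).
  by rewrite leq_exp2r.
rewrite oA !expnMn; apply: leq_mul => //.
rewrite -!expnM.
apply: (@leq_trans (p ^ (r * 4) * p ^ (r ^ 2))).
  apply: leq_mul; first by rewrite leq_exp2r ?prime_gt1 // muln_gt0 r_gt0.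
  by rewrite leq_exp2l ?prime_gt1 // leq_divM.
rewrite -expnD leq_exp2l ?prime_gt1 // mulnDr [X in _ <= X]addnC leq_add2l.
by rewrite -mulnn leq_mul2l rrho orbT.
Qed.

End AbelianSubgroups.

(** * Roots of unity modulo n *)

Definition roots_of_one (n p : nat) : {set 'I_n} := [set i : 'I_n | i ^ p == 1 %[mod n]].

Section Multiplicative.
Variables (m n : nat).
Hypotheses (m0 : 0 < m) (n0 : 0 < n) (cop : coprime m n).

Definition crt_pair (i : 'I_(m * n)) : 'I_m * 'I_n :=
  (Ordinal (ltn_pmod i m0), Ordinal (ltn_pmod i n0)).

Lemma crt_pair_inj : injective crt_pair.
Proof.
move=> i j [] e1 e2; apply: val_inj => /=.
have : i == j %[mod m * n] by rewrite chinese_remainder // e1 e2 !eqxx.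
by rewrite !modn_small // => /eqP.
Qed.

Lemma card_roots_of_one_mul p :
  #|roots_of_one (m * n) p| = #|roots_of_one m p| * #|roots_of_one n p|.
Proof.
rewrite -cardsX.
have bij : bijective crt_pair.
  by apply: inj_card_bij; [exact: crt_pair_inj | rewrite card_prod !card_ord].
rewrite -(on_card_preimset (f := crt_pair) (R := setX (roots_of_one m p) (roots_of_one n p))).
  apply: eq_card => i; rewrite !inE /= chinese_remainder //.
  by rewrite !modnXm.
exact: onW_bij.
Qed.
End Multiplicative.

(** The cofactor of i - j in i ^ p - j ^ p, which controls how far a solution of
i ^ p = 1 is determined by its residue modulo d. *)
Lemma geom_sum_mod (d p i j : nat) : i = j %[mod d] ->
  \sum_(k < p) i ^ (p.-1 - k) * j ^ k = p * j ^ p.-1 %[mod d].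
Proof.
move=> e; rewrite -modn_summ.
rewrite (eq_bigr (fun=> j ^ p.-1 %% d)); last first.
  move=> k _; rewrite -modnMml -modnXm e modnXm modnMml -expnD subnK //.
  by case: p k => [[]|p k] //; rewrite -ltnS /= ltn_ord.
by rewrite sum_nat_const card_ord modnMmr.
Qed.

Lemma root_of_one_ndvd q a p i : prime q -> 0 < a -> 0 < p ->
  i ^ p = 1 %[mod q ^ a] -> ~~ (q %| i).
Proof.
move=> pq a0 p0 e; apply/negP => qi.
have : q %| i ^ p by rewrite Euclid_dvdX // qi.
have e' : i ^ p = 1 %[mod q].
  have dq : q %| q ^ a by rewrite -{1}(expn1 q) dvdn_exp2l.
  by rewrite -(modn_dvdm _ dq) e modn_dvdm.
by rewrite /dvdn e' modn_small ?prime_gt1.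
Qed.

Lemma dvdn_diff_roots p n i j : j <= i -> i ^ p = 1 %[mod n] -> j ^ p = 1 %[mod n] ->
  n %| (i - j) * \sum_(k < p) i ^ (p.-1 - k) * j ^ k.
Proof.
move=> ji ei ej; rewrite -subn_exp -eqn_mod_dvd; first by rewrite ei ej.
by case: (p) => // p'; rewrite leq_exp2r.
Qed.

(** Two solutions that agree modulo q differ by a factor of i ^ p - j ^ p whose
cofactor is p j ^ (p - 1) modulo q, hence a unit. *)
Lemma roots_of_one_reduce_inj q a p : prime q -> prime p -> q != p -> 0 < a ->
  forall i j : 'I_(q ^ a), i \in roots_of_one (q ^ a) p -> j \in roots_of_one (q ^ a) p ->
  i = j %[mod q] -> i = j.
Proof.
move=> pq pp qp a0 i j; rewrite !inE => /eqP ei /eqP ej e; apply: val_inj => /=.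
wlog ji : i j ei ej e / j <= i.
  by move=> H; case/orP: (leq_total i j) => h; [apply/esym|]; exact: H.
have p0 := prime_gt0 pp.
have d := dvdn_diff_roots ji ei ej.
have nS : ~~ (q %| \sum_(k < p) i ^ (p.-1 - k) * j ^ k).
  rewrite /dvdn (geom_sum_mod _ e) -/(dvdn _ _) Euclid_dvdM // negb_or.
  rewrite dvdn_prime2 // qp /=; apply: contra (root_of_one_ndvd pq a0 p0 ej).
  by rewrite Euclid_dvdX // => /andP[].
move: d; rewrite Gauss_dvdl; last by rewrite coprime_pexpl // prime_coprime.
by rewrite -eqn_mod_dvd // !modn_small // => /eqP.
Qed.

(** The polynomial X ^ p - 1 has at most p roots in the field F_q. *)
Lemma card_roots_of_one_prime q p : prime q -> 0 < p -> #|roots_of_one q p| <= p.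
Proof.
move=> pq p0.
rewrite cardE -(size_map (fun i : 'I_q => ((i : nat)%:R : 'F_q)%R)).
apply: (@max_unity_roots 'F_q) => //.
  apply/allP => _ /mapP[i + ->]; rewrite mem_enum inE => /eqP e.
  apply/unity_rootP; rewrite -GRing.natrX; apply: val_inj.
  by rewrite /= val_Fp_nat // e -val_Fp_nat.
rewrite map_inj_uniq ?enum_uniq // => i j /(congr1 (fun x : 'F_q => x : nat)).
by rewrite /= !val_Fp_nat // !modn_small // => /val_inj.
Qed.

Lemma card_roots_of_one_coprime_pow q a p : prime q -> prime p -> q != p -> 0 < a ->
  #|roots_of_one (q ^ a) p| <= p.
Proof.
move=> pq pp qp a0; apply: leq_trans (card_roots_of_one_prime pq (prime_gt0 pp)).
have q0 := prime_gt0 pq.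
pose f (i : 'I_(q ^ a)) := Ordinal (ltn_pmod i q0).
rewrite -(card_in_imset (f := f)); last first.
  by move=> i j iS jS [] e; exact: (roots_of_one_reduce_inj pq pp qp a0 iS jS e).
apply: subset_leq_card; apply/subsetP => _ /imsetP[i + ->]; rewrite !inE => /eqP e.
have dq : q %| q ^ a by rewrite -{1}(expn1 q) dvdn_exp2l.
by rewrite /= modnXm -(modn_dvdm _ dq) e modn_dvdm.
Qed.

(** When two solutions agree modulo p ^ 2, the cofactor of i - j is exactly
divisible by p, so they agree modulo p ^ (a - 1). A solution is thus determined
by its residue modulo p ^ 2 and its leading base-p digit. The crude exponent 3
costs only a bounded amount, as it occurs for a single prime power of n. *)
Lemma card_roots_of_one_same_pow a p : prime p -> 0 < a ->
  #|roots_of_one (p ^ a) p| <= p ^ 3.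
Proof.
move=> pp a0; have p0 := prime_gt0 pp.
have pa0 : 0 < p ^ a.-1 by rewrite expn_gt0 p0.
have p20 : 0 < p ^ 2 by rewrite expn_gt0 p0.
have lt2 (i : 'I_(p ^ a)) : i %/ p ^ a.-1 < p.
  by rewrite ltn_divLR // -expnS prednK.
pose f (i : 'I_(p ^ a)) := (Ordinal (ltn_pmod i p20), Ordinal (lt2 i)).
rewrite -(card_in_imset (f := f)); last first.
  move=> i j; rewrite !inE => /eqP ei /eqP ej [] e1 e2; apply: val_inj => /=.
  suff : i == j %[mod p ^ a.-1].
    by move=> /eqP e; rewrite (divn_eq i (p ^ a.-1)) (divn_eq j (p ^ a.-1)) e2 e.
  wlog ji : i j ei ej e1 e2 / j <= i.
    move=> H; case/orP: (leq_total i j) => h; last exact: H.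
    by rewrite eq_sym; exact: H.
  have d := dvdn_diff_roots ji ei ej.
  have nj : ~~ (p %| j) := root_of_one_ndvd pp a0 p0 ej.
  set S := \sum_(k < p) _ in d.
  have eS : S = p * j ^ p.-1 %[mod p ^ 2] by exact: geom_sum_mod.
  have pS : p %| S.
    have dp : p %| p ^ 2 by rewrite -mulnn dvdn_mulr.
    by rewrite /dvdn -(modn_dvdm _ dp) eS modn_dvdm // modnMr.
  case/dvdnP: pS => S' eS'; rewrite eS' in d eS.
  have nS' : ~~ (p %| S').
    apply/negP => pS'; have : p ^ 2 %| S' * p by rewrite -mulnn dvdn_mul.
    rewrite /dvdn eS -/(dvdn _ _) -mulnn dvdn_pmul2l // Euclid_dvdX //.
    by rewrite (negPf nj).
  have ea : p ^ a = p ^ a.-1 * p by rewrite -expnSr prednK.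
  move: d; rewrite mulnA [X in X %| _]ea dvdn_pmul2r //= Gauss_dvdl.
    by rewrite -eqn_mod_dvd.
  by rewrite coprimeXl // prime_coprime.
apply: leq_trans (max_card _) _.
by rewrite card_prod !card_ord -expnSr.
Qed.

Lemma primes_mul_prime_pow q a m : prime q -> 0 < a -> 0 < m -> ~~ (q %| m) ->
  size (primes (q ^ a * m)) = (size (primes m)).+1.
Proof.
move=> pq a0 m0 nm.
have qa0 : 0 < q ^ a by rewrite expn_gt0 prime_gt0.
have : perm_eq (primes (q ^ a * m)) (q :: primes m).
  apply: uniq_perm; rewrite ?primes_uniq //= ?primes_uniq ?andbT.
    by rewrite mem_primes (negPf nm) !andbF.
  by move=> r; rewrite primesM // primesX // primes_prime // !inE.
by move/perm_size.
Qed.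

Lemma card_roots_of_one_le n p : prime p -> 0 < n ->
  #|roots_of_one n p| <= p ^ (size (primes n) + (p %| n) * 2).
Proof.
move=> pp; elim/ltn_ind: n => n IH n0.
have p0 := prime_gt0 pp.
have [n1|n1] := leqP n 1.
  apply: leq_trans (max_card _) _; rewrite card_ord (leq_trans n1) //.
  by rewrite expn_gt0 p0.
pose q := pdiv n; have pq : prime q by exact: pdiv_prime.
pose a := logn q n; have a0 : 0 < a by rewrite logn_gt0 mem_primes pq n0 pdiv_dvd.
pose m := n`_q^'.
have en : n = q ^ a * m by rewrite -[LHS](partnC q n0) p_part.
have m0 : 0 < m by exact: part_gt0.
have nqm : ~~ (q %| m).
  by rewrite -p'natE // part_pnat.
clearbody m; clearbody a; clearbody q.
have qa1 : 1 < q ^ a by rewrite -(expn0 q) ltn_exp2l ?prime_gt1.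
have mn : m < n by rewrite en ltn_Pmull.
have cop : coprime (q ^ a) m by rewrite coprimeXl // prime_coprime.
have qa0 : 0 < q ^ a by exact: ltnW.
rewrite en card_roots_of_one_mul // primes_mul_prime_pow //.
have IHm := IH m mn m0.
have [qp|qp] := eqVneq q p.
  subst q; rewrite (negPf nqm) addn0 in IHm.
  rewrite Euclid_dvdM // Euclid_dvdX // dvdnn a0 /= mul1n addSn -addnS addnC expnD.
  apply: leq_mul IHm; exact: card_roots_of_one_same_pow.
rewrite Euclid_dvdM // Euclid_dvdX // dvdn_prime2 // eq_sym (negPf qp) /=.
rewrite addSn expnS; apply: leq_mul IHm.
exact: card_roots_of_one_coprime_pow.
Qed.

(** Cauchy provides an element of order p in the units of F_q, whose powers are p solutions. *)
Lemma card_roots_of_one_prime_ge q p : prime q -> prime p -> q = 1 %[mod p] ->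
  p <= #|roots_of_one q p|.
Proof.
move=> pq pp e.
have q1 := prime_gt1 pq; have p0 := prime_gt0 pp.
have dp : p %| #|[set: {unit 'F_q}]|.
  rewrite card_finField_unit card_Fp // -subn1 -eqn_mod_dvd ?prime_gt0 //.
  exact/eqP.
have [x _ ox] := Cauchy pp dp.
have lt (k : 'I_p) : (val (x ^+ k)%g : 'F_q) < q.
  by rewrite -[X in _ < X](Fp_cast pq) ltn_ord.
pose f (k : 'I_p) : 'I_q := Ordinal (lt k).
rewrite -[p in p <= _]card_ord -(card_imset (f := f)).
  apply: subset_leq_card; apply/subsetP => _ /imsetP[k _ ->]; rewrite inE /=.
  set z : 'F_q := val _.
  have z1 : (z ^+ p = 1)%R.
    rewrite /z -FinRing.val_unitX -expgM mulnC expgM.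
    by have := expg_order x; rewrite ox => ->; rewrite expg1n.
  have h : (((z : nat) ^ p)%:R = 1%:R :> 'F_q)%R by rewrite GRing.natrX natr_Zp.
  have := congr1 (fun u : 'F_q => nat_of_ord u) h.
  by rewrite (val_Fp_nat pq) (val_Fp_nat pq) => ->.
move=> i j /(congr1 val) /= /val_inj /val_inj /eqP.
by rewrite eq_expg_mod_order ox !modn_small // => /eqP /val_inj.
Qed.

Lemma card_roots_of_one_prod (s : seq nat) p : prime p -> uniq s ->
  (forall q, q \in s -> prime q && (q %% p == 1)) ->
  p ^ size s <= #|roots_of_one (\prod_(q <- s) q) p|.
Proof.
move=> pp; elim: s => [_ _|q s IH /= /andP[qs us] H].
  rewrite big_nil /= expn0 card_gt0; apply/set0Pn; exists ord0.
  by rewrite inE !modn1.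
have /andP[pq eq] : prime q && (q %% p == 1) by apply: H; rewrite mem_head.
have Hs r : r \in s -> prime r && (r %% p == 1) by move=> rs; apply: H; rewrite in_cons rs orbT.
have s0 : 0 < \prod_(r <- s) r.
  rewrite big_seq; elim/big_ind: _ => // [a b a0 b0|r rs]; first by rewrite muln_gt0 a0.
  by have /andP[/prime_gt0] := Hs r rs.
have cop : coprime q (\prod_(r <- s) r).
  rewrite big_seq; elim/big_ind: _ => [|a b ca cb|r rs]; first exact: coprimen1.
    by rewrite coprimeMr ca.
  have /andP[pr _] := Hs r rs.
  rewrite prime_coprime // dvdn_prime2 //; apply: contra qs => /eqP ->.
  by [].
have q0 := prime_gt0 pq.
rewrite big_cons (card_roots_of_one_mul q0 s0 cop) (expnS p (size s)); apply: leq_mul.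
  apply: card_roots_of_one_prime_ge => //.
  by rewrite (eqP eq) modn_small ?prime_gt1.
exact: IH.
Qed.

(** * Subgroups of the group of units modulo n *)

Lemma card_power_torsion_units n p : 1 < n -> prime p ->
  #|power_torsion p (units_Zp n)| = #|roots_of_one n p|.
Proof.
case: n => [|[|n]] // _ pp.
pose f (x : {unit 'Z_n.+2}) : 'I_n.+2 := val x.
have fi : injective f by move=> x y /val_inj.
rewrite -(card_imset _ fi); apply: eq_card => i.
have valX (z : 'Z_n.+2) k : nat_of_ord (z ^+ k)%R = (z ^ k) %% n.+2.
  by rewrite -{1}[z]natr_Zp -GRing.natrX val_Zp_nat.
rewrite inE; apply/imsetP/eqP => [[x]|e].
  rewrite !inE => /eqP xp ->; rewrite -(valX (f x)) /f -FinRing.val_unitX xp.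
  by rewrite modn_small.
have iu : ((i : 'Z_n.+2) \is a GRing.unit)%R.
  rewrite -[i]natr_Zp unitZpE // -(coprime_pexpr _ _ (prime_gt0 pp)).
  by rewrite -coprime_modr e modn_small // coprimen1.
exists (FinRing.unit 'Z_n.+2 iu) => //.
rewrite !inE /=; apply/eqP; apply: val_inj; rewrite FinRing.val_unitX /=.
by apply: val_inj; rewrite /= valX e.
Qed.

Lemma G_upper n : 0 < n -> G n ^ 4 <= n ^ (size (primes n) + 6).
Proof.
move=> n0; have oU : #|units_Zp n| <= n.
  rewrite card_units_Zp // totient_count_coprime.
  by rewrite -[leqRHS]muln1 -[n in n * 1]subn0 -sum_nat_const_nat; apply: leq_sum => i _; case: coprime.
have [n1|n1] := leqP n 1.
  have -> : n = 1 by lia.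
  have h : #|units_Zp 1| = 1 by rewrite card_units_Zp.
  have := @card_subgroups_upper _ _ 0 (units_Zp_abelian 1).
  rewrite h !exp1n; apply=> p pr; rewrite expn0 -[leqRHS]h.
  by apply: subset_leq_card; apply/subsetP => x; rewrite inE => /andP[].
apply: (@leq_trans (#|units_Zp n| ^ (size (primes n) + 2 + 4))).
  apply: card_subgroups_upper; first exact: units_Zp_abelian.
  move=> p pr; rewrite card_power_torsion_units //.
  apply: leq_trans (card_roots_of_one_le pr n0) _.
  by rewrite leq_exp2l ?prime_gt1 // leq_add2l; case: (_ %| _).
by rewrite -addnA leq_exp2r // addn_gt0 orbT.
Qed.

Lemma G_lower (s : seq nat) p t : prime p -> uniq s ->
  (forall q, q \in s -> prime q && (q %% p == 1)) -> t <= size s ->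
  p ^ (t * (size s - t)) <= G (\prod_(q <- s) q).
Proof.
move=> pp us Hs ts.
have [s0|s0] := posnP (size s).
  move: ts; rewrite s0 leqn0 => /eqP ->; rewrite mul0n expn0 card_gt0.
  by apply/set0Pn; exists 1%G; rewrite inE sub1G.
have n1 : 1 < \prod_(q <- s) q.
  case: s s0 Hs {us ts} => // q s _ Hs; rewrite big_cons.
  have /andP[pq _] := Hs q (mem_head _ _).
  apply: leq_trans (prime_gt1 pq) _; rewrite leq_pmulr // big_seq.
  elim/big_ind: _ => // [a b a0 b0|r rs]; first by rewrite muln_gt0 a0.
  have rqs : r \in q :: s by rewrite in_cons rs orbT.
  by have /andP[/prime_gt0] := Hs r rqs.
apply: card_subgroups_lower => //; first exact: units_Zp_abelian.
by rewrite card_power_torsion_units //; exact: card_roots_of_one_prod.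
Qed.

From mathcomp Require Import all_classical all_reals all_analysis.
From mathcomp Require Import zify ring lra.
Import Order.TTheory GRing.Theory Num.Theory.
Import numFieldNormedType.Exports.
Local Open Scope ring_scope.

(** * Trigonometric sums *)

Section Trig.
Variable R : realType.
Implicit Types (x t phi : R).

Lemma sin_sum_telescope phi m0 M :
  2 * sin phi * (\sum_(m0 <= m < m0 + M) cos (2 * m%:R * phi)) =
  sin ((2 * (m0 + M)%:R - 1) * phi) - sin ((2 * m0%:R - 1) * phi).
Proof.
rewrite big_distrr /=.
rewrite (eq_bigr (fun m : nat => sin ((2 * m.+1%:R - 1) * phi) -
                           sin ((2 * m%:R - 1) * phi))).
  rewrite telescope_sumr //; lia.
move=> m _.
have -> : (2 * m.+1%:R - 1) * phi = 2 * m%:R * phi + phi by rewrite -natr1; ring.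
have -> : (2 * m%:R - 1) * phi = 2 * m%:R * phi - phi by ring.
by rewrite sinD sinB; ring.
Qed.

Lemma cos_sum_telescope phi m0 M :
  2 * sin phi * (\sum_(m0 <= m < m0 + M) sin (2 * m%:R * phi)) =
  cos ((2 * m0%:R - 1) * phi) - cos ((2 * (m0 + M)%:R - 1) * phi).
Proof.
rewrite big_distrr /=.
rewrite (eq_bigr (fun m : nat => - cos ((2 * m.+1%:R - 1) * phi) -
                           - cos ((2 * m%:R - 1) * phi))).
  rewrite (@telescope_sumr _ _ _ (fun m : nat => - cos ((2 * m%:R - 1) * phi))); last lia.
  by ring.
move=> m _.
have -> : (2 * m.+1%:R - 1) * phi = 2 * m%:R * phi + phi by rewrite -natr1; ring.
have -> : (2 * m%:R - 1) * phi = 2 * m%:R * phi - phi by ring.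
by rewrite cosD cosB; ring.
Qed.

Lemma dirichlet_kernel_cos phi m0 M : sin phi != 0 ->
  `|\sum_(m0 <= m < m0 + M) cos (2 * m%:R * phi)| <= `|sin phi|^-1.
Proof.
move=> s0; have := sin_sum_telescope phi m0 M.
set S := \sum_(_ <= _ < _) _ => E.
have s1 : 0 < `|sin phi| by rewrite normr_gt0.
rewrite -[leRHS]mul1r ler_pdivlMr // -normrM.
have -> : S * sin phi = (2 * sin phi * S) / 2 by field.
rewrite E normrM [`|2^-1|]ger0_norm // ler_pdivrMr // mul1r.
rewrite (le_trans (ler_normB _ _)) //.
by have -> : (2 : R) = 1 + 1 by []; rewrite lerD // sin_max.
Qed.

Lemma dirichlet_kernel_sin phi m0 M : sin phi != 0 ->
  `|\sum_(m0 <= m < m0 + M) sin (2 * m%:R * phi)| <= `|sin phi|^-1.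
Proof.
move=> s0; have := cos_sum_telescope phi m0 M.
set S := \sum_(_ <= _ < _) _ => E.
have s1 : 0 < `|sin phi| by rewrite normr_gt0.
rewrite -[leRHS]mul1r ler_pdivlMr // -normrM.
have -> : S * sin phi = (2 * sin phi * S) / 2 by field.
rewrite E normrM [`|2^-1|]ger0_norm // ler_pdivrMr // mul1r.
rewrite (le_trans (ler_normB _ _)) //.
by have -> : (2 : R) = 1 + 1 by []; rewrite lerD // cos_max.
Qed.

Lemma norm_sinDnatpi x k : `|sin (x + k%:R * pi)| = `|sin x|.
Proof.
elim: k => [|k IH]; first by rewrite mul0r addr0.
by rewrite -natr1 mulrDl mul1r addrA sinDpi normrN IH.
Qed.

Lemma sinD_nat2pi x k : sin (x + 2 * k%:R * pi) = sin x.
Proof.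
elim: k => [|k IH]; first by rewrite mulr0 mul0r addr0.
have -> : x + 2 * k.+1%:R * pi = (x + 2 * k%:R * pi) + pi *+ 2.
  by rewrite -natr1 mulr2n; ring.
by rewrite sinD2pi IH.
Qed.

Lemma cosD_nat2pi x k : cos (x + 2 * k%:R * pi) = cos x.
Proof.
elim: k => [|k IH]; first by rewrite mulr0 mul0r addr0.
have -> : x + 2 * k.+1%:R * pi = (x + 2 * k%:R * pi) + pi *+ 2.
  by rewrite -natr1 mulr2n; ring.
by rewrite cosD2pi IH.
Qed.

Lemma cos_piquarter_ge : 2^-1 <= cos (pi / 4) :> R.
Proof.
have h := @cos_mulr2n R (pi / 4).
have e : (pi / 4) *+ 2 = pi / 2 :> R by rewrite -mulr_natr; field.
rewrite e cos_pihalf in h.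
have c0 : 0 <= cos (pi / 4) :> R.
  by apply: cos_ge0_pihalf; have := @pi_gt0 R => ?; apply/andP; split; lra.
have h2 : cos (pi / 4) ^+ 2 = 2^-1 :> R by move: h; rewrite mulr2n; lra.
by rewrite leNgt; apply/negP => h3; nra.
Qed.

(** A weak form of the Jordan inequality. *)
Lemma sin_ge_quarter x : 0 <= x <= pi / 2 -> x / 4 <= sin x.
Proof.
move=> /andP[x0 xp].
have p0 := @pi_gt0 R; have p2 := @pihalf_lt2 R.
have [xq|xq] := leP x (pi / 4); last first.
  have : sin (pi / 4) <= sin x.
    by rewrite ltW // ltr_sin // ?in_itv /=; try (apply/andP; split); lra.
  have : sin (pi / 4) = cos (pi / 4) :> R.
    rewrite -[RHS]sinDpihalf.
    have -> : pi / 4 + pi / 2 = pi - pi / 4 :> R by field.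
    by rewrite sinB sinpi cospi; ring.
  by have := cos_piquarter_ge; lra.
move: x0; rewrite le_eqVlt => /orP[/eqP <-|x0]; first by rewrite sin0 mul0r.
have [c] := @MVT R sin cos 0 x x0 (fun y _ => is_derive_sin y)
  (fun y => @continuous_subspaceT _ _ _ _ (@continuous_sin R) y).
rewrite in_itv /= sin0 !subr0 => /andP[c0 cx] ->.
rewrite mulrC ler_wpM2r //; first exact: ltW.
rewrite (@le_trans _ _ (cos (pi / 4))) //.
  by have := cos_piquarter_ge; lra.
by rewrite ltW // ltr_cos // ?in_itv /=; try (apply/andP; split); lra.
Qed.

Lemma sin_pi_ge t : 0 <= t <= 1 -> t * (1 - t) / 8 <= sin (pi * t).
Proof.
move=> /andP[t0 t1].
have p0 := @pi_gt0 R; have p2 := @pi_ge2 R.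
have -> : pi * t = (pi * t / 2) *+ 2 by rewrite -mulr_natr; field.
rewrite sin_mulr2n.
have h1 : pi * t / 2 / 4 <= sin (pi * t / 2).
  by apply: sin_ge_quarter; apply/andP; split; nra.
have -> : cos (pi * t / 2) = sin (pi * (1 - t) / 2).
  have -> : pi * (1 - t) / 2 = pi / 2 - pi * t / 2 by ring.
  by rewrite sinB sin_pihalf cos_pihalf; ring.
have h2 : pi * (1 - t) / 2 / 4 <= sin (pi * (1 - t) / 2).
  by apply: sin_ge_quarter; apply/andP; split; nra.
have g1 : t / 4 <= sin (pi * t / 2) by nra.
have g2 : (1 - t) / 4 <= sin (pi * (1 - t) / 2) by nra.
rewrite mulr2n.
have q1 : 0 <= t / 4 by lra.
have q2 : 0 <= (1 - t) / 4 by lra.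
by have := ler_pM q1 q2 g1 g2; nra.
Qed.

End Trig.

(** * A Schur bound and Fourier analysis modulo p *)

Section Dual.
Variable R : realType.

Lemma sqr_sum_double (I : finType) (P : pred I) (f : I -> R) :
  (\sum_(i | P i) f i) ^+ 2 = \sum_(i | P i) \sum_(j | P j) f i * f j.
Proof.
rewrite expr2 big_distrl /=; apply: eq_bigr => i _.
by rewrite big_distrr.
Qed.

(** Expand the square and apply the Schur test to the kernel. The sum inside
the square is the real part of a complex exponential sum; adding the square of
the imaginary part leaves a kernel in the differences phi r - phi s only. *)
Lemma trig_dual (I : finType) (P : pred I) (phi u v : I -> R)
    (kap : I -> I -> R) (K : R) m0 M :
  (forall r s, P r -> P s -> kap r s = kap s r) ->
  (forall r s, P r -> P s ->
    `|\sum_(m0 <= m < m0 + M) cos (2 * m%:R * (phi r - phi s))| <= kap r s) ->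
  (forall r s, P r -> P s ->
    `|\sum_(m0 <= m < m0 + M) sin (2 * m%:R * (phi r - phi s))| <= kap r s) ->
  (forall r, P r -> \sum_(s | P s) kap r s <= K) ->
  \sum_(m0 <= m < m0 + M) (\sum_(r | P r)
      (u r * cos (2 * m%:R * phi r) + v r * sin (2 * m%:R * phi r))) ^+ 2
  <= 2 * K * \sum_(r | P r) (u r ^+ 2 + v r ^+ 2).
Proof.
move=> kC kcos ksin kK.
pose F m r := u r * cos (2 * m%:R * phi r) + v r * sin (2 * m%:R * phi r).
pose H (m : nat) r := u r * sin (2 * m%:R * phi r) - v r * cos (2 * m%:R * phi r).
pose rho r := u r ^+ 2 + v r ^+ 2.
(* adding the square of the conjugate sum leaves only differences phi r - phi s *)
apply: (@le_trans _ _ (\sum_(m0 <= m < m0 + M)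
   ((\sum_(r | P r) F m r) ^+ 2 + (\sum_(r | P r) H m r) ^+ 2))).
  by apply: ler_sum => m _; rewrite lerDl sqr_ge0.
have E m : (\sum_(r | P r) F m r) ^+ 2 + (\sum_(r | P r) H m r) ^+ 2 =
  \sum_(r | P r) \sum_(s | P s)
    ((u r * u s + v r * v s) * cos (2 * m%:R * (phi r - phi s)) +
     (v r * u s - u r * v s) * sin (2 * m%:R * (phi r - phi s))).
  rewrite !sqr_sum_double -big_split /=; apply: eq_bigr => r _.
  rewrite -big_split /=; apply: eq_bigr => s _.
  have -> : 2 * m%:R * (phi r - phi s) =
            2 * m%:R * phi r - 2 * m%:R * phi s by ring.
  by rewrite cosB sinB /F /H; ring.
rewrite (eq_bigr _ (fun m _ => E m)) exchange_big /=.
apply: (@le_trans _ _ (\sum_(r | P r) \sum_(s | P s) kap r s * (rho r + rho s))).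
  apply: ler_sum => r Pr; rewrite exchange_big /=; apply: ler_sum => s Ps.
  rewrite big_split /= -!big_distrr /=.
  have c1 := kcos r s Pr Ps; have c2 := ksin r s Pr Ps.
  set X := \sum_(_ <= _ < _) _ in c1 *; set Y := \sum_(_ <= _ < _) _ in c2 *.
  have a1 : `|u r * u s + v r * v s| <= (rho r + rho s) / 2.
    by rewrite ler_norml /rho; apply/andP; split;
      have := sqr_ge0 (u r + u s); have := sqr_ge0 (v r + v s); have := sqr_ge0 (u r - u s); have := sqr_ge0 (v r - v s);
      have := sqr_ge0 (u r + v s); have := sqr_ge0 (v r + u s); have := sqr_ge0 (u r - v s); have := sqr_ge0 (v r - u s); nra.
  have a2 : `|v r * u s - u r * v s| <= (rho r + rho s) / 2.
    by rewrite ler_norml /rho; apply/andP; split;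
      have := sqr_ge0 (u r + u s); have := sqr_ge0 (v r + v s); have := sqr_ge0 (u r - u s); have := sqr_ge0 (v r - v s);
      have := sqr_ge0 (u r + v s); have := sqr_ge0 (v r + u s); have := sqr_ge0 (u r - v s); have := sqr_ge0 (v r - u s); nra.
  apply: (le_trans (ler_norm _)); apply: (le_trans (ler_normD _ _)).
  rewrite !normrM.
  have := ler_pM (normr_ge0 _) (normr_ge0 _) a1 c1.
  have := ler_pM (normr_ge0 _) (normr_ge0 _) a2 c2.
  by lra.
rewrite (eq_bigr (fun r => \sum_(s | P s) kap r s * rho r +
                           \sum_(s | P s) kap r s * rho s)); last first.
  by move=> r _; rewrite -big_split; apply: eq_bigr => s _; rewrite mulrDr.
rewrite big_split /=.
have -> : \sum_(r | P r) \sum_(s | P s) kap r s * rho s =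
          \sum_(r | P r) \sum_(s | P s) kap r s * rho r.
  rewrite exchange_big /=; apply: eq_bigr => r Pr; apply: eq_bigr => s Ps.
  by rewrite kC.
suff : \sum_(r | P r) \sum_(s | P s) kap r s * rho r <= K * \sum_(r | P r) rho r.
  by rewrite /rho; lra.
rewrite big_distrr /=; apply: ler_sum => r Pr; rewrite -big_distrl /= ler_wpM2r ?kK //.
by rewrite addr_ge0 // sqr_ge0.
Qed.

End Dual.

Section Fourier.
Variable R : realType.

Lemma cos_distn (a b : nat) (x : R) :
  cos (2 * `|a - b|%N%:R * x) = cos (2 * a%:R * x - 2 * b%:R * x).
Proof.
have [ab|ba] := leqP a b.
  by rewrite distnEr // natrB // -cosN; congr cos; ring.
by rewrite distnEl ?natrB 1?ltnW //; congr cos; ring.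
Qed.

Lemma sin_frac_neq0 p k : (0 < p)%N -> ~~ (p %| k)%N ->
  sin (pi * k%:R / p%:R) != 0 :> R.
Proof.
move=> p0 pk.
have p0R : (0 : R) < p%:R by rewrite ltr0n.
rewrite -normr_eq0.
have -> : pi * k%:R / p%:R = pi * (k %% p)%:R / p%:R + (k %/ p)%:R * pi :> R.
  rewrite {1}(divn_eq k p) natrD natrM; field.
  exact: lt0r_neq0.
rewrite norm_sinDnatpi normr_eq0 lt0r_neq0 //.
apply: sin_gt0_pi; rewrite divr_gt0 ?mulr_gt0 ?pi_gt0 //=; last first.
  by rewrite ltr0n lt0n.
rewrite ltr_pdivrMr // ltr_pM2l ?pi_gt0 // ltr_nat.
exact: ltn_pmod.
Qed.

Lemma cos_orthogonality p k : (0 < p)%N ->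
  \sum_(0 <= h < p) cos (2 * k%:R * (pi * h%:R / p%:R)) =
  (if (p %| k)%N then p%:R else 0) :> R.
Proof.
move=> p0.
have p0R : (0 : R) < p%:R by rewrite ltr0n.
case: ifPn => pk.
  rewrite (eq_bigr (fun=> 1)) ?sumr_const_nat ?subn0 // => h _.
  case/dvdnP: pk => q ->.
  have -> : 2 * (q * p)%:R * (pi * h%:R / p%:R) = 0 + 2 * (q * h)%:R * pi :> R.
    by rewrite !natrM; field; exact: lt0r_neq0.
  by rewrite cosD_nat2pi cos0.
have s0 := sin_frac_neq0 p0 pk.
have := sin_sum_telescope (pi * k%:R / p%:R : R) 0 p.
rewrite add0n mulr0.
have -> : \sum_(0 <= m < p) cos (2 * m%:R * (pi * k%:R / p%:R)) =
          \sum_(0 <= h < p) cos (2 * k%:R * (pi * h%:R / p%:R)) :> R.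
  by apply: eq_bigr => h _; congr cos; ring.
have -> : (2 * p%:R - 1) * (pi * k%:R / p%:R) =
          - (pi * k%:R / p%:R) + 2 * k%:R * pi :> R.
  by field; exact: lt0r_neq0.
rewrite sinD_nat2pi sub0r mulN1r subrr.
by move/eqP; rewrite mulf_eq0 mulf_eq0 pnatr_eq0 /= (negPf s0) /= => /eqP.
Qed.

Variables (p : nat) (c : nat -> R).
Hypothesis p0 : (0 < p)%N.
Hypothesis cper : forall m, c (m + p)%N = c m.
Hypothesis cmean : \sum_(0 <= a < p) c a = 0.

Definition fourier_cos h := p%:R^-1 * \sum_(0 <= a < p) c a * cos (2 * a%:R * (pi * h%:R / p%:R)).
Definition fourier_sin h := p%:R^-1 * \sum_(0 <= a < p) c a * sin (2 * a%:R * (pi * h%:R / p%:R)).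

Lemma periodic_modn m : c m = c (m %% p)%N.
Proof.
rewrite {1}(divn_eq m p) addnC.
by elim: (m %/ p)%N => [|q IH]; rewrite ?mul0n ?addn0 // mulSn addnCA addnC cper.
Qed.

(** The frequency h = 0 is absent because c has mean zero. *)
Lemma fourier_inversion m : c m =
  \sum_(1 <= h < p) (fourier_cos h * cos (2 * m%:R * (pi * h%:R / p%:R)) +
                     fourier_sin h * sin (2 * m%:R * (pi * h%:R / p%:R))).
Proof.
have p0R : (0 : R) < p%:R by rewrite ltr0n.
have E h : fourier_cos h * cos (2 * m%:R * (pi * h%:R / p%:R)) +
           fourier_sin h * sin (2 * m%:R * (pi * h%:R / p%:R)) =
  p%:R^-1 * \sum_(0 <= a < p) c a * cos (2 * `|m - a|%N%:R * (pi * h%:R / p%:R)).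
  rewrite /fourier_cos /fourier_sin !big_distrr !big_distrl -big_split /=.
  by apply: eq_bigr => a _; rewrite cos_distn cosB; ring.
under eq_bigr do rewrite E.
rewrite -big_distrr exchange_big /=.
have E2 a : \sum_(1 <= h < p) c a * cos (2 * `|m - a|%N%:R * (pi * h%:R / p%:R)) =
  (if (p %| `|m - a|)%N then c a * p%:R else 0) - c a.
  rewrite -big_distrr /=.
  have := @cos_orthogonality p `|m - a|%N p0.
  rewrite [X in X = _ -> _]big_ltn // mulr0 mul0r mulr0 cos0.
  set S := \sum_(1 <= _ < _) _.
  by case: ifP => _ H; [rewrite -H | rewrite -[0 in RHS](mulr0 (c a)) -H]; ring.
rewrite (eq_bigr _ (fun a _ => E2 a)) big_split /= sumrN cmean subr0.
rewrite -big_mkcond /= big_nat_cond.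
rewrite (eq_bigl (fun a => (0 <= a < p)%N && (a == m %% p)%N)); last first.
  move=> a /=; case ap : (a < p)%N; rewrite //=.
  have [ma|am] := leqP m a.
    rewrite distnEr // -eqn_mod_dvd // modn_small //.
  rewrite distnEl 1?ltnW // -eqn_mod_dvd 1?ltnW // eq_sym modn_small //.
rewrite -big_nat_cond big_mkord.
rewrite (eq_bigl (fun i : 'I_p => i == Ordinal (ltn_pmod m p0))) //.
rewrite big_pred1_eq /= periodic_modn mulrC mulfK //.
exact: lt0r_neq0.
Qed.

Lemma parseval : \sum_(1 <= h < p) (fourier_cos h ^+ 2 + fourier_sin h ^+ 2) =
  p%:R^-1 * \sum_(0 <= a < p) c a ^+ 2.
Proof.
rewrite [in RHS](eq_bigr (fun a => \sum_(1 <= h < p)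
    (c a * (fourier_cos h * cos (2 * a%:R * (pi * h%:R / p%:R)) +
            fourier_sin h * sin (2 * a%:R * (pi * h%:R / p%:R)))))); last first.
  by move=> a _; rewrite -big_distrr /= -fourier_inversion.
rewrite exchange_big /= big_distrr /=; apply: eq_bigr => h _.
rewrite !expr2 {1}/fourier_cos {1}/fourier_sin !big_distrr !big_distrl -big_split /=.
by apply: eq_bigr => a _; ring.
Qed.

End Fourier.

(** * Spacing of Farey fractions *)

Definition harmonic_sum (R : realType) (Q : nat) : R := \sum_(1 <= j < Q.+1) j%:R^-1.

Lemma sum_inv_inj (R : realType) (I : finType) (A : pred I) (f : I -> nat) Q :
  (forall s, A s -> (0 < f s <= Q)%N) ->
  (forall s t, A s -> A t -> f s = f t -> s = t) ->
  \sum_(s | A s) (f s)%:R^-1 <= harmonic_sum R Q.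
Proof.
move=> fb finj.
pose g s : 'I_Q.+1 := inord (f s).
have gE s : A s -> nat_of_ord (g s) = f s.
  by move=> As; rewrite /g inordK // ltnS; case/andP: (fb s As).
have ginj : {in A &, injective g}.
  by move=> s t As At e; apply: finj => //; rewrite -!gE // e.
rewrite (eq_bigr (fun s => ((g s : nat)%:R : R)^-1)); last by move=> s As; rewrite gE.
rewrite -(@big_imset _ _ _ _ _ g (mem A) (fun j : 'I_Q.+1 => (j%:R : R)^-1)) //=.
rewrite /harmonic_sum [leRHS](_ : _ = \sum_(j < Q.+1 | (0 < j)%N) (j%:R : R)^-1).
  rewrite big_mkcond [leRHS]big_mkcond /=; apply: ler_sum => j _.
  case: ifPn => [/imsetP[s As ->]|_].
    by rewrite gE //; case/andP: (fb s As) => ->.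
  by case: ifP => // _; rewrite invr_ge0.
by rewrite (big_nat_widenl 1 0) // big_mkord.
Qed.

Section FareyInj.
Variables (Q p p1 n1 p2 n2 : nat).
Hypotheses (p_gt0 : (0 < p)%N) (p1_gt0 : (0 < p1)%N) (p2_gt0 : (0 < p2)%N).
Hypothesis leQ : (p1 * p2 <= Q)%N.

(** The slots of length 1 / Q: two fractions with denominators p p1 and p p2
in the same slot have a difference whose numerator over p p1 p2 is less
than p. *)
Lemma floor_close : (n1 * Q %/ (p * p1) = n2 * Q %/ (p * p2))%N ->
  (n1 * p2 < n2 * p1 + p)%N.
Proof.
move=> e; set j := (n1 * Q %/ (p * p1))%N in e.
have h1 : (n1 * Q < j.+1 * (p * p1))%N by rewrite -ltn_divLR ?muln_gt0 ?p_gt0.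
have h2 : (j * (p * p2) <= n2 * Q)%N by rewrite e leq_divM.
have Q0 : (0 < Q)%N by apply: leq_trans leQ; rewrite muln_gt0 p1_gt0.
rewrite -(ltn_pmul2r Q0) mulnDl.
have : (n1 * Q * p2 < j.+1 * (p * p1) * p2)%N by rewrite ltn_pmul2r.
have : (j * (p * p2) * p1 <= n2 * Q * p1)%N by rewrite leq_mul2r h2 orbT.
have : (p * (p1 * p2) <= p * Q)%N by rewrite leq_mul2l leQ orbT.
nia.
Qed.
End FareyInj.

(** Distinct fractions h / p in lowest terms are distinct modulo 1. *)
Lemma farey_eq (p1 h1 k1 p2 h2 k2 : nat) :
  prime p1 -> prime p2 -> (0 < h1 < p1)%N -> (0 < h2 < p2)%N ->
  (h1 * p2 + k1 * (p1 * p2) = h2 * p1 + k2 * (p1 * p2))%N -> p1 = p2 /\ h1 = h2.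
Proof.
move=> pr1 pr2 /andP[h10 h1p] /andP[h20 h2p] e.
have d : (p1 %| h1 * p2)%N.
  have : (p1 %| h1 * p2 + k1 * (p1 * p2))%N.
    by rewrite e; apply: dvdn_add; apply: dvdn_mull => //; exact: dvdn_mulr.
  by rewrite dvdn_addl //; apply: dvdn_mull; exact: dvdn_mulr.
have e12 : p1 = p2.
  move: d; rewrite Euclid_dvdM // gtnNdvd //= dvdn_prime2 //.
  by move/eqP.
split=> //; subst p2.
have p10 := prime_gt0 pr1.
have : (h1 + k1 * p1 = h2 + k2 * p1)%N.
  by apply/eqP; rewrite -(eqn_pmul2r p10); apply/eqP; lia.
move=> /(congr1 (fun x => x %% p1)%N).
by rewrite addnC modnMDl addnC modnMDl !modn_small.
Qed.

(** The numerator, over p p', of h' / p' - h / p reduced modulo 1. *)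
Definition farey_num (p h p' h' : nat) : nat :=
  if (h * p' <= h' * p)%N then (h' * p - h * p')%N
  else (h' * p + p * p' - h * p')%N.

Lemma farey_numE p h p' h' : (h < p)%N ->
  exists k, (farey_num p h p' h' + h * p' = h' * p + k * (p * p'))%N.
Proof.
move=> hp; rewrite /farey_num; case: ifP => c.
  by exists 0%N; lia.
exists 1%N; rewrite mul1n subnK //.
have : (h * p' <= p * p')%N by rewrite leq_mul2r ltnW ?orbT.
lia.
Qed.

(** The fractions h' / p' are 1 / Q apart modulo 1, so that their
distances from h / p, measured upwards, lie in distinct slots of length 1 / Q. *)
Lemma farey_num_inj_r Q p h p1 h1 p2 h2 : (h < p)%N ->
  prime p1 -> prime p2 -> (0 < h1 < p1)%N -> (0 < h2 < p2)%N ->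
  (p1 * p2 <= Q)%N ->
  (farey_num p h p1 h1 * Q %/ (p * p1) = farey_num p h p2 h2 * Q %/ (p * p2))%N ->
  p1 = p2 /\ h1 = h2.
Proof.
move=> hp pr1 pr2 hp1 hp2 leQ e.
have p0 : (0 < p)%N by apply: leq_ltn_trans hp.
have [k1 e1] := farey_numE p1 h1 hp; have [k2 e2] := farey_numE p2 h2 hp.
have c1 := floor_close p0 (prime_gt0 pr1) (prime_gt0 pr2) leQ e.
have leQ' : (p2 * p1 <= Q)%N by rewrite mulnC.
have c2 := floor_close p0 (prime_gt0 pr2) (prime_gt0 pr1) leQ' (esym e).
apply: (@farey_eq p1 h1 k1 p2 h2 k2) => //.
move: (farey_num p h p1 h1) (farey_num p h p2 h2) e1 e2 c1 c2 => n1 n2 e1 e2 c1 c2.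
have E1 : (n1 * p2 + h * p1 * p2 = p * (h1 * p2 + k1 * (p1 * p2)))%N.
  by rewrite -mulnDl e1; lia.
have E2 : (n2 * p1 + h * p1 * p2 = p * (h2 * p1 + k2 * (p1 * p2)))%N.
  by have := congr1 (muln^~ p1) e2; rewrite !mulnDl; clear; lia.
have cl X Y : (p * X < p * Y + p)%N -> (X <= Y)%N by rewrite addnC -mulnS ltn_pmul2l.
move: (h1 * p2 + _)%N (h2 * p1 + _)%N E1 E2 c1 c2 => X Y.
move: (n1 * p2)%N (n2 * p1)%N (h * p1 * p2)%N cl => A B C cl E1 E2 c1 c2.
by apply/eqP; rewrite eqn_leq; apply/andP; split; apply: cl; clear -E1 E2 c1 c2; move: (p * X)%N (p * Y)%N E1 E2; lia.
Qed.

(** The same as [farey_num_inj_r] for the distances measured downwards. *)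
Lemma farey_num_inj_l Q p h p1 h1 p2 h2 : (h < p)%N ->
  prime p1 -> prime p2 -> (0 < h1 < p1)%N -> (0 < h2 < p2)%N ->
  (p1 * p2 <= Q)%N ->
  (farey_num p1 h1 p h * Q %/ (p * p1) = farey_num p2 h2 p h * Q %/ (p * p2))%N ->
  p1 = p2 /\ h1 = h2.
Proof.
move=> hp pr1 pr2 hp1 hp2 leQ e.
have p0 : (0 < p)%N by apply: leq_ltn_trans hp.
have [k1 e1] := farey_numE p h (proj2 (andP hp1)).
have [k2 e2] := farey_numE p h (proj2 (andP hp2)).
have c1 := floor_close p0 (prime_gt0 pr1) (prime_gt0 pr2) leQ e.
have leQ' : (p2 * p1 <= Q)%N by rewrite mulnC.
have c2 := floor_close p0 (prime_gt0 pr2) (prime_gt0 pr1) leQ' (esym e).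
apply: (@farey_eq p1 h1 k2 p2 h2 k1) => //.
move: (farey_num p1 h1 p h) (farey_num p2 h2 p h) e1 e2 c1 c2 => n1 n2 e1 e2 c1 c2.
have E1 : (n1 * p2 + p * (h1 * p2) = h * p1 * p2 + p * (k1 * (p1 * p2)))%N.
  by have := congr1 (muln^~ p2) e1; rewrite !mulnDl; clear; lia.
have E2 : (n2 * p1 + p * (h2 * p1) = h * p1 * p2 + p * (k2 * (p1 * p2)))%N.
  by have := congr1 (muln^~ p1) e2; rewrite !mulnDl; clear; lia.
have cl X Y : (p * X < p * Y + p)%N -> (X <= Y)%N by rewrite addnC -mulnS ltn_pmul2l.
move: (h1 * p2)%N (h2 * p1)%N (k1 * _)%N (k2 * _)%N E1 E2 c1 c2 => X Y Z W.
move: (n1 * p2)%N (n2 * p1)%N (h * p1 * p2)%N cl => A B C cl E1 E2 c1 c2.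
by apply/eqP; rewrite eqn_leq; apply/andP; split; apply: cl; rewrite !mulnDr; clear -E1 E2 c1 c2;
  move: (p * X)%N (p * Y)%N (p * Z)%N (p * W)%N E1 E2; lia.
Qed.

Lemma farey_num_sum p h p' h' : (h < p)%N -> (h' < p')%N -> (h * p' <> h' * p)%N ->
  (farey_num p h p' h' + farey_num p' h' p h = p * p')%N.
Proof.
move=> hp hp' ne; rewrite /farey_num.
have a : (h * p' <= p * p')%N by rewrite leq_mul2r ltnW ?orbT.
have b : (h' * p <= p * p')%N by rewrite [leqRHS]mulnC leq_mul2r ltnW ?orbT.
rewrite [(p' * p)%N]mulnC; move: (h * p')%N (h' * p)%N (p * p')%N ne a b.
by move=> x y z ne a b; case: (leqP x y) => c; case: (leqP y x) => d; lia.
Qed.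

Lemma farey_num_gt0 p h p' h' : (h < p)%N -> (0 < p')%N -> (h * p' <> h' * p)%N ->
  (0 < farey_num p h p' h')%N.
Proof.
move=> hp p'0 ne; rewrite /farey_num.
have : (h * p' < p * p')%N by rewrite ltn_pmul2r.
move: (h * p')%N (h' * p)%N (p * p')%N ne => x y z ne a.
by case: (leqP x y) => c; lia.
Qed.

Lemma farey_neq p h p' h' : prime p -> prime p' -> (0 < h < p)%N ->
  (0 < h' < p')%N -> (p, h) <> (p', h') -> (h * p' <> h' * p)%N.
Proof.
move=> pr pr' hp hp' ne e; apply: ne.
have [] := @farey_eq p h 0 p' h' 0 pr pr' hp hp'; first by rewrite e.
by move=> -> ->.
Qed.

Section Spacing.
Variable R : realType.

(** 1 / |sin(pi t)| is at most 8 / t + 8 / (1 - t), and t and 1 - t are bounded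
below through the numbers j and j' of their slots. *)
Lemma inv_sin_farey Q p h p' h' : prime p -> prime p' -> (0 < h < p)%N ->
  (0 < h' < p')%N -> (p, h) <> (p', h') -> (p * p' <= Q)%N ->
  let j := (farey_num p h p' h' * Q %/ (p * p'))%N in
  let j' := (farey_num p' h' p h * Q %/ (p * p'))%N in
  [/\ (0 < j <= Q)%N, (0 < j' <= Q)%N,
     sin (pi * h%:R / p%:R - pi * h'%:R / p'%:R) != 0 :> R
   & `|sin (pi * h%:R / p%:R - pi * h'%:R / p'%:R)|^-1
      <= 8 * Q%:R * (j%:R^-1 + j'%:R^-1) :> R].
Proof.
move=> pr pr' hp hp' ne leQ.
have [h0 h1] := andP hp; have [h0' h1'] := andP hp'.
have p0 := prime_gt0 pr; have p0' := prime_gt0 pr'.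
have pp0 : (0 < p * p')%N by rewrite muln_gt0 p0.
have p0R : (0 : R) < p%:R by rewrite ltr0n.
have p0R' : (0 : R) < p'%:R by rewrite ltr0n.
have nh := farey_neq pr pr' hp hp' ne.
have S := farey_num_sum h1 h1' nh.
have g1 := farey_num_gt0 h1 p0' nh.
have g2 := farey_num_gt0 h1' p0 (fun e => nh (esym e)).
have jb n : (0 < n)%N -> (n <= p * p')%N -> (0 < n * Q %/ (p * p') <= Q)%N.
  move=> n0 nl; rewrite divn_gt0 //; apply/andP; split.
    by apply: leq_trans leQ _; rewrite leq_pmull.
  by rewrite -[leqRHS](mulKn Q pp0) leq_div2r // leq_mul2r nl orbT.
move=> j j'.
have b1 : (0 < j <= Q)%N by apply: jb => //; lia.
have b2 : (0 < j' <= Q)%N by apply: jb => //; lia.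
pose t : R := (farey_num p h p' h')%:R / (p * p')%:R.
have pp0R : (0 : R) < (p * p')%:R by rewrite ltr0n.
have Et' : 1 - t = (farey_num p' h' p h)%:R / (p * p')%:R.
  rewrite /t -{1}(divff (lt0r_neq0 pp0R)) -mulrBl -natrB; last lia.
  by congr (_%:R / _); lia.
have t0 : 0 < t by rewrite divr_gt0 // ltr0n.
have t1 : 0 < 1 - t by rewrite Et' divr_gt0 // ltr0n.
have Es : `|sin (pi * h%:R / p%:R - pi * h'%:R / p'%:R)| = `|sin (pi * t)|.
  rewrite -[LHS]normrN -sinN opprB.
  have [k e] := farey_numE p' h' h1.
  have -> : pi * t = pi * h'%:R / p'%:R - pi * h%:R / p%:R + k%:R * pi :> R.
    have := congr1 (fun n : nat => n%:R : R) e.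
    rewrite !natrD !natrM /t.
    move: (farey_num _ _ _ _) => n E.
    have -> : (n%:R : R) = h'%:R * p%:R + k%:R * (p%:R * p'%:R) - h%:R * p'%:R.
      by rewrite -E; ring.
    rewrite natrM.
    by field; rewrite !lt0r_neq0.
  by rewrite norm_sinDnatpi.
have tt : t * (1 - t) / 8 <= sin (pi * t).
  by apply: sin_pi_ge; apply/andP; split; lra.
have ttg : 0 < t * (1 - t) / 8 by rewrite divr_gt0 // mulr_gt0.
have s0 : 0 < sin (pi * t) by apply: lt_le_trans tt.
have jt n : (0 < n * Q %/ (p * p'))%N ->
  (n%:R / (p * p')%:R)^-1 <= Q%:R * ((n * Q %/ (p * p'))%N%:R)^-1 :> R.
  move=> jn0.
  have n0 : (0 < n)%N by case: n jn0 => //; rewrite mul0n div0n.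
  rewrite invf_div ler_pdivlMr ?ltr0n // mulrAC ler_pdivrMr ?ltr0n //.
  rewrite -!natrM ler_nat mulnC [leqRHS]mulnC.
  exact: leq_divM.
split=> //.
  by rewrite -normr_eq0 Es normr_eq0 lt0r_neq0.
rewrite Es gtr0_norm //.
apply: (@le_trans _ _ (t * (1 - t) / 8)^-1); first by rewrite lef_pV2.
have -> : (t * (1 - t) / 8)^-1 = 8 * (t^-1 + (1 - t)^-1).
  by field; rewrite !lt0r_neq0 //; lra.
rewrite -mulrA ler_pM2l // mulrDr lerD // ?Et'; apply: jt.
  by case/andP: b1.
by case/andP: b2.
Qed.

End Spacing.

(** * The dual large sieve *)

Section LargeSieve.
Variable R : realType.
Variables (Pm : nat) (S : pred nat).
Hypothesis Sprime : forall p, S p -> prime p && (p <= Pm)%N.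

Definition large_sieve_const (M : nat) : R := 2 * (M%:R + 16 * (Pm ^ 2)%:R * harmonic_sum R (Pm ^ 2)).

Let inS (r : 'I_Pm.+1 * 'I_Pm.+1) := S r.1 && (0 < r.2 < r.1)%N.

Lemma farey_pair_sum (F : nat -> nat -> R) :
  \sum_(p < Pm.+1 | S p) \sum_(1 <= h < p) F p h =
  \sum_(r | inS r) F r.1 r.2.
Proof.
rewrite /inS; under [RHS]eq_bigl do rewrite /=.
rewrite -(pair_big_dep (fun p : 'I_Pm.+1 => S p) (fun p h : 'I_Pm.+1 => (0 < h < p)%N)
   (fun p h : 'I_Pm.+1 => F p h)) /=.
apply: eq_bigr => p Sp.
rewrite (big_nat_widenl 1 0) // (big_nat_widen _ _ Pm.+1) ?(ltnW (ltn_ord p)) //.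
by rewrite big_mkord; apply: eq_bigl => h; rewrite andTb.
Qed.

Let phi (r : 'I_Pm.+1 * 'I_Pm.+1) : R := pi * (r.2 : nat)%:R / (r.1 : nat)%:R.

Let kap (M : nat) (r s : 'I_Pm.+1 * 'I_Pm.+1) : R :=
  if r == s then M%:R else `|sin (phi r - phi s)|^-1.

Lemma pair_neq (r s : 'I_Pm.+1 * 'I_Pm.+1) : r != s ->
  (r.1 : nat, r.2 : nat) <> (s.1 : nat, s.2 : nat).
Proof.
move=> /eqP ne [e1 e2]; apply: ne.
by rewrite [r]surjective_pairing [s]surjective_pairing; congr pair; apply: val_inj.
Qed.

Lemma inv_sin_farey_pair r s : inS r -> inS s -> r != s ->
  let j := (farey_num r.1 r.2 s.1 s.2 * Pm ^ 2 %/ (r.1 * s.1))%N in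
  let j' := (farey_num s.1 s.2 r.1 r.2 * Pm ^ 2 %/ (r.1 * s.1))%N in
  [/\ (0 < j <= Pm ^ 2)%N, (0 < j' <= Pm ^ 2)%N,
     sin (phi r - phi s) != 0
   & `|sin (phi r - phi s)|^-1 <= 8 * (Pm ^ 2)%:R * (j%:R^-1 + j'%:R^-1)].
Proof.
move=> /andP[Sr hr] /andP[Ss hs] ne.
have /andP[pr lr] := Sprime Sr; have /andP[ps ls] := Sprime Ss.
apply: inv_sin_farey => //; first exact: pair_neq.
by rewrite -mulnn leq_mul.
Qed.

(** The slots j and j' are distinct for distinct s, so the row sum is a
harmonic sum; this logarithm is the loss against the sharp large sieve. *)
Lemma kap_row_sum M r : inS r ->
  \sum_(s | inS s) kap M r s <= M%:R + 16 * (Pm ^ 2)%:R * harmonic_sum R (Pm ^ 2).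
Proof.
move=> rS; have /andP[Sr hr] := rS; have /andP[pr lr] := Sprime Sr.
rewrite (bigD1 r) //= /kap eqxx lerD2l.
pose j (s : 'I_Pm.+1 * 'I_Pm.+1) := (farey_num r.1 r.2 s.1 s.2 * Pm ^ 2 %/ (r.1 * s.1))%N.
pose j' (s : 'I_Pm.+1 * 'I_Pm.+1) := (farey_num s.1 s.2 r.1 r.2 * Pm ^ 2 %/ (r.1 * s.1))%N.
have step : \sum_(s | inS s && (s != r))
      (if r == s then M%:R else `|sin (phi r - phi s)|^-1) <=
    \sum_(s | inS s && (s != r)) 8 * (Pm ^ 2)%:R * ((j s)%:R^-1 + (j' s)%:R^-1).
  apply: ler_sum => s /andP[sS ne]; rewrite eq_sym (negPf ne).
  by rewrite eq_sym in ne; have [] := inv_sin_farey_pair rS sS ne.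
apply: (le_trans step).
rewrite -big_distrr big_split /=.
have H1 : \sum_(s | inS s && (s != r)) (j s)%:R^-1 <= harmonic_sum R (Pm ^ 2).
  apply: sum_inv_inj.
    by move=> s /andP[sS ne]; rewrite eq_sym in ne; have [] := inv_sin_farey_pair rS sS ne.
  move=> s t /andP[/andP[Ss hs] _] /andP[/andP[St ht] _] e.
  have /andP[ps ls] := Sprime Ss; have /andP[pt lt] := Sprime St.
  have [] := farey_num_inj_r (proj2 (andP hr)) ps pt hs ht _ e.
    by rewrite -mulnn leq_mul.
  by move=> e1 e2; rewrite [s]surjective_pairing [t]surjective_pairing;
     congr pair; apply: val_inj.
have H2 : \sum_(s | inS s && (s != r)) (j' s)%:R^-1 <= harmonic_sum R (Pm ^ 2).
  apply: sum_inv_inj.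
    by move=> s /andP[sS ne]; rewrite eq_sym in ne; have [] := inv_sin_farey_pair rS sS ne.
  move=> s t /andP[/andP[Ss hs] _] /andP[/andP[St ht] _] e.
  have /andP[ps ls] := Sprime Ss; have /andP[pt lt] := Sprime St.
  have [] := farey_num_inj_l (proj2 (andP hr)) ps pt hs ht _ e.
    by rewrite -mulnn leq_mul.
  by move=> e1 e2; rewrite [s]surjective_pairing [t]surjective_pairing;
     congr pair; apply: val_inj.
have Q0 : 0 <= 8 * (Pm ^ 2)%:R :> R by rewrite mulr_ge0.
have := ler_wpM2l Q0 (lerD H1 H2); move: (harmonic_sum _ _) ((Pm ^ 2)%:R) => h q; lra.
Qed.

(** Write every c p as a combination of exponentials with frequencies h / p,
where h <> 0 since c p has mean zero, and apply [trig_dual] to all the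
frequencies at once; Parseval turns the coefficients back into c p. *)
Theorem dual_large_sieve (c : nat -> nat -> R) (m0 M : nat) :
  (forall p m, S p -> c p (m + p)%N = c p m) ->
  (forall p, S p -> \sum_(0 <= a < p) c p a = 0) ->
  \sum_(m0 <= m < m0 + M) (\sum_(p < Pm.+1 | S p) c p m) ^+ 2 <=
  large_sieve_const M * \sum_(p < Pm.+1 | S p) (p%:R^-1 * \sum_(0 <= a < p) c p a ^+ 2).
Proof.
move=> cper cmean.
have p0 p : S p -> (0 < p)%N by case/Sprime/andP => /prime_gt0.
rewrite (eq_bigr (fun m : nat => (\sum_(r | inS r)
   (fourier_cos r.1 (c r.1) r.2 * cos (2 * m%:R * phi r) +
    fourier_sin r.1 (c r.1) r.2 * sin (2 * m%:R * phi r))) ^+ 2)); last first.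
  move=> m _; rewrite -(farey_pair_sum (fun p h =>
   (fourier_cos p (c p) h * cos (2 * m%:R * (pi * h%:R / p%:R)) +
    fourier_sin p (c p) h * sin (2 * m%:R * (pi * h%:R / p%:R))))).
  congr (_ ^+ 2); apply: eq_bigr => p Sp.
  by apply: fourier_inversion; [exact: p0|move=> ?; exact: cper|exact: cmean].
apply: le_trans (@trig_dual _ _ inS phi _ _ (kap M) _ m0 M _ _ _ (@kap_row_sum M)) _.
- move=> r s _ _; rewrite /kap eq_sym; case: eqP => // _.
  by rewrite -normrN -sinN opprB.
- move=> r s rS sS; rewrite /kap; case: ifPn => [/eqP <-|ne].
    apply: (le_trans (ler_norm_sum _ _ _)).
    rewrite (le_trans (ler_sum _ (fun m _ => cos_max _))) //.
    by rewrite sumr_const_nat addKn.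
  by apply: dirichlet_kernel_cos; have [] := inv_sin_farey_pair rS sS ne.
- move=> r s rS sS; rewrite /kap; case: ifPn => [/eqP <-|ne].
    apply: (le_trans (ler_norm_sum _ _ _)).
    rewrite (le_trans (ler_sum _ (fun m _ => sin_max _))) //.
    by rewrite sumr_const_nat addKn.
  by apply: dirichlet_kernel_sin; have [] := inv_sin_farey_pair rS sS ne.
rewrite -(farey_pair_sum (fun p h => fourier_cos p (c p) h ^+ 2 + fourier_sin p (c p) h ^+ 2)).
rewrite /large_sieve_const le_eqVlt; apply/orP; left; apply/eqP; congr (_ * _).
apply: eq_bigr => p Sp.
by apply: parseval; [exact: p0|move=> ?; exact: cper|exact: cmean].
Qed.

End LargeSieve.

(** * Deviation from equidistribution in the class of 1 *)

Section CauchySchwarz.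
Variable R : realType.

Lemma cauchy_schwarz_sum (I : Type) (r : seq I) (P : pred I) (f g : I -> R) :
  (\sum_(i <- r | P i) f i * g i) ^+ 2 <=
  (\sum_(i <- r | P i) f i ^+ 2) * (\sum_(i <- r | P i) g i ^+ 2).
Proof.
elim: r => [|i r IH]; first by rewrite !big_nil expr0n mulr0.
rewrite !big_cons; case: ifP => // _.
set A := \sum_(j <- r | P j) f j ^+ 2 in IH *.
set B := \sum_(j <- r | P j) g j ^+ 2 in IH *.
set C := \sum_(j <- r | P j) f j * g j in IH *.
have A0 : 0 <= A by apply: sumr_ge0 => j _; exact: sqr_ge0.
have B0 : 0 <= B by apply: sumr_ge0 => j _; exact: sqr_ge0.
suff : 2 * (f i * g i * C) <= f i ^+ 2 * B + g i ^+ 2 * A by nra.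
have h : `|C| <= Num.sqrt A * Num.sqrt B.
  by rewrite -sqrtrM // -sqrtr_sqr ler_sqrt // mulr_ge0.
apply: (@le_trans _ _ (2 * (`|f i * g i| * (Num.sqrt A * Num.sqrt B)))).
  rewrite ler_pM2l // (le_trans (ler_norm _)) // normrM.
  by rewrite ler_wpM2l.
rewrite -[in leRHS](sqr_sqrtr A0) -[in leRHS](sqr_sqrtr B0) normrM.
rewrite -[f i ^+ 2]real_normK ?num_real // -[g i ^+ 2]real_normK ?num_real //.
move: (`|f i|) (`|g i|) (Num.sqrt A) (Num.sqrt B) => x y s t.
have := sqr_ge0 (x * t - y * s); nra.
Qed.

(** Cauchy-Schwarz for two terms. *)
Lemma sqrt_cross (a1 a2 b1 b2 : R) : 0 <= a1 -> 0 <= a2 -> 0 <= b1 -> 0 <= b2 ->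
  Num.sqrt a1 * Num.sqrt b2 + Num.sqrt a2 * Num.sqrt b1 <=
  Num.sqrt (a1 + a2) * Num.sqrt (b1 + b2).
Proof.
move=> a10 a20 b10 b20.
rewrite -[leRHS]sqrtrM ?addr_ge0 //.
rewrite (le_trans (ler_norm _)) // -sqrtr_sqr; apply: ler_wsqrtr.
rewrite -{2}(sqr_sqrtr a10) -{2}(sqr_sqrtr a20) -{2}(sqr_sqrtr b10) -{2}(sqr_sqrtr b20).
move: (Num.sqrt a1) (Num.sqrt a2) (Num.sqrt b1) (Num.sqrt b2) => x y s t.
have := sqr_ge0 (x * s - y * t); nra.
Qed.

End CauchySchwarz.

Section Kernel.
Variable R : realType.

(** The deviation of the indicator of n = 1 mod p from its mean over the
residues prime to p; it has mean zero modulo p. *)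
Definition dev_one (p n : nat) : R :=
  (n %% p == 1)%N%:R - (if (p %| n)%N then 0 else (p.-1)%:R^-1).

Lemma dev_one_mod p n m : (n = m %[mod p])%N -> dev_one p n = dev_one p m.
Proof. by move=> e; rewrite /dev_one /dvdn e. Qed.

Lemma dev_one_norm_le1 p n : prime p -> `|dev_one p n| <= 1.
Proof.
move=> pr; have p1 := prime_gt1 pr.
have h0 : 0 <= (p.-1)%:R^-1 :> R by rewrite invr_ge0.
have h1 : (p.-1)%:R^-1 <= 1 :> R by rewrite invf_le1 ?ltr0n ?ler1n; lia.
rewrite /dev_one ler_norml; case: eqP; case: ifP => _ _ /=; apply/andP; split; lra.
Qed.

Section Prime.
Variable p : nat.
Hypothesis pr : prime p.
Let p0 := prime_gt0 pr.
Let p1 := prime_gt1 pr.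

Lemma dev_one_dvd n : (p %| n)%N -> dev_one p n = 0.
Proof.
by move=> d; rewrite /dev_one d subr0; move: d; rewrite /dvdn => /eqP ->.
Qed.

Lemma mul_mod_inj n : ~~ (p %| n)%N ->
  injective (fun i : 'I_p => Ordinal (ltn_pmod (i * n) p0)).
Proof.
move=> pn i j [] /eqP e; apply: val_inj => /=.
have cop : coprime p n by rewrite prime_coprime.
wlog ij : i j e / (j <= i)%N.
  by move=> W; case/orP: (leq_total i j) => h; [apply/esym|]; apply: W => //; rewrite eq_sym.
move: e; rewrite eqn_mod_dvd ?leq_mul2r ?ij ?orbT // -mulnBl Gauss_dvdl //.
rewrite -eqn_mod_dvd // => /eqP.
by rewrite !modn_small.
Qed.

Lemma sum_mul_mod n (f : nat -> R) : ~~ (p %| n)%N ->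
  (forall a b, a = b %[mod p]%N -> f a = f b) ->
  \sum_(0 <= a < p) f (a * n)%N = \sum_(0 <= a < p) f a.
Proof.
move=> pn fp; rewrite !big_mkord [RHS](reindex_inj (mul_mod_inj pn)) /=.
by apply: eq_bigr => i _; apply: fp; rewrite modn_mod.
Qed.

Lemma sum_dev_one_weighted (f : nat -> R) :
  \sum_(0 <= a < p) f a * dev_one p a =
  f 1%N - (p.-1)%:R^-1 * \sum_(1 <= a < p) f a.
Proof.
rewrite big_ltn // dev_one_dvd ?dvdn0 // mulr0 add0r.
rewrite (eq_big_nat _ _ (F2 := fun a => (if a == 1%N then f a else 0) - (p.-1)%:R^-1 * f a)).
  rewrite sumrB -big_distrr /=; congr (_ - _).
  rewrite big_ltn // eqxx big_nat_cond big1 ?addr0 //.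
  by move=> i /andP[/andP[i2 _] _]; case: eqP => //; lia.
move=> a /andP[a0 ap]; rewrite /dev_one modn_small // gtnNdvd //.
by case: eqP => _ /=; ring.
Qed.

Lemma sum_dev_one : \sum_(0 <= a < p) dev_one p a = 0.
Proof.
rewrite (eq_bigr (fun a => 1 * dev_one p a)); last by move=> *; rewrite mul1r.
rewrite (sum_dev_one_weighted (fun=> 1)) sumr_const_nat -subn1 mulVf ?subrr //.
by rewrite pnatr_eq0; lia.
Qed.

Lemma sum_dev_one_mul n : \sum_(0 <= a < p) dev_one p (a * n) = 0.
Proof.
have [d|nd] := boolP (p %| n)%N.
  by rewrite big1 // => a _; rewrite dev_one_dvd // dvdn_mull.
by rewrite (sum_mul_mod nd (@dev_one_mod p)) sum_dev_one.
Qed.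

(** Residues divisible by p are sent to themselves, which makes the map a
permutation of all residues. *)
Definition modinv (i : 'I_p) : 'I_p :=
  odflt i [pick v : 'I_p | (v * i %% p == 1)%N].

Lemma modinvP (i : 'I_p) : ~~ (p %| i)%N -> (modinv i * i %% p = 1)%N.
Proof.
move=> pi; rewrite /modinv; case: pickP => [v /eqP //|h]; exfalso.
have [g gK Kg] := injF_bij (mul_mod_inj pi).
have := h (g (Ordinal p1)); have := congr1 val (Kg (Ordinal p1)) => /= ->.
by rewrite eqxx.
Qed.

Lemma modinv_dvd (i : 'I_p) : (p %| i)%N -> modinv i = i.
Proof.
move=> d; rewrite /modinv; case: pickP => [v /eqP|//].
by rewrite (eqP (dvdn_mull v d)).
Qed.

Lemma modinv_inj : injective modinv.
Proof.
move=> i j e.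
have H (k : 'I_p) : (p %| k)%N -> k = 0%N :> nat.
  by move=> d; apply/eqP; rewrite -(modn_small (ltn_ord k)).
have [di|ndi] := boolP (p %| i)%N; have [dj|ndj] := boolP (p %| j)%N.
- by apply: val_inj; rewrite /= (H i di) (H j dj).
- have := modinvP ndj; rewrite -e (modinv_dvd di) (H i di) mul0n mod0n; lia.
- have := modinvP ndi; rewrite e (modinv_dvd dj) (H j dj) mul0n mod0n; lia.
have ei := modinvP ndi; have ej := modinvP ndj.
have nv : ~~ (p %| modinv i)%N.
  by apply/negP => d; move: ei; rewrite (eqP (dvdn_mulr i d)).
apply: (mul_mod_inj nv); apply: val_inj => /=.
by rewrite mulnC ei mulnC e ej.
Qed.

(** Summing B u against the indicator of u i = 1 evaluates B at the inverse of i,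
and the constant part of the kernel is killed by the mean of B. *)
Lemma dev_one_inversion (B : nat -> R) (i : 'I_p) :
  (forall a b, a = b %[mod p]%N -> B a = B b) ->
  B 0%N = 0 -> \sum_(0 <= u < p) B u = 0 -> ~~ (p %| i)%N ->
  \sum_(0 <= u < p) B u * dev_one p (u * i)%N = B (modinv i).
Proof.
move=> Bp B0 Bm ni; have ei := modinvP ni.
have nv : ~~ (p %| modinv i)%N.
  by apply/negP => d; move: ei; rewrite (eqP (dvdn_mulr i d)).
rewrite -(sum_mul_mod nv (f := fun u => B u * dev_one p (u * i))); last first.
  by move=> a b e; rewrite (Bp _ _ e); congr (_ * _); apply: dev_one_mod; rewrite -modnMml e modnMml.
rewrite (eq_bigr (fun u => B (u * modinv i)%N * dev_one p u)); last first.
  move=> u _; congr (_ * _); apply: dev_one_mod.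
  by rewrite -mulnA -modnMmr ei muln1.
rewrite (sum_dev_one_weighted (fun u => B (u * modinv i)%N)) mul1n.
suff -> : \sum_(1 <= a < p) B (a * modinv i)%N = 0 by rewrite mulr0 subr0.
have := sum_mul_mod nv Bp; rewrite Bm big_ltn // mul0n B0 add0r.
by [].
Qed.

(** Inversion permutes the residues, so it preserves the sum of squares. *)
Lemma dev_one_energy (B : nat -> R) :
  (forall a b, a = b %[mod p]%N -> B a = B b) ->
  B 0%N = 0 -> \sum_(0 <= u < p) B u = 0 ->
  \sum_(0 <= n < p) (\sum_(0 <= u < p) B u * dev_one p (u * n)%N) ^+ 2 <=
  \sum_(0 <= u < p) B u ^+ 2.
Proof.
move=> Bp B0 Bm; rewrite !big_mkord [leRHS](reindex_inj modinv_inj) /=.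
apply: ler_sum => i _.
have [d|nd] := boolP (p %| i)%N; last by rewrite dev_one_inversion.
rewrite big1 ?expr0n ?sqr_ge0 // => u _.
by rewrite dev_one_dvd ?mulr0 // dvdn_mull.
Qed.

End Prime.
End Kernel.

(** * Bilinear sums *)

Section Bilinear.
Variable R : realType.
Variables (Pm : nat) (S : pred nat) (P0 : R).
Hypothesis Sprime : forall p, S p -> prime p && (p <= Pm)%N.
Hypothesis P0_gt0 : 0 < P0.
Hypothesis S_ge : forall p, S p -> P0 <= p%:R.

Lemma harmonic_sum_ge0 Q : 0 <= harmonic_sum R Q.
Proof. by apply: sumr_ge0 => j _; rewrite invr_ge0. Qed.

Lemma large_sieve_const_ge0 M : 0 <= large_sieve_const R Pm M.
Proof. by rewrite mulr_ge0 // addr_ge0 // !mulr_ge0 // harmonic_sum_ge0. Qed.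

Lemma large_sieve_const_mono M N : (M <= N)%N -> large_sieve_const R Pm M <= large_sieve_const R Pm N.
Proof. by move=> le; rewrite ler_pM2l // lerD2r ler_nat. Qed.

Variables (a b : nat -> R).

Let B n0 N p m := \sum_(n0 <= n < n0 + N) b n * dev_one R p (m * n).

Let Bper n0 N p m m' : (m = m' %[mod p])%N -> B n0 N p m = B n0 N p m'.
Proof.
move=> e; apply: eq_bigr => n _; congr (_ * _); apply: dev_one_mod.
by rewrite -modnMml e modnMml.
Qed.

Let B_0 n0 N p : S p -> B n0 N p 0 = 0.
Proof.
move=> Sp; rewrite /B big1 // => n _.
by rewrite mul0n dev_one_dvd ?mulr0 //; case/andP: (Sprime Sp).
Qed.

Let Bmean n0 N p : S p -> \sum_(0 <= u < p) B n0 N p u = 0.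
Proof.
move=> Sp; rewrite exchange_big /= big1 // => n _.
by rewrite -big_distrr /= sum_dev_one_mul ?mulr0 //; case/andP: (Sprime Sp).
Qed.

(** By [dev_one_inversion] the left-hand side X is a linear form in b whose
coefficients are values of functions of mean zero and total energy at most
X / P0 ^ 2. Cauchy-Schwarz and the dual large sieve bound X ^ 2 by a
multiple of X. *)
Lemma bilinear_energy n0 N :
  \sum_(p < Pm.+1 | S p) (p%:R^-1 * \sum_(0 <= u < p) B n0 N p u ^+ 2) <=
  (\sum_(n0 <= n < n0 + N) b n ^+ 2) * large_sieve_const R Pm N / P0 ^+ 2.
Proof.
set X := \sum_(p < Pm.+1 | S p) _.
pose W p n : R := p%:R^-1 * \sum_(0 <= u < p) B n0 N p u * dev_one R p (u * n).
have X0 : 0 <= X.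
  by apply: sumr_ge0 => p _; rewrite mulr_ge0 ?invr_ge0 // sumr_ge0 // => u _; exact: sqr_ge0.
have EX : X = \sum_(n0 <= n < n0 + N) b n * \sum_(p < Pm.+1 | S p) W p n.
  rewrite (eq_bigr (fun n => \sum_(p < Pm.+1 | S p) b n * W p n)); last first.
    by move=> n _; rewrite big_distrr.
  rewrite exchange_big /=; apply: eq_bigr => p Sp.
  rewrite [RHS](eq_bigr (fun n => p%:R^-1 * \sum_(0 <= u < p)
      (B n0 N p u * (b n * dev_one R p (u * n))))); last first.
    move=> n _; rewrite /W mulrCA big_distrr /=; congr (_ * _).
    by apply: eq_bigr => u _; ring.
  rewrite -big_distrr [in RHS]exchange_big /=; congr (_ * _); apply: eq_bigr => u _.
  by rewrite -big_distrr /= expr2.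
have H : X ^+ 2 <= (\sum_(n0 <= n < n0 + N) b n ^+ 2) * (large_sieve_const R Pm N * (X / P0 ^+ 2)).
  rewrite {1}EX; apply: (le_trans (cauchy_schwarz_sum _ _ _ _)).
  apply: ler_wpM2l; first by apply: sumr_ge0 => n _; exact: sqr_ge0.
  apply: (@le_trans _ _ (large_sieve_const R Pm N *
     \sum_(p < Pm.+1 | S p) (p%:R^-1 * \sum_(0 <= n < p) W p n ^+ 2))).
    apply: dual_large_sieve => // p.
      move=> m Sp; rewrite /W; congr (_ * _); apply: eq_bigr => u _.
      by congr (_ * _); apply: dev_one_mod; rewrite mulnDr addnC modnMDl.
    move=> Sp; rewrite -big_distrr exchange_big /= big1 ?mulr0 // => u _.
    rewrite -big_distrr /=.
    under eq_bigr do rewrite mulnC.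
    by rewrite sum_dev_one_mul ?mulr0 //; case/andP: (Sprime Sp).
  apply: ler_wpM2l; first exact: large_sieve_const_ge0.
  rewrite big_distrl /=; apply: ler_sum => p Sp.
  have /andP[pr _] := Sprime Sp.
  rewrite -mulrA ler_wpM2l ?invr_ge0 // /W.
  under eq_bigr do rewrite exprMn.
  rewrite -big_distrr /= mulrC.
  have pge := S_ge Sp.
  have pp : (0 : R) < p%:R by rewrite ltr0n prime_gt0.
  apply: ler_pM.
  - by apply: sumr_ge0 => n _; exact: sqr_ge0.
  - by rewrite sqr_ge0.
  - by apply: dev_one_energy => //; [move=> ? ? ?; exact: Bper|exact: B_0|exact: Bmean].
  - rewrite exprVn lef_pV2 ?posrE ?exprn_gt0 //.
    by rewrite ler_pXn2r // nnegrE ltW.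
move: X0; rewrite le_eqVlt => /orP[/eqP <-|X0].
  apply: divr_ge0; last exact: sqr_ge0.
  apply: mulr_ge0; last exact: large_sieve_const_ge0.
  by apply: sumr_ge0 => n _; exact: sqr_ge0.
rewrite -(ler_pM2r X0) -expr2; apply: (le_trans H).
by rewrite le_eqVlt; apply/orP; left; apply/eqP; ring.
Qed.

(** Insert signs, apply Cauchy-Schwarz in m and the dual large sieve to the
functions B, and bound their energy by [bilinear_energy]. *)
Lemma bilinear_rect m0 M n0 N :
  \sum_(p < Pm.+1 | S p) `|\sum_(m0 <= m < m0 + M) \sum_(n0 <= n < n0 + N)
       a m * b n * dev_one R p (m * n)| <=
  Num.sqrt (large_sieve_const R Pm M * large_sieve_const R Pm N) / P0 *
  (Num.sqrt (\sum_(m0 <= m < m0 + M) a m ^+ 2) *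
   Num.sqrt (\sum_(n0 <= n < n0 + N) b n ^+ 2)).
Proof.
set T := \sum_(p < Pm.+1 | S p) _.
set A2 := \sum_(m0 <= m < m0 + M) a m ^+ 2.
set B2 := \sum_(n0 <= n < n0 + N) b n ^+ 2.
have A20 : 0 <= A2 by apply: sumr_ge0 => n _; exact: sqr_ge0.
have B20 : 0 <= B2 by apply: sumr_ge0 => n _; exact: sqr_ge0.
have T0 : 0 <= T by apply: sumr_ge0.
pose t p := \sum_(m0 <= m < m0 + M) a m * B n0 N p m.
have tE p : \sum_(m0 <= m < m0 + M) \sum_(n0 <= n < n0 + N)
       a m * b n * dev_one R p (m * n) = t p.
  by apply: eq_bigr => m _; rewrite /B big_distrr /=; apply: eq_bigr => n _; ring.
pose sg p : R := Num.sg (t p).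
pose c p m := sg p * B n0 N p m.
have ET : T = \sum_(m0 <= m < m0 + M) a m * \sum_(p < Pm.+1 | S p) c p m.
  rewrite (eq_bigr (fun m => \sum_(p < Pm.+1 | S p) a m * c p m)); last first.
    by move=> n _; rewrite big_distrr.
  rewrite exchange_big /=; apply: eq_bigr => p Sp.
  rewrite tE normrEsg -/(sg p) /t big_distrr /=.
  by apply: eq_bigr => m _; rewrite /c; ring.
have H : T ^+ 2 <= A2 * (large_sieve_const R Pm M * (B2 * large_sieve_const R Pm N / P0 ^+ 2)).
  rewrite {1}ET; apply: (le_trans (cauchy_schwarz_sum _ _ _ _)).
  apply: ler_wpM2l => //.
  apply: (@le_trans _ _ (large_sieve_const R Pm M *
     \sum_(p < Pm.+1 | S p) (p%:R^-1 * \sum_(0 <= u < p) c p u ^+ 2))).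
    apply: dual_large_sieve => // p.
      by move=> m Sp; rewrite /c (@Bper _ _ _ _ m) // modnDr.
    by move=> Sp; rewrite -big_distrr /= Bmean ?mulr0.
  apply: ler_wpM2l; first exact: large_sieve_const_ge0.
  apply: le_trans (bilinear_energy n0 N).
  apply: ler_sum => p Sp; rewrite ler_wpM2l ?invr_ge0 //.
  apply: ler_sum => u _; rewrite /c exprMn.
  rewrite -[leRHS]mul1r ler_wpM2r ?sqr_ge0 // /sg sqr_sg.
  by case: (_ != _).
have L1 := large_sieve_const_ge0 M; have L2 := large_sieve_const_ge0 N.
move: (large_sieve_const R Pm M) (large_sieve_const R Pm N) L1 L2 H => LM LN L1 L2 H.
have L12 : 0 <= LM * LN by exact: mulr_ge0.
rewrite -[leLHS]ger0_norm // -sqrtr_sqr.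
rewrite -(sqrtrM _ A20) -[P0](gtr0_norm P0_gt0) -sqrtr_sqr.
rewrite -sqrtrV ?sqr_ge0 // -(sqrtrM _ L12) -sqrtrM; last first.
  by rewrite mulr_ge0 // invr_ge0 sqr_ge0.
apply: ler_wsqrtr; apply: (le_trans H).
by rewrite le_eqVlt; apply/orP; left; apply/eqP; ring.
Qed.

Variables (Mx Nx : nat).
Let K := Num.sqrt (large_sieve_const R Pm Mx * large_sieve_const R Pm Nx) / P0.

Lemma bilinear_factor_ge0 : 0 <= K.
Proof. by rewrite divr_ge0 ?sqrtr_ge0 // ltW. Qed.

Let A2 m0 m1 : R := \sum_(m0 <= m < m1) a m ^+ 2.
Let B2 n0 n1 : R := \sum_(n0 <= n < n1) b n ^+ 2.

Let A2_ge0 m0 m1 : 0 <= A2 m0 m1.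
Proof. by apply: sumr_ge0 => n _; exact: sqr_ge0. Qed.
Let B2_ge0 m0 m1 : 0 <= B2 m0 m1.
Proof. by apply: sumr_ge0 => n _; exact: sqr_ge0. Qed.

Lemma bilinear_rectK m0 m1 n0 n1 : (m0 <= m1)%N -> (n0 <= n1)%N ->
  (m1 - m0 <= Mx)%N -> (n1 - n0 <= Nx)%N ->
  \sum_(p < Pm.+1 | S p) `|\sum_(m0 <= m < m1) \sum_(n0 <= n < n1)
       a m * b n * dev_one R p (m * n)| <=
  K * (Num.sqrt (A2 m0 m1) * Num.sqrt (B2 n0 n1)).
Proof.
move=> m01 n01 hM hN.
have := bilinear_rect m0 (m1 - m0) n0 (n1 - n0); rewrite !subnKC //.
move/le_trans; apply; apply: ler_wpM2r; first by rewrite mulr_ge0 ?sqrtr_ge0.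
rewrite ler_wpM2r ?invr_ge0 ?(ltW P0_gt0) //; apply: ler_wsqrtr.
by apply: ler_pM; rewrite ?large_sieve_const_ge0 ?large_sieve_const_mono.
Qed.

(** The region below a nonincreasing threshold is split at its middle
abscissa into a rectangle and two regions of half the width, whose ranges of m,
and whose ranges of n, are disjoint. By [sqrt_cross] each level of the
recursion thus costs no more than one rectangle. *)
Lemma bilinear_staircase k m0 n0 n1 (t : nat -> nat) :
  (2 ^ k <= Mx)%N -> (n1 - n0 <= Nx)%N ->
  (forall m, (m0 <= m < m0 + 2 ^ k)%N -> (n0 <= t m <= n1)%N) ->
  (forall m m', (m <= m')%N -> (t m' <= t m)%N) ->
  \sum_(p < Pm.+1 | S p) `|\sum_(m0 <= m < m0 + 2 ^ k) \sum_(n0 <= n < t m)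
       a m * b n * dev_one R p (m * n)| <=
  k.+1%:R * K * (Num.sqrt (A2 m0 (m0 + 2 ^ k)) * Num.sqrt (B2 n0 n1)).
Proof.
elim: k m0 n0 n1 => [|k IH] m0 n0 n1 hM hN ht tmono.
  rewrite expn0 addn1 mul1r.
  have /andP[t0 t1] : (n0 <= t m0 <= n1)%N by apply: ht; rewrite expn0; lia.
  rewrite (eq_bigr (fun p : 'I__ => `|\sum_(m0 <= m < m0.+1) \sum_(n0 <= n < t m0)
       a m * b n * dev_one R p (m * n)|)); last by move=> p _; rewrite !big_nat1.
  apply: le_trans (bilinear_rectK _ t0 _ _) _ => //.
  - by rewrite subSnn; move: hM; rewrite expn0.
  - by apply: leq_trans hN; rewrite leq_sub2r.
  rewrite ler_wpM2l ?bilinear_factor_ge0 // ler_wpM2l ?sqrtr_ge0 //; apply: ler_wsqrtr.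
  rewrite /B2 (@big_cat_nat _ _ _ (t m0) n0 n1) //= lerDl.
  by apply: sumr_ge0 => n _; exact: sqr_ge0.
set m1 := (m0 + 2 ^ k)%N; set ts := t m1.
have pk : (0 < 2 ^ k)%N by rewrite expn_gt0.
have e2 : (m0 + 2 ^ k.+1 = m1 + 2 ^ k)%N by rewrite expnS mul2n -addnn addnA.
rewrite e2.
have m01 : (m0 <= m1)%N by rewrite leq_addr.
have m12 : (m1 <= m1 + 2 ^ k)%N by rewrite leq_addr.
have /andP[ts0 ts1] : (n0 <= ts <= n1)%N by apply: ht; rewrite e2; lia.
have hM' : (2 ^ k <= Mx)%N by apply: leq_trans hM; rewrite leq_exp2l.
have EA : A2 m0 (m1 + 2 ^ k) = A2 m0 m1 + A2 m1 (m1 + 2 ^ k).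
  by rewrite /A2 (@big_cat_nat _ _ _ m1).
have EB : B2 n0 n1 = B2 n0 ts + B2 ts n1 by rewrite /B2 (@big_cat_nat _ _ _ ts).
have R1 : \sum_(p < Pm.+1 | S p) `|\sum_(m0 <= m < m1) \sum_(n0 <= n < ts)
       a m * b n * dev_one R p (m * n)| <=
  K * (Num.sqrt (A2 m0 m1) * Num.sqrt (B2 n0 ts)).
  apply: bilinear_rectK => //; first by rewrite addKn.
  by apply: leq_trans hN; rewrite leq_sub2r.
have R2 : \sum_(p < Pm.+1 | S p) `|\sum_(m0 <= m < m0 + 2 ^ k) \sum_(ts <= n < t m)
       a m * b n * dev_one R p (m * n)| <=
  k.+1%:R * K * (Num.sqrt (A2 m0 (m0 + 2 ^ k)) * Num.sqrt (B2 ts n1)).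
  apply: IH => //.
    by apply: leq_trans hN; rewrite leq_sub2l.
  move=> m /andP[h1 h2]; rewrite [X in X && _]tmono ?(ltnW h2) //=.
  by have /andP[] : (n0 <= t m <= n1)%N by apply: ht; rewrite e2; lia.
have R3 : \sum_(p < Pm.+1 | S p) `|\sum_(m1 <= m < m1 + 2 ^ k) \sum_(n0 <= n < t m)
       a m * b n * dev_one R p (m * n)| <=
  k.+1%:R * K * (Num.sqrt (A2 m1 (m1 + 2 ^ k)) * Num.sqrt (B2 n0 ts)).
  apply: IH => //.
    by apply: leq_trans hN; rewrite leq_sub2r.
  move=> m /andP[h1 h2]; rewrite [X in _ && X]tmono // andbT.
  by have /andP[] : (n0 <= t m <= n1)%N by apply: ht; rewrite e2; lia.
apply: (@le_trans _ _ (K * (Num.sqrt (A2 m0 m1) * Num.sqrt (B2 n0 ts)) +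
  k.+1%:R * K * (Num.sqrt (A2 m0 (m0 + 2 ^ k)) * Num.sqrt (B2 ts n1)) +
  k.+1%:R * K * (Num.sqrt (A2 m1 (m1 + 2 ^ k)) * Num.sqrt (B2 n0 ts)))).
  apply: le_trans (lerD (lerD R1 R2) R3); rewrite -!big_split /=.
  apply: ler_sum => p Sp.
  rewrite (@big_cat_nat _ _ _ m1) //=.
  apply: (le_trans (ler_normD _ _)); rewrite lerD2r.
  apply: le_trans (ler_normD _ _); rewrite -big_split /=.
  rewrite le_eqVlt; apply/orP; left; apply/eqP; congr (`|_|).
  apply: eq_big_nat => m /andP[h1 h2].
  by rewrite -(@big_cat_nat _ _ _ ts) //= tmono // ltnW.
rewrite EA EB -/m1.
have cr := sqrt_cross (A2_ge0 m0 m1) (A2_ge0 m1 (m1 + 2 ^ k)) (B2_ge0 n0 ts) (B2_ge0 ts n1).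
have K0 := bilinear_factor_ge0.
have r1 : Num.sqrt (A2 m0 m1) * Num.sqrt (B2 n0 ts) <=
  Num.sqrt (A2 m0 m1 + A2 m1 (m1 + 2 ^ k)) * Num.sqrt (B2 n0 ts + B2 ts n1).
  by apply: ler_pM; rewrite ?sqrtr_ge0 //; apply: ler_wsqrtr; rewrite lerDl.
have h1 := ler_wpM2l K0 r1.
have kK0 : 0 <= k.+1%:R * K by rewrite mulr_ge0.
have h2 := ler_wpM2l kK0 cr.
by rewrite -[k.+2%:R]natr1; lra.
Qed.

End Bilinear.

(** * Divisor sums and the von Mangoldt function *)

Section DivisorSums.
Variable V : nmodType.

Lemma sum_multiples (l N : nat) (F : nat -> V) : (0 < l)%N ->
  \sum_(1 <= d < N.+1 | (l %| d)%N) F d = \sum_(1 <= e < (N %/ l).+1) F (l * e)%N.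
Proof.
move=> l0; rewrite big_mkcond; elim: N => [|N IH]; first by rewrite div0n !big_geq.
rewrite big_nat_recr //= IH divnS //.
case: ifP => d; last by rewrite add0n addr0.
rewrite add1n [in RHS]big_nat_recr //=; congr (_ + F _).
have -> : (N %/ l).+1 = (N.+1 %/ l)%N by rewrite divnS // d.
by rewrite mulnC divnK.
Qed.

Lemma sum_divisors_widen n N (F : nat -> V) : (0 < n <= N)%N ->
  \sum_(1 <= d < n.+1 | (d %| n)%N) F d = \sum_(1 <= d < N.+1 | (d %| n)%N) F d.
Proof.
move=> /andP[n0 nN]; rewrite (big_nat_widen _ _ N.+1) //.
apply: eq_bigl => d; case dn : (d %| n)%N => //=.
by rewrite ltnS dvdn_leq.
Qed.

Lemma sum_div_widen m N (F : nat -> V) : (0 < m)%N ->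
  \sum_(1 <= k < (N %/ m).+1) F k = \sum_(1 <= k < N.+1 | (m * k <= N)%N) F k.
Proof.
move=> m0; rewrite (big_nat_widen _ _ N.+1) ?ltnS ?leq_div //.
by apply: eq_bigl => k /=; rewrite ltnS leq_divRL // mulnC.
Qed.

Lemma sum_divisors_exchange N (H : nat -> nat -> V) :
  \sum_(1 <= n < N.+1) \sum_(1 <= d < n.+1 | (d %| n)%N) H d n =
  \sum_(1 <= d < N.+1) \sum_(1 <= k < (N %/ d).+1) H d (d * k)%N.
Proof.
rewrite (eq_big_nat _ _ (F2 := fun n => \sum_(1 <= d < N.+1 | (d %| n)%N) H d n)).
  rewrite (exchange_big_dep xpredT) //=; apply: eq_big_nat => d /andP[d0 _].
  by rewrite sum_multiples.
by move=> n; rewrite ltnS; exact: sum_divisors_widen.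
Qed.

Lemma hyperbola_swap N (H : nat -> nat -> V) :
  \sum_(1 <= m < N.+1) \sum_(1 <= k < (N %/ m).+1) H m k =
  \sum_(1 <= k < N.+1) \sum_(1 <= m < (N %/ k).+1) H m k.
Proof.
rewrite (eq_big_nat _ _ (F2 := fun m => \sum_(1 <= k < N.+1 | (m * k <= N)%N) H m k)).
  rewrite (exchange_big_dep xpredT) //=; apply: eq_big_nat => d /andP[d0 _].
  by rewrite sum_div_widen //; apply: eq_bigl => m; rewrite mulnC.
by move=> m /andP[m0 _]; rewrite sum_div_widen.
Qed.

End DivisorSums.

Section VonMangoldt.
Variable R : realType.

Lemma ln_prodn (I : Type) (r : seq I) (P : pred I) (f : I -> nat) :
  (forall i, P i -> (0 < f i)%N) ->
  ln ((\prod_(i <- r | P i) f i)%N%:R) = \sum_(i <- r | P i) ln (f i)%:R :> R.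
Proof.
move=> f0; elim: r => [|i r IH]; first by rewrite !big_nil ln1.
rewrite !big_cons; case: ifP => // Pi.
rewrite natrM lnM ?IH // posrE ltr0n ?f0 //.
by elim/big_ind: _ => // a b a0 b0; rewrite muln_gt0 a0.
Qed.

Lemma ln_nat_ge0 n : 0 <= ln n%:R :> R.
Proof.
by case: n => [|n]; [rewrite ln0 | rewrite ln_ge0 // ler1n].
Qed.

Lemma ler_ln_nat m n : (0 < m)%N -> (m <= n)%N -> ln m%:R <= ln n%:R :> R.
Proof.
move=> m0 mn; rewrite ler_ln ?posrE ?ltr0n ?ler_nat //.
exact: leq_trans mn.
Qed.

(** The index k stops at n because l ^ k > k. In this form sums against
vonMangoldt are double sums over primes and exponents ([sum_vonMangoldt]). *)
Definition vonMangoldt (n : nat) : R :=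
  \sum_(1 <= l < n.+1 | prime l) \sum_(1 <= k < n.+1 | n == (l ^ k)%N) ln l%:R.

Lemma vonMangoldt_ge0 n : 0 <= vonMangoldt n.
Proof. by apply: sumr_ge0 => l _; apply: sumr_ge0 => k _; exact: ln_nat_ge0. Qed.

Lemma vonMangoldt_widen n N : (n <= N)%N -> vonMangoldt n =
  \sum_(1 <= l < N.+1 | prime l) \sum_(1 <= k < N.+1 | n == (l ^ k)%N) ln l%:R.
Proof.
move=> nN; rewrite /vonMangoldt.
rewrite [LHS](eq_bigr (fun l => \sum_(1 <= k < N.+1 | n == (l ^ k)%N) ln l%:R)); last first.
  move=> l pl; rewrite (big_nat_widen _ _ N.+1) //; apply: eq_bigl => k.
  by case: eqP => //= ->; rewrite ltnS ltnW // ltn_expl // prime_gt1.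
rewrite (big_nat_widen _ _ N.+1) // [RHS](bigID (fun l => (l < n.+1)%N)) /=.
rewrite [X in _ = _ + X]big1_seq ?addr0 // => l /andP[/andP[pl ln_] _].
rewrite big_nat_cond big1 // => k /andP[/andP[k0 _] /eqP e]; move: ln_.
by rewrite e ltnS -{1}(expn1 l) leq_exp2l ?prime_gt1 // k0.
Qed.

Lemma sum_vonMangoldt N (F : nat -> R) :
  \sum_(1 <= n < N.+1) vonMangoldt n * F n =
  \sum_(1 <= l < N.+1 | prime l)
     \sum_(1 <= k < N.+1 | (l ^ k <= N)%N) ln l%:R * F (l ^ k)%N.
Proof.
rewrite (eq_big_nat _ _ (F2 := fun n => \sum_(1 <= l < N.+1 | prime l)
  \sum_(1 <= k < N.+1) if n == (l ^ k)%N then ln l%:R * F n else 0)); last first.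
  move=> n /andP[_ nN]; rewrite (@vonMangoldt_widen n N) // big_distrl /=.
  apply: eq_bigr => l _; rewrite big_distrl big_mkcond /=.
  by apply: eq_bigr => k _; case: ifP.
rewrite exchange_big /=; apply: eq_bigr => l pl; rewrite exchange_big /=.
rewrite [RHS]big_mkcond; apply: eq_bigr => k _.
case: ifP => h; last first.
  rewrite big_nat_cond big1 // => n /andP[/andP[_ nN] _].
  by case: eqP => // e; move: nN; rewrite e ltnS h.
rewrite -big_mkcond big_nat_cond.
rewrite (eq_bigl (fun n => n == (l ^ k)%N)); last first.
  by move=> n; case: eqP; rewrite ?andbF ?andbT // => ->; rewrite expn_gt0 prime_gt0.
rewrite (big_rem (l ^ k)%N) /=; last first.
  by rewrite mem_index_iota expn_gt0 prime_gt0 // ltnS.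
rewrite eqxx big1_seq ?addr0 // => n /andP[/eqP -> ].
by rewrite mem_rem_uniqF // iota_uniq.
Qed.

Lemma sum_logn (n N l : nat) : prime l -> (0 < n <= N)%N ->
  \sum_(1 <= k < N.+1 | (l ^ k %| n)%N) (1 : R) = (logn l n)%:R.
Proof.
move=> pl /andP[n0 nN].
under eq_bigl do rewrite pfactor_dvdn //.
have lN : (logn l n <= N)%N by apply: leq_trans nN; apply: ltnW; apply: ltn_logl.
have := big_nat_widen 1 (logn l n).+1 N.+1 xpredT (fun=> 1 : R) lN.
by rewrite /= => <-; rewrite sumr_const_nat subn1.
Qed.

Lemma ln_logn (n N : nat) : (0 < n <= N)%N ->
  ln n%:R = \sum_(1 <= l < N.+1 | prime l) (logn l n)%:R * ln l%:R :> R.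
Proof.
move=> /andP[n0 nN].
rewrite -{1}(partnT n0) /partn ln_prodn; last first.
  by move=> l _; case: (posnP l) => [->|l0]; [rewrite lognE | rewrite expn_gt0 l0].
rewrite (eq_bigl (fun=> true)) // (big_nat_widen _ _ N.+1) //.
rewrite big_ltn_cond // lognE /= expn0 ln1 add0r.
rewrite [RHS]big_mkcond [LHS]big_mkcond /=; apply: eq_big_nat => l /andP[l0 lN].
rewrite natrX lnXn ?ltr0n // -[ln _ *+ _]mulr_natl.
have [pl|pl] := boolP (prime l); last first.
  by have -> : logn l n = 0%N; [rewrite lognE (negPf pl) | rewrite mul0r; case: ifP].
rewrite ltnS; case: leqP => //= nl.
by have -> : logn l n = 0%N; [rewrite lognE pl n0 gtnNdvd | rewrite mul0r].
Qed.

(** Both sides count each prime l with its multiplicity in n, with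
weight ln l. *)
Lemma sum_divisors_vonMangoldt n : (0 < n)%N ->
  \sum_(1 <= d < n.+1 | (d %| n)%N) vonMangoldt d = ln n%:R.
Proof.
move=> n0; rewrite (@ln_logn n n) ?n0 //=.
rewrite big_mkcond (eq_bigr (fun d => vonMangoldt d * (d %| n)%N%:R)); last first.
  by move=> d _; case: ifP => _; rewrite ?mulr1 ?mulr0.
rewrite (sum_vonMangoldt n (fun d => (d %| n)%N%:R)); apply: eq_bigr => l pl.
rewrite -(@sum_logn n n) ?n0 //= big_distrl /= big_mkcond [RHS]big_mkcond /=.
apply: eq_bigr => k _; rewrite mul1r.
have [d|nd] := boolP (l ^ k %| n)%N; last by rewrite mulr0 if_same.
by rewrite dvdn_leq // mulr1.
Qed.

Lemma vonMangoldt_le_ln n : vonMangoldt n <= ln n%:R.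
Proof.
case: n => [|n]; first by rewrite /vonMangoldt !big_geq // ln0.
rewrite -(sum_divisors_vonMangoldt (ltn0Sn n)) (big_rem n.+1) /=; last first.
  by rewrite mem_index_iota /=.
by rewrite dvdnn lerDl sumr_ge0 // => d _; exact: vonMangoldt_ge0.
Qed.

Definition chebyshev_psi (N : nat) : R := \sum_(1 <= n < N.+1) vonMangoldt n.

Lemma sum_ln N : \sum_(1 <= n < N.+1) ln n%:R =
  \sum_(1 <= d < N.+1) vonMangoldt d * (N %/ d)%:R :> R.
Proof.
rewrite (eq_big_nat _ _ (F2 := fun n => \sum_(1 <= d < n.+1 | (d %| n)%N) vonMangoldt d)).
  rewrite (sum_divisors_exchange N (fun d n => vonMangoldt d)).
  by apply: eq_bigr => d _; rewrite sumr_const_nat subn1 mulr_natr.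
by move=> n /andP[n0 _]; rewrite sum_divisors_vonMangoldt.
Qed.

End VonMangoldt.

(** * Chebyshev bounds *)

Section Chebyshev.
Variable R : realType.

Lemma ln2_le1 : ln 2 <= 1 :> R.
Proof. by have := @le_ln1Dx R 1 ltac:(lra); rewrite -[1 + 1]/(2%:R). Qed.

Lemma ln2_ge : 2^-1 <= ln 2 :> R.
Proof.
have := @le_ln1Dx R (- 2^-1) ltac:(lra).
have -> : 1 + - 2^-1 = 2^-1 :> R by lra.
by rewrite lnV ?posrE //; lra.
Qed.

Lemma harmonic_sum_le Q : (0 < Q)%N -> harmonic_sum R Q <= 1 + ln Q%:R.
Proof.
rewrite /harmonic_sum; elim: Q => // [[|Q] IH] _; first by rewrite big_nat1 invr1 ln1 addr0.
rewrite big_nat_recr //=; apply: (le_trans (lerD (IH isT) (lexx _))).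
rewrite -addrA lerD2l.
have q0 : (0 : R) < Q.+1%:R by rewrite ltr0n.
have q1 : (0 : R) < Q.+2%:R by rewrite ltr0n.
have h1 : (Q.+2%:R)^-1 < 1 :> R by rewrite invf_lt1 // ltr1n.
have hm : -1 < - (Q.+2%:R)^-1 :> R by rewrite ltrN2.
have := le_ln1Dx hm.
have -> : 1 + - (Q.+2%:R)^-1 = Q.+1%:R / Q.+2%:R :> R.
  have -> : Q.+1%:R = Q.+2%:R - 1 :> R by rewrite -[Q.+2%:R]natr1 addrK.
  by rewrite mulrBl divff ?lt0r_neq0 // mul1r.
by rewrite ln_div ?posrE // lerBlDr => h; rewrite -lerBrDr addrC.
Qed.

Lemma ln_factS n : ln (n.+1`!)%:R = ln (n`!)%:R + ln n.+1%:R :> R.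
Proof. by rewrite factS natrM lnM ?posrE ?ltr0n ?fact_gt0 // addrC. Qed.

Lemma ln_fact N : ln (N`!)%:R = \sum_(1 <= n < N.+1) ln n%:R :> R.
Proof.
elim: N => [|N IH]; first by rewrite fact0 ln1 big_geq.
by rewrite ln_factS IH [in RHS]big_nat_recr.
Qed.

Lemma central_bin_ge n : (2 ^ n <= 'C(n.*2, n))%N.
Proof.
elim: n => [|n IH]; first by rewrite bin0.
rewrite doubleS binS expnS; have h1 := binS n.*2 n.
have h2 : ('C(n.*2, n) <= 'C(n.*2.+1, n))%N.
  by case: (n) => [|m]; rewrite ?bin0 // binS leq_addr.
rewrite h1; lia.
Qed.

Lemma bin_le_exp n k : ('C(n, k) <= 2 ^ n)%N.
Proof.
elim: n k => [|n IH] [|k]; rewrite ?bin0 ?expn_gt0 // ?bin0n // binS expnS.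
by have := IH k; have := IH k.+1; lia.
Qed.

Lemma sum_ln_widen n N : (n <= N)%N -> \sum_(1 <= k < n.+1) ln k%:R =
  \sum_(1 <= d < N.+1) vonMangoldt R d * (n %/ d)%:R :> R.
Proof.
move=> nN; rewrite sum_ln (@big_cat_nat _ _ _ n.+1 1 N.+1) //=.
rewrite [X in _ = _ + X]big_nat_cond [X in _ = _ + X]big1 ?addr0 //.
by move=> d /andP[/andP[nd _] _]; rewrite divn_small // mulr0.
Qed.

(** The formula for the sum of ln k over k <= N as a sum of vonMangoldt d * (N %/ d),
applied to the factorials in the binomial coefficient. *)
Lemma ln_central_bin n : ln 'C(n.*2, n)%:R =
  \sum_(1 <= d < n.*2.+1) vonMangoldt R d * ((n.*2 %/ d)%:R - 2 * (n %/ d)%:R) :> R.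
Proof.
have nn : (n <= n.*2)%N by rewrite -addnn leq_addr.
have e := bin_fact nn.
have -> : ln 'C(n.*2, n)%:R = ln (n.*2`!)%:R - 2 * ln (n`!)%:R :> R.
  rewrite -e (_ : (n.*2 - n = n)%N) -?addnn ?addnK // !natrM.
  by rewrite !lnM ?posrE ?mulr_gt0 ?ltr0n ?fact_gt0 // -?addnn ?bin_gt0 ?leq_addr //; ring.
rewrite !ln_fact (sum_ln_widen (leqnn _)) (sum_ln_widen nn) big_distrr -sumrB /=.
by apply: eq_bigr => d _; ring.
Qed.

Lemma divn_double d n : (0 < d)%N ->
  (n %/ d * 2 <= n.*2 %/ d <= n %/ d * 2 + 1)%N.
Proof.
move=> d0; rewrite leq_divRL // -[X in _ && X]ltnS ltn_divLR //.
have := divn_eq n d; have := ltn_pmod n d0.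
move: (n %/ d)%N (n %% d)%N => q r rd e.
by apply/andP; split; rewrite e -addnn; nia.
Qed.

(** The coefficients 2n %/ d - 2 (n %/ d) in [ln_central_bin] are 0 or 1. *)
Lemma chebyshev_psi_double_ge n : n%:R * ln 2 <= chebyshev_psi R n.*2.
Proof.
apply: (@le_trans _ _ (ln 'C(n.*2, n)%:R)).
  by rewrite mulr_natl -lnXn // -natrX ler_ln_nat ?expn_gt0 // central_bin_ge.
rewrite ln_central_bin /chebyshev_psi big_nat_cond [leRHS]big_nat_cond.
apply: ler_sum => d /andP[/andP[d0 _] _].
rewrite -[leRHS]mulr1 ler_wpM2l ?vonMangoldt_ge0 //.
have /andP[_ h] := divn_double n d0.
by rewrite lerBlDl mulrC -natrM natr1 ler_nat -addn1.
Qed.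

(** The coefficients in [ln_central_bin] are 1 for n < d <= 2n. *)
Lemma chebyshev_psi_double_le n : chebyshev_psi R n.*2 <= chebyshev_psi R n + n.*2%:R * ln 2.
Proof.
have hC : ln 'C(n.*2, n)%:R <= n.*2%:R * ln 2 :> R.
  rewrite mulr_natl -lnXn // -natrX ler_ln_nat ?bin_le_exp //.
  by rewrite bin_gt0 -addnn leq_addr.
rewrite -lerBlDl; apply: le_trans hC.
rewrite ln_central_bin /chebyshev_psi (@big_cat_nat _ _ _ n.+1 1) //=; last first.
  by rewrite ltnS -addnn leq_addr.
rewrite addrAC subrr add0r (@big_cat_nat _ _ _ n.+1 1 n.*2.+1) //=; last first.
  by rewrite ltnS -addnn leq_addr.
rewrite -[leLHS]add0r; apply: lerD.
  rewrite big_nat_cond; apply: sumr_ge0 => d /andP[/andP[d0 _] _].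
  rewrite mulr_ge0 ?vonMangoldt_ge0 // subr_ge0 mulrC -natrM ler_nat.
  by have /andP[] := divn_double n d0.
rewrite big_nat_cond [leRHS]big_nat_cond.
apply: ler_sum => d /andP[/andP[d0 d1] _].
have -> : (n %/ d = 0)%N by rewrite divn_small.
rewrite mulr0 subr0 -[leLHS]mulr1 ler_wpM2l ?vonMangoldt_ge0 // ler1n divn_gt0 //; lia.
Qed.

Lemma chebyshev_psi_mono m n : (m <= n)%N -> chebyshev_psi R m <= chebyshev_psi R n.
Proof.
move=> mn; rewrite /chebyshev_psi (@big_cat_nat _ _ _ m.+1 1 n.+1) //= lerDl.
by apply: sumr_ge0 => d _; exact: vonMangoldt_ge0.
Qed.

Lemma chebyshev_psi_ge N : (1 < N)%N -> N%:R / 8 <= chebyshev_psi R N.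
Proof.
move=> N1; have h := chebyshev_psi_double_ge N./2.
have h1 : (N./2.*2 <= N)%N by rewrite -[leqRHS]odd_double_half leq_addl.
apply: le_trans (chebyshev_psi_mono h1); apply: le_trans h.
have h2 : (N <= N./2 * 4)%N.
  have := odd_double_half N; have : (odd N <= 1)%N by case: odd.
  by rewrite -muln2; lia.
have h3 : N%:R <= (N./2)%:R * 4 :> R by rewrite -natrM ler_nat.
by have := ln2_ge; have : 0 <= (N./2)%:R :> R by []; nra.
Qed.

Lemma chebyshev_psi_le N : chebyshev_psi R N <= 4 * N%:R.
Proof.
elim/ltn_ind: N => N IH.
have [N1|N1] := leqP N 0; first by rewrite (_ : N = 0%N) ?/chebyshev_psi ?big_geq ?mulr0 //; lia.
have hlt : (N./2 < N)%N by lia.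
have h1 := IH _ hlt.
have h2 := chebyshev_psi_double_le N./2.
have l2 := ln2_le1.
have h3 : chebyshev_psi R N <= chebyshev_psi R N./2.*2 + (odd N)%:R * ln N%:R.
  rewrite -{1}[N]odd_double_half; case o: (odd N); last by rewrite mul0r addr0.
  rewrite add1n /chebyshev_psi big_nat_recr //= lerD2l mul1r.
  apply: (le_trans (vonMangoldt_le_ln _ _)); apply: ler_ln_nat => //.
  by rewrite -[leqRHS]odd_double_half o.
have h4 : ln N%:R <= N%:R :> R by rewrite ltW // ln_sublinear // ltr0n.
have l0 := ln_nat_ge0 R N.
have e : N%:R = (odd N)%:R + 2 * (N./2)%:R :> R.
  by rewrite -{1}[N]odd_double_half natrD -mul2n natrM.
have ed : (N./2.*2)%:R = 2 * (N./2)%:R :> R by rewrite -mul2n natrM.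
have hh : 0 <= (N./2)%:R :> R by [].
rewrite ed in h2.
move: (chebyshev_psi R N) (chebyshev_psi R N./2) (chebyshev_psi R _) h1 h2 h3 => X Y Z h1 h2 h3.
by case: (odd N) e h3 => /= e h3; nra.
Qed.

Definition prime_pi (N : nat) : nat := \sum_(1 <= l < N.+1 | prime l) 1.

Lemma sum_pow_le l N : prime l -> (l <= N)%N ->
  \sum_(1 <= k < N.+1 | (l ^ k <= N)%N) ln l%:R <= ln N%:R :> R.
Proof.
move=> pl lN; have l1 := prime_gt1 pl.
have N0 : (0 < N)%N by apply: leq_trans lN; exact: prime_gt0.
have e k : (l ^ k <= N)%N = (k <= trunc_log l N)%N.
  apply/idP/idP => [h|h]; first exact: trunc_log_max.
  by apply: leq_trans (trunc_logP l1 N0); rewrite leq_exp2l.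
under eq_bigl do rewrite e.
have tN : (trunc_log l N <= N)%N.
  by apply: leq_trans (trunc_logP l1 N0); apply: ltnW; rewrite ltn_expl.
have := big_nat_widen 1 (trunc_log l N).+1 N.+1 xpredT (fun=> ln l%:R : R) tN.
rewrite /= => <-; rewrite sumr_const_nat subn1 /= -lnXn ?ltr0n ?prime_gt0 //.
by rewrite -natrX ler_ln_nat ?expn_gt0 ?prime_gt0 // trunc_logP.
Qed.

Lemma chebyshev_psi_le_prime_pi N : chebyshev_psi R N <= (prime_pi N)%:R * ln N%:R.
Proof.
rewrite /chebyshev_psi (eq_bigr (fun n => vonMangoldt R n * 1)); last by move=> *; rewrite mulr1.
rewrite (sum_vonMangoldt N (fun=> 1)) /prime_pi natr_sum big_distrl /=.
rewrite big_nat_cond [leRHS]big_nat_cond; apply: ler_sum => l /andP[/andP[_ lN] pl].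
under eq_bigr do rewrite mulr1.
by rewrite mul1r sum_pow_le.
Qed.

End Chebyshev.

(** * The truncated Moebius function *)

Section Moebius.
Variable R : realType.

(** The factors make moebius vanish on integers that are not squarefree. *)
Definition moebius (n : nat) : R :=
  \prod_(l <- primes n) (if (logn l n == 1)%N then -1 else 0).

Lemma moebius_norm_le1 n : `|moebius n| <= 1.
Proof.
rewrite /moebius; elim/big_ind: _ => [|x y hx hy|l _]; first by rewrite normr1.
  by rewrite normrM mulr_ile1.
by case: ifP => _; rewrite ?normrN ?normr1 ?normr0.
Qed.

Lemma moebius1 : moebius 1 = 1.
Proof. by rewrite /moebius big_nil. Qed.

Lemma moebius_mul_prime l e : prime l -> (0 < e)%N -> ~~ (l %| e)%N -> moebius (l * e) = - moebius e.
Proof.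
move=> pl e0 nle; have l0 := prime_gt0 pl.
have le0 : (0 < l * e)%N by rewrite muln_gt0 l0.
have lp : l \notin primes e by rewrite mem_primes (negPf nle) !andbF.
have pe : perm_eq (primes (l * e)) (l :: primes e).
  apply: uniq_perm; rewrite ?primes_uniq //= ?lp ?primes_uniq //.
  by move=> q; rewrite primesM // primes_prime // !inE.
rewrite /moebius (perm_big _ pe) big_cons lognM // lognE pl l0 dvdnn divnn l0 logn1.
rewrite lognE pl e0 (negPf nle) /= mulN1r; congr (- _).
rewrite big_seq [RHS]big_seq; apply: eq_bigr => q qe.
rewrite lognM //; suff -> : logn q l = 0%N by [].
rewrite lognE l0; case: (boolP (prime q)) => //= pq.
by rewrite dvdn_prime2 //; case: eqP => // ql; move: lp; rewrite -ql qe.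
Qed.

Lemma moebius_sqr_dvd l e : prime l -> (0 < e)%N -> (l %| e)%N -> moebius (l * e) = 0.
Proof.
move=> pl e0 le; have l0 := prime_gt0 pl.
have lp : l \in primes (l * e) by rewrite mem_primes pl muln_gt0 l0 e0 dvdn_mulr.
rewrite /moebius (big_rem l lp) /= lognM // [logn l l]lognE pl l0 dvdnn divnn l0 logn1.
rewrite lognE pl e0 le /=.
by rewrite mul0r.
Qed.

(** For l a prime divisor of n, the divisors d and l d with l not dividing d
cancel, and the divisors divisible by l ^ 2 contribute nothing. *)
Lemma sum_moebius n : (1 < n)%N -> \sum_(1 <= d < n.+1 | (d %| n)%N) moebius d = 0.
Proof.
move=> n1; have n0 : (0 < n)%N by exact: ltnW.
pose l := pdiv n; have pl : prime l by exact: pdiv_prime.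
have ln : (l %| n)%N by exact: pdiv_dvd.
have l0 := prime_gt0 pl.
rewrite (bigID (fun d => (l %| d)%N)) /=.
rewrite (eq_bigl (fun d => (l %| d)%N && (d %| n)%N)); last by move=> d; rewrite andbC.
rewrite (_ : \sum_(1 <= d < n.+1 | (l %| d)%N && (d %| n)%N) moebius d =
   \sum_(1 <= d < n.+1 | (l %| d)%N) if (d %| n)%N then moebius d else 0); last first.
  by rewrite big_mkcondr.
rewrite (sum_multiples n (fun d => if (d %| n)%N then moebius d else 0) l0).
rewrite (sum_div_widen n (fun e => if (l * e %| n)%N then moebius (l * e) else 0) l0).
apply/eqP; rewrite addr_eq0 -sumrN; apply/eqP.
rewrite big_mkcond [RHS]big_mkcond /=; apply: eq_big_nat => e /andP[e0 _].
have [le|nle] := boolP (l %| e)%N.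
  by rewrite moebius_sqr_dvd // andbF if_same if_same.
rewrite moebius_mul_prime // andbT Gauss_dvd ?prime_coprime // ln /=.
case: (boolP (e %| n)%N) => en; last by rewrite if_same.
rewrite dvdn_leq // Gauss_dvd ?prime_coprime //.
by rewrite ln.
Qed.

Variable V : nat.
Definition moebius_upto d : R := if (d <= V)%N then moebius d else 0.
(** The convolution of the truncated Moebius function with 1: it agrees with the
identity of convolution up to V. *)
Definition moebius_upto_sum (k : nat) : R := \sum_(1 <= d < k.+1 | (d %| k)%N) moebius_upto d.

Lemma moebius_upto_sum1 : (0 < V)%N -> moebius_upto_sum 1 = 1.
Proof. by move=> V0; rewrite /moebius_upto_sum big_mkcond big_nat1 /= /moebius_upto V0 moebius1. Qed.

Lemma moebius_upto_sum_eq0 k : (1 < k <= V)%N -> moebius_upto_sum k = 0.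
Proof.
move=> /andP[k1 kV]; rewrite /moebius_upto_sum -[RHS](sum_moebius k1) big_nat_cond [RHS]big_nat_cond.
apply: eq_bigr => d /andP[/andP[_ dk] _]; rewrite /moebius_upto ifT //.
by apply: leq_trans kV.
Qed.

Lemma moebius_upto_sum_norm k : (0 < k)%N ->
  `|moebius_upto_sum k| <= \sum_(1 <= d < V.+1) (d %| k)%N%:R.
Proof.
move=> k0; apply: (le_trans (ler_norm_sum _ _ _)).
apply: (@le_trans _ _ (\sum_(1 <= d < (maxn k V).+1 | (d %| k)%N) (d <= V)%N%:R)).
  rewrite -(sum_divisors_widen (N := maxn k V)) ?k0 ?leq_maxl //.
  apply: ler_sum => d _; rewrite /moebius_upto.
  by case: ifP => _ /=; rewrite ?moebius_norm_le1 ?normr0.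
rewrite [leRHS](big_nat_widen _ _ (maxn k V).+1) ?ltnS ?leq_maxr //=.
rewrite big_mkcond [leRHS]big_mkcond; apply: ler_sum => d _ /=.
by rewrite ltnS; case: (d %| k)%N; case: (d <= V)%N.
Qed.

Lemma sum_lcm_le N d e : (0 < d)%N -> (0 < e)%N ->
  \sum_(1 <= k < N.+1) ((d %| k)%N%:R * (e %| k)%N%:R) <=
  N%:R * ((gcdn d e)%:R / (d%:R * e%:R)) :> R.
Proof.
move=> d0 e0.
have l0 : (0 < lcmn d e)%N by rewrite lcmn_gt0 d0.
rewrite (eq_bigr (fun k => if (lcmn d e %| k)%N then 1 else 0)); last first.
  move=> k _; rewrite dvdn_lcm.
  by case: (d %| k)%N; case: (e %| k)%N; rewrite /= ?mulr0 ?mul0r ?mulr1.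
rewrite -big_mkcond /= (sum_multiples N (fun=> 1) l0) sumr_const_nat subn1 /=.
have e1 : (gcdn d e)%:R / (d%:R * e%:R) = (lcmn d e)%:R^-1 :> R.
  rewrite -natrM -muln_lcm_gcd natrM invfM mulrCA mulfV ?mulr1 //.
  by rewrite pnatr_eq0 -lt0n gcdn_gt0 d0.
by rewrite e1 ler_pdivlMr ?ltr0n // -natrM ler_nat leq_divM.
Qed.

Lemma gcdn_le_sum d e : (0 < d <= V)%N -> (0 < e)%N ->
  (gcdn d e)%:R <= \sum_(1 <= g < V.+1) (g%:R * ((g %| d)%N%:R * (g %| e)%N%:R)) :> R.
Proof.
move=> /andP[d0 dV] e0.
have g0 : (0 < gcdn d e)%N by rewrite gcdn_gt0 d0.
rewrite (big_rem (gcdn d e)) /=; last first.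
  rewrite mem_index_iota g0 ltnS; apply: leq_trans dV.
  by rewrite dvdn_leq // dvdn_gcdl.
rewrite dvdn_gcdl dvdn_gcdr !mulr1 lerDl sumr_ge0 // => g _.
Qed.

Lemma sum_dvd_inv g : (0 < g)%N ->
  \sum_(1 <= d < V.+1) ((g %| d)%N%:R / d%:R) <= g%:R^-1 * harmonic_sum R V.
Proof.
move=> g0.
rewrite (eq_bigr (fun d => if (g %| d)%N then d%:R^-1 else 0)); last first.
  by move=> d _; case: ifP => _; rewrite ?mul1r ?mul0r.
rewrite -big_mkcond /= (sum_multiples V (fun d => d%:R^-1) g0) /harmonic_sum big_distrr /=.
rewrite [leRHS](@big_cat_nat _ _ _ (V %/ g).+1 1 V.+1) //= ?ltnS ?leq_div //.
rewrite [leLHS](eq_bigr (fun i => g%:R^-1 * i%:R^-1)); last first.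
  by move=> i _; rewrite natrM invfM.
by rewrite lerDl sumr_ge0 // => i _; rewrite mulr_ge0 ?invr_ge0.
Qed.

(** Bound the convolution by the number of divisors up to V, expand
the square into pairs (d, e), and replace gcd(d, e) / (d e) by a sum over the
common divisors g, which separates d from e. *)
Lemma moebius_upto_sum_mean_square N :
  \sum_(1 <= k < N.+1) moebius_upto_sum k ^+ 2 <= N%:R * harmonic_sum R V ^+ 3.
Proof.
apply: (@le_trans _ _ (\sum_(1 <= k < N.+1) (\sum_(1 <= d < V.+1) (d %| k)%N%:R) ^+ 2)).
  rewrite big_nat_cond [leRHS]big_nat_cond; apply: ler_sum => k /andP[/andP[k0 _] _].
  have h := moebius_upto_sum_norm k0.
  by rewrite -[leLHS]real_normK ?num_real // !expr2; apply: ler_pM.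
rewrite (eq_bigr (fun k => \sum_(1 <= d < V.+1) \sum_(1 <= e < V.+1)
   ((d %| k)%N%:R * (e %| k)%N%:R))); last first.
  move=> k _; rewrite expr2 big_distrl /=; apply: eq_bigr => d _.
  by rewrite big_distrr.
rewrite exchange_big /=.
apply: (@le_trans _ _ (\sum_(1 <= d < V.+1) \sum_(1 <= e < V.+1)
    \sum_(1 <= g < V.+1) N%:R * (g%:R * ((g %| d)%N%:R / d%:R) * ((g %| e)%N%:R / e%:R)))).
  rewrite big_nat_cond [leRHS]big_nat_cond.
  apply: ler_sum => d /andP[/andP[d0 dV] _]; rewrite exchange_big /=.
  rewrite big_nat_cond [leRHS]big_nat_cond.
  apply: ler_sum => e /andP[/andP[e0 eV] _].
  apply: (le_trans (sum_lcm_le N d0 e0)); rewrite -big_distrr /= ler_wpM2l //.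
  rewrite mulrC -ler_pdivlMl ?invr_gt0 ?mulr_gt0 ?ltr0n // invrK.
  have dV' : (0 < d <= V)%N by rewrite d0.
  apply: (le_trans (gcdn_le_sum dV' e0)); rewrite big_distrr /=.
  apply: ler_sum => g _; rewrite le_eqVlt; apply/orP; left; apply/eqP.
  by field; rewrite !pnatr_eq0 -!lt0n d0 e0.
rewrite (eq_bigr (fun d => \sum_(1 <= g < V.+1) \sum_(1 <= e < V.+1)
   N%:R * (g%:R * ((g %| d)%N%:R / d%:R) * ((g %| e)%N%:R / e%:R)))); last first.
  by move=> d _; rewrite exchange_big.
rewrite exchange_big /=.
have H0 := harmonic_sum_ge0 R V.
apply: (@le_trans _ _ (\sum_(1 <= g < V.+1) N%:R * (g%:R^-1 * harmonic_sum R V ^+ 2))).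
  rewrite big_nat_cond [leRHS]big_nat_cond; apply: ler_sum => g /andP[/andP[g0 _] _].
  have h := sum_dvd_inv g0.
  rewrite (eq_bigr (fun d => N%:R * g%:R * ((g %| d)%N%:R / d%:R) *
    \sum_(1 <= e < V.+1) ((g %| e)%N%:R / e%:R))); last first.
    move=> d _; rewrite big_distrr /=; apply: eq_bigr => e _; ring.
  rewrite -big_distrl -big_distrr /=.
  set X := \sum_(_ <= _ < _) _ in h *.
  have X0 : 0 <= X by apply: sumr_ge0 => e _; rewrite mulr_ge0 ?invr_ge0.
  have g0R : 0 < g%:R :> R by rewrite ltr0n.
  rewrite -!mulrA ler_wpM2l //.
  have -> : g%:R^-1 * harmonic_sum R V ^+ 2 = g%:R * ((g%:R^-1 * harmonic_sum R V) * (g%:R^-1 * harmonic_sum R V)).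
    by field; rewrite lt0r_neq0.
  by rewrite ler_wpM2l // ler_pM.
by rewrite -big_distrr -big_distrl /= -/(harmonic_sum R V) exprS.
Qed.

End Moebius.

(** * The identity of Vaughan *)

Section TypeI.
Variable R : realType.
Variable p : nat.
Hypothesis pr : prime p.

Lemma sum_periodic_mod (f : nat -> R) n :
  (forall j, f (j + p)%N = f j) -> \sum_(0 <= j < p) f j = 0 ->
  \sum_(0 <= j < n) f j = \sum_(0 <= j < n %% p) f j.
Proof.
move=> fp f0; rewrite {1}(divn_eq n p).
elim: (n %/ p)%N => [|q IH]; first by rewrite mul0n.
rewrite -IH mulSn -addnA (@big_cat_nat _ _ _ p) ?leq_addr //= f0 add0r.
rewrite -{1}[p]add0n big_addn addKn; apply: eq_bigr => j _; exact: fp.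
Qed.

(** Full periods contribute nothing. An incomplete period gives a
difference of two quantities between 0 and 1. *)
Lemma sum_dev_one_progression_le1 c J : `|\sum_(1 <= j < J.+1) dev_one R p (j * c)| <= 1.
Proof.
have [d|nd] := boolP (p %| c)%N.
  by rewrite big1 ?normr0 // => j _; rewrite dev_one_dvd // dvdn_mull.
have -> : \sum_(1 <= j < J.+1) dev_one R p (j * c) = \sum_(0 <= j < J.+1) dev_one R p (j * c).
  by rewrite [RHS]big_ltn // dev_one_dvd ?mul0n ?dvdn0 // add0r.
rewrite (sum_periodic_mod _ _ (sum_dev_one_mul R pr c)); last first.
  by move=> j; apply: dev_one_mod; rewrite mulnDl addnC [(p * c)%N]mulnC modnMDl.
set r := (_ %% _)%N; have rp : (r <= p)%N by rewrite ltnW // ltn_pmod // prime_gt0.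
pose A n : R := (n %% p == 1)%N%:R.
pose B n : R := if (p %| n)%N then 0 else (p.-1)%:R^-1.
have B0 n : 0 <= B n by rewrite /B; case: ifP => // _; rewrite invr_ge0.
have A0 n : 0 <= A n by [].
have SA : \sum_(0 <= j < p) A (j * c)%N = 1.
  rewrite (sum_mul_mod pr nd); last by move=> a b e; rewrite /A e.
  have p1 := prime_gt1 pr.
  rewrite big_ltn ?prime_gt0 // big_ltn // /A mod0n modn_small //= add0r.
  rewrite big_nat_cond big1 ?addr0 // => i /andP[/andP[i2 ip] _].
  by rewrite modn_small //; case: eqP => //; lia.
have SB : \sum_(0 <= j < p) B (j * c)%N = 1.
  have := sum_dev_one_mul R pr c; rewrite /dev_one sumrB -/A => /eqP.
  by rewrite subr_eq0 => /eqP <-.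
have mono F : (forall n, 0 <= F n) -> \sum_(0 <= j < r) F j <= \sum_(0 <= j < p) F j :> R.
  by move=> F0; rewrite [leRHS](@big_cat_nat _ _ _ r) //= lerDl sumr_ge0.
have hA := mono (fun j => A (j * c)%N) (fun j => A0 _).
have hB := mono (fun j => B (j * c)%N) (fun j => B0 _).
rewrite SA in hA; rewrite SB in hB.
have gA : 0 <= \sum_(0 <= j < r) A (j * c)%N by apply: sumr_ge0.
have gB : 0 <= \sum_(0 <= j < r) B (j * c)%N by apply: sumr_ge0.
by rewrite /dev_one sumrB ler_norml; apply/andP; split; rewrite -/A; lra.
Qed.

(** Abel summation against the increasing weights ln j. *)
Lemma abel_ln (f : nat -> R) J :
  (forall n, `|\sum_(1 <= j < n.+1) f j| <= 1) ->
  `|\sum_(1 <= j < J.+1) ln j%:R * f j| <= 2 * ln J%:R.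
Proof.
move=> h; have [J0|J0] := posnP J; first by rewrite J0 big_geq // normr0 ln0 // mulr0.
have : `|\sum_(1 <= j < J.+1) ln j%:R * f j - ln J%:R * \sum_(1 <= j < J.+1) f j|
   <= ln J%:R.
  elim: J J0 => // -[_ _|J IH _].
    by rewrite !big_nat1 ln1 !mul0r subr0 normr0.
  rewrite !(big_nat_recr J.+2) //=.
  have := IH isT; have := h J.+1.
  set X := \sum_(_ <= _ < _) _ * _; set Y := \sum_(_ <= _ < _) f _ => hY hX.
  have l : ln J.+1%:R <= ln J.+2%:R :> R by apply: ler_ln_nat.
  have -> : X + ln J.+2%:R * f J.+2 - ln J.+2%:R * (Y + f J.+2) =
    (X - ln J.+1%:R * Y) - (ln J.+2%:R - ln J.+1%:R) * Y by ring.
  apply: (le_trans (ler_normB _ _)); rewrite normrM [`|ln _ - _|]ger0_norm ?subr_ge0 //.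
  have : 0 <= ln J.+2%:R - ln J.+1%:R :> R by rewrite subr_ge0.
  by move: (ln J.+2%:R) (ln J.+1%:R) hX => a b hX ab; nra.
have l := ln_nat_ge0 R J.
move: (h J); set Y := \sum_(_ <= _ < _) f _ => hY hX.
set X := \sum_(_ <= _ < _) _ * _ in hX *.
have -> : X = (X - ln J%:R * Y) + ln J%:R * Y by ring.
apply: (le_trans (ler_normD _ _)); rewrite normrM (ger0_norm l).
by nra.
Qed.

End TypeI.

Section Vaughan.
Variable R : realType.
Variables (U V : nat).
Hypothesis V0 : (0 < V)%N.

Definition vonMangoldt_gt m : R := if (U < m)%N then vonMangoldt R m else 0.
Definition moebius_upto_sum_gt k : R := if (V < k)%N then moebius_upto_sum R V k else 0.

(** The part of the sum of Lambda(n) e_p(n) in which both variables exceed the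
cutoffs. *)
Definition typeII (y p : nat) : R :=
  \sum_(1 <= m < y.+1) \sum_(1 <= k < (y %/ m).+1)
     vonMangoldt_gt m * moebius_upto_sum_gt k * dev_one R p (m * k).

(** The convolution of the truncated Moebius function with 1 is 1 at k = 1, and
vanishes for 1 < k <= V. *)
Lemma vaughan_split y (e : nat -> R) :
  \sum_(1 <= m < y.+1) \sum_(1 <= k < (y %/ m).+1) vonMangoldt_gt m * moebius_upto_sum R V k * e (m * k)%N =
  \sum_(1 <= m < y.+1) vonMangoldt_gt m * e m +
  \sum_(1 <= m < y.+1) \sum_(1 <= k < (y %/ m).+1) vonMangoldt_gt m * moebius_upto_sum_gt k * e (m * k)%N.
Proof.
rewrite -big_split /=; apply: eq_big_nat => m /andP[m0 my].
have ym : (0 < y %/ m)%N by rewrite divn_gt0.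
rewrite big_ltn ?ltnS // [in RHS]big_ltn ?ltnS //.
rewrite moebius_upto_sum1 // mulr1 muln1 /moebius_upto_sum_gt ltnNge V0 /= mulr0 mul0r add0r.
congr (_ + _); apply: eq_big_nat => k /andP[k1 _].
by case: ltnP => // kV; rewrite moebius_upto_sum_eq0 ?k1 // !mulr0.
Qed.

(** Exchange the convolutions so that the truncated Moebius function comes
outside; the von Mangoldt function beyond U, convolved with 1, is ln minus a
sum over m <= U. *)
Lemma vaughan_typeI y (e : nat -> R) :
  \sum_(1 <= m < y.+1) \sum_(1 <= k < (y %/ m).+1) vonMangoldt_gt m * moebius_upto_sum R V k * e (m * k)%N =
  \sum_(1 <= d < y.+1) moebius_upto R V d *
    (\sum_(1 <= n < (y %/ d).+1) ln n%:R * e (n * d)%N -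
     \sum_(1 <= m < (y %/ d).+1) (if (m <= U)%N then vonMangoldt R m else 0) *
        \sum_(1 <= j < (y %/ d %/ m).+1) e (j * (m * d))%N).
Proof.
rewrite (eq_bigr (fun m => \sum_(1 <= d < (y %/ m).+1)
    \sum_(1 <= j < (y %/ m %/ d).+1) vonMangoldt_gt m * moebius_upto R V d * e (m * (d * j))%N)); last first.
  move=> m _.
  rewrite -(sum_divisors_exchange (y %/ m) (fun d k => vonMangoldt_gt m * moebius_upto R V d * e (m * k)%N)).
  apply: eq_bigr => k _; rewrite /moebius_upto_sum big_distrr big_distrl /=.
  by apply: eq_bigr => d _.
rewrite (hyperbola_swap y (fun m d => \sum_(1 <= j < (y %/ m %/ d).+1)
   vonMangoldt_gt m * moebius_upto R V d * e (m * (d * j))%N)).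
apply: eq_bigr => d _.
have -> : \sum_(1 <= n < (y %/ d).+1) ln n%:R * e (n * d)%N =
  \sum_(1 <= m < (y %/ d).+1) vonMangoldt R m *
     \sum_(1 <= j < (y %/ d %/ m).+1) e (j * (m * d))%N.
  rewrite (eq_big_nat _ _ (F2 := fun n =>
     \sum_(1 <= m < n.+1 | (m %| n)%N) vonMangoldt R m * e (n * d)%N)).
    rewrite (sum_divisors_exchange (y %/ d) (fun m n => vonMangoldt R m * e (n * d)%N)).
    apply: eq_bigr => m _; rewrite big_distrr; apply: eq_bigr => j _ /=.
    by congr (_ * e _); lia.
  by move=> n /andP[n0 _]; rewrite -big_distrl /= sum_divisors_vonMangoldt.
rewrite -sumrB big_distrr /=; apply: eq_bigr => m _.
rewrite -mulrBl mulrA divnAC big_distrr /=; apply: eq_bigr => j _.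
have -> : (m * (d * j) = j * (m * d))%N by lia.
by rewrite /vonMangoldt_gt ltnNge; case: (m <= U)%N => /=; ring.
Qed.

(** Adding the terms with n <= U, the two evaluations [vaughan_split] and
[vaughan_typeI] of one double sum leave the bilinear sum [typeII] and sums of
e_p over multiples of fixed integers, possibly weighted by ln. *)
Lemma vaughan_bound y p : prime p ->
  `|\sum_(1 <= n < y.+1) vonMangoldt R n * dev_one R p n| <=
  4 * U%:R + V%:R * (2 * ln y%:R + 4 * U%:R) + `|typeII y p|.
Proof.
move=> pr.
have psiU N : \sum_(1 <= m < N.+1) (if (m <= U)%N then vonMangoldt R m else 0) <= 4 * U%:R.
  apply: le_trans (chebyshev_psi_le R U); rewrite /chebyshev_psi.
  apply: (@le_trans _ _ (\sum_(1 <= m < (maxn N U).+1 | (m <= U)%N) vonMangoldt R m)).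
    rewrite -big_mkcond /= (big_nat_widen _ _ (maxn N U).+1) ?ltnS ?leq_maxl //.
    rewrite big_mkcond [leRHS]big_mkcond; apply: ler_sum => m _ /=.
    by case: (m <= U)%N; case: (m < N.+1)%N => //; exact: vonMangoldt_ge0.
  rewrite [leRHS](big_nat_widen _ _ (maxn N U).+1) ?ltnS ?leq_maxr //.
have le0 m : 0 <= (if (m <= U)%N then vonMangoldt R m else 0).
  by case: ifP => // _; exact: vonMangoldt_ge0.
have -> : \sum_(1 <= n < y.+1) vonMangoldt R n * dev_one R p n =
   \sum_(1 <= n < y.+1) (if (n <= U)%N then vonMangoldt R n else 0) * dev_one R p n +
   \sum_(1 <= n < y.+1) vonMangoldt_gt n * dev_one R p n.
  rewrite -big_split; apply: eq_bigr => n _ /=; rewrite -mulrDl; congr (_ * _).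
  by rewrite /vonMangoldt_gt ltnNge; case: (n <= U)%N; rewrite ?addr0 ?add0r.
have -> : \sum_(1 <= n < y.+1) vonMangoldt_gt n * dev_one R p n =
  \sum_(1 <= d < y.+1) moebius_upto R V d *
    (\sum_(1 <= n < (y %/ d).+1) ln n%:R * dev_one R p (n * d)%N -
     \sum_(1 <= m < (y %/ d).+1) (if (m <= U)%N then vonMangoldt R m else 0) *
        \sum_(1 <= j < (y %/ d %/ m).+1) dev_one R p (j * (m * d))%N) - typeII y p.
  by rewrite -vaughan_typeI vaughan_split /typeII addrK.
apply: (le_trans (ler_normD _ _)); rewrite -addrA; apply: lerD.
  apply: le_trans (psiU y); apply: (le_trans (ler_norm_sum _ _ _)).
  apply: ler_sum => n _; rewrite normrM (ger0_norm (le0 _)) -[leRHS]mulr1.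
  by rewrite ler_wpM2l // dev_one_norm_le1.
apply: (le_trans (ler_normB _ _)); rewrite lerD2r.
apply: (le_trans (ler_norm_sum _ _ _)).
have c0 : 0 <= 2 * ln y%:R + 4 * U%:R :> R.
  by rewrite addr_ge0 // mulr_ge0 // ln_nat_ge0.
apply: (@le_trans _ _ (\sum_(1 <= d < y.+1 | (d <= V)%N) (2 * ln y%:R + 4 * U%:R))).
  rewrite [leRHS]big_mkcond [leLHS]big_nat_cond [leRHS]big_nat_cond.
  apply: ler_sum => d /andP[/andP[d0 _] _]; rewrite normrM /moebius_upto.
  case: ifP => _; last by rewrite normr0 mul0r.
  rewrite -[leRHS]mul1r; apply: ler_pM => //; first exact: moebius_norm_le1.
  apply: (le_trans (ler_normB _ _)); apply: lerD.
    apply: (@le_trans _ _ (2 * ln (y %/ d)%N%:R)).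
      by apply: abel_ln => n; exact: sum_dev_one_progression_le1.
    rewrite ler_pM2l //; have [->|q0] := posnP (y %/ d)%N.
      by rewrite ln0 // ln_nat_ge0.
    by apply: ler_ln_nat => //; exact: leq_div.
  apply: le_trans (psiU (y %/ d)%N); apply: (le_trans (ler_norm_sum _ _ _)).
  apply: ler_sum => n _; rewrite normrM (ger0_norm (le0 _)) -[leRHS]mulr1.
  by rewrite ler_wpM2l // sum_dev_one_progression_le1.
rewrite [leLHS](big_nat_widen _ _ (maxn y V).+1) ?ltnS ?leq_maxl //=.
apply: (@le_trans _ _ (\sum_(1 <= d < (maxn y V).+1 | (d < V.+1)%N)
    (2 * ln y%:R + 4 * U%:R))).
  rewrite big_mkcond [leRHS]big_mkcond; apply: ler_sum => d _ /=; rewrite !ltnS.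
  by case: (d <= V)%N; case: (d <= y)%N.
have := big_nat_widen 1 V.+1 (maxn y V).+1 xpredT
  (fun=> 2 * ln y%:R + 4 * U%:R : R).
rewrite ltnS leq_maxr /= => <- //; rewrite sumr_const_nat subn1 /=.
by rewrite -[leLHS]mulr_natl.
Qed.
End Vaughan.

(** * Bilinear sums over a hyperbola *)

Section TypeIIAverage.
Variable R : realType.
Variables (Pm w : nat) (S : pred nat) (P0 : R).
Hypothesis Sprime : forall p, S p -> prime p && (p <= Pm)%N.
Hypothesis P0_gt0 : 0 < P0.
Hypothesis S_ge : forall p, S p -> P0 <= p%:R.

Lemma sum_dyadic (V : nmodType) K (F : nat -> V) :
  \sum_(1 <= m < 2 ^ K) F m = \sum_(j < K) \sum_(2 ^ j <= m < 2 ^ j + 2 ^ j) F m.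
Proof.
elim: K => [|K IH]; first by rewrite big_ord0 big_geq.
rewrite big_ord_recr /= -IH addnn -mul2n -expnS -big_cat_nat //.
  by rewrite expn_gt0.
by rewrite leq_exp2l.
Qed.

Lemma typeII_dyadic U V y p :
  typeII R U V y p = \sum_(j < (trunc_log 2 y).+1)
    \sum_(2 ^ j <= m < 2 ^ j + 2 ^ j) \sum_(1 <= k < (y %/ m).+1)
     vonMangoldt_gt R U m * moebius_upto_sum_gt R V k * dev_one R p (m * k).
Proof.
rewrite -(sum_dyadic _ (fun m => \sum_(1 <= k < (y %/ m).+1)
     vonMangoldt_gt R U m * moebius_upto_sum_gt R V k * dev_one R p (m * k))).
have yK : (y.+1 <= 2 ^ (trunc_log 2 y).+1)%N by exact: trunc_log_ltn.
rewrite /typeII [RHS](@big_cat_nat _ _ _ y.+1) //=.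
rewrite [X in _ = _ + X]big_nat_cond [X in _ = _ + X]big1 ?addr0 //.
move=> m /andP[/andP[ym _] _]; rewrite divn_small //.
by rewrite big_geq.
Qed.

Lemma large_sieve_const_le M : (0 < Pm)%N ->
  large_sieve_const R Pm M <= 32 * harmonic_sum R (Pm ^ 2) * (M%:R + (Pm ^ 2)%:R).
Proof.
move=> P1; rewrite /large_sieve_const.
have h1 : 1 <= harmonic_sum R (Pm ^ 2).
  have q0 : (0 < Pm ^ 2)%N by rewrite expn_gt0 P1.
  rewrite /harmonic_sum; case: (Pm ^ 2)%N q0 => // q _.
  by rewrite big_ltn // invr1 lerDl sumr_ge0 // => i _; rewrite invr_ge0.
have m0 : 0 <= M%:R :> R by [].
have q0 : 0 <= (Pm ^ 2)%:R :> R by [].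
by move: (harmonic_sum _ _) ((Pm ^ 2)%:R) h1 q0 => h q h1 q0; nra.
Qed.

Lemma vonMangoldt_gt_energy U j :
  \sum_(2 ^ j <= m < 2 ^ j + 2 ^ j) vonMangoldt_gt R U m ^+ 2 <=
  (2 ^ j)%:R * ln (2 ^ j.+1)%:R ^+ 2.
Proof.
apply: (@le_trans _ _ (\sum_(2 ^ j <= m < 2 ^ j + 2 ^ j) ln (2 ^ j.+1)%:R ^+ 2)).
  rewrite big_nat_cond [leRHS]big_nat_cond; apply: ler_sum => m /andP[/andP[m0 m1] _].
  have mp : (0 < m)%N by apply: leq_trans m0; rewrite expn_gt0.
  rewrite !expr2 /vonMangoldt_gt; case: ifP => _; last by rewrite mulr0 -expr2 sqr_ge0.
  have h : vonMangoldt R m <= ln (2 ^ j.+1)%:R.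
    apply: (le_trans (vonMangoldt_le_ln _ _)); apply: ler_ln_nat => //.
    by rewrite expnS mul2n -addnn ltnW.
  by apply: ler_pM; rewrite ?vonMangoldt_ge0.
by rewrite sumr_const_nat addKn mulr_natl.
Qed.

Lemma moebius_upto_sum_gt_energy V N :
  \sum_(1 <= k < N.+1) moebius_upto_sum_gt R V k ^+ 2 <= N%:R * harmonic_sum R V ^+ 3.
Proof.
apply: le_trans (moebius_upto_sum_mean_square R V N); apply: ler_sum => k _.
by rewrite /moebius_upto_sum_gt; case: ifP => // _; rewrite expr0n sqr_ge0.
Qed.

(** With cutoffs U = V = W and y = W Pm ^ 2, a block on which the bilinear sum
does not vanish has M and N of size at most 2 Pm ^ 2, while M N is at most y.
Each factor M + Pm ^ 2 of the large sieve is then of the order of Pm ^ 2, and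
the bound saves, up to logarithms, a factor sqrt W over the trivial one. *)
Lemma typeII_block W j (Lg : R) : (0 < Pm)%N -> (0 < W)%N -> (W <= Pm ^ 2)%N ->
  (2 ^ j <= W * Pm ^ 2)%N -> ln (2 ^ j.+1)%:R <= Lg ->
  \sum_(p < Pm.+1 | S p) `|\sum_(2 ^ j <= m < 2 ^ j + 2 ^ j)
      \sum_(1 <= k < ((W * Pm ^ 2) %/ m).+1)
     vonMangoldt_gt R W m * moebius_upto_sum_gt R W k * dev_one R p (m * k)| <=
  j.+1%:R * (32 * harmonic_sum R (Pm ^ 2) * Lg * Num.sqrt (5 * W%:R * harmonic_sum R W ^+ 3)
             * Pm%:R ^+ 3 / P0).
Proof.
move=> P1 W0 WQ jy lLg; set y := (W * Pm ^ 2)%N in jy *.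
set M := (2 ^ j)%N; set N := (y %/ M)%N.
have M0 : (0 < M)%N by rewrite expn_gt0.
pose t m := (y %/ m.-1.+1).+1.
have l0 : 0 <= ln (2 ^ j.+1)%:R :> R by exact: ln_nat_ge0.
have Lg0 : 0 <= Lg by apply: le_trans lLg.
set H := harmonic_sum R W; set h := harmonic_sum R (Pm ^ 2).
have H0 : 0 <= H := harmonic_sum_ge0 R W.
have h0 : 0 <= h := harmonic_sum_ge0 R _.
have stair := @bilinear_staircase R Pm S P0 Sprime P0_gt0 S_ge (vonMangoldt_gt R W) (moebius_upto_sum_gt R W)
   M N j M 1 N.+1 t (leqnn _) _ _ _.
have {}stair := stair (eq_leq (subn1 N.+1)).
have tm m : (M <= m < M + 2 ^ j)%N -> (1 <= t m <= N.+1)%N.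
  move=> /andP[m0 m1]; rewrite /t /= ltnS.
  by rewrite prednK ?(leq_trans M0) // leq_div2l.
have tmono m m' : (m <= m')%N -> (t m' <= t m)%N.
  by move=> mm; rewrite /t ltnS leq_div2l // ltnS -!subn1 leq_sub2r.
have {tm tmono}stair := stair tm tmono.
have E p : \sum_(M <= m < M + 2 ^ j) \sum_(1 <= k < (y %/ m).+1)
     vonMangoldt_gt R W m * moebius_upto_sum_gt R W k * dev_one R p (m * k) =
   \sum_(M <= m < M + 2 ^ j) \sum_(1 <= k < t m)
     vonMangoldt_gt R W m * moebius_upto_sum_gt R W k * dev_one R p (m * k).
  apply: eq_big_nat => m /andP[m0 _]; rewrite /t prednK //.
  exact: leq_trans m0.
rewrite (eq_bigr (fun p : 'I_Pm.+1 => `|\sum_(M <= m < M + 2 ^ j) \sum_(1 <= k < t m)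
     vonMangoldt_gt R W m * moebius_upto_sum_gt R W k * dev_one R p (m * k)|)); last first.
  by move=> p _; rewrite E.
apply: (le_trans stair); rewrite -[leLHS]mulrA ler_wpM2l //.
set A := \sum_(M <= m < _) _; set B := \sum_(1 <= n < _) _.
have A0 : 0 <= A by apply: sumr_ge0 => i _; exact: sqr_ge0.
have B0 : 0 <= B by apply: sumr_ge0 => i _; exact: sqr_ge0.
have RH0 : 0 <= 32 * h * Lg * Num.sqrt (5 * W%:R * H ^+ 3) * Pm%:R ^+ 3 / P0.
  by rewrite !mulr_ge0 ?sqrtr_ge0 ?invr_ge0 // ltW.
have hA : A <= M%:R * Lg ^+ 2.
  apply: (le_trans (vonMangoldt_gt_energy W j)); rewrite ler_wpM2l //.
  by rewrite !expr2; apply: ler_pM.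
have hB : B <= N%:R * H ^+ 3 by exact: moebius_upto_sum_gt_energy.
have [sM|bM] := leqP (2 ^ j.+1) W.+1.
  have -> : A = 0.
    rewrite /A big_nat_cond big1 // => m /andP[/andP[m0 m1] _].
    rewrite /vonMangoldt_gt ifF ?expr0n //; apply/negbTE; rewrite -leqNgt -ltnS.
    by apply: leq_trans sM; rewrite expnS mul2n -addnn.
  by rewrite sqrtr0 !(mul0r, mulr0).
have [sN|bN] := leqP N W.
  have -> : B = 0.
    rewrite /B big_nat_cond big1 // => m /andP[/andP[m0 m1] _].
    rewrite /moebius_upto_sum_gt ifF ?expr0n //; apply/negbTE; rewrite -leqNgt.
    by apply: leq_trans sN; rewrite -ltnS.
  by rewrite sqrtr0 !(mulr0, mul0r).
have MNy : (M * N <= W * Pm ^ 2)%N by rewrite mulnC leq_divM.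
have hM : (M <= Pm ^ 2)%N.
  rewrite -(leq_pmul2l W0); apply: leq_trans MNy.
  by rewrite mulnC leq_mul2l ltnW ?orbT.
have hN : (N <= 2 * Pm ^ 2)%N.
  rewrite -(leq_pmul2l W0).
  have : (W * N <= 2 * M * N)%N by rewrite leq_mul2r -expnS ltnW ?orbT // ltnW.
  by move/leq_trans; apply; rewrite -mulnA [leqRHS]mulnCA leq_mul2l MNy orbT.
have L1 := large_sieve_const_le M P1; have L2 := large_sieve_const_le N P1.
have L10 := large_sieve_const_ge0 R Pm M; have L20 := large_sieve_const_ge0 R Pm N.
rewrite -/h in L1 L2.
rewrite [leLHS](_ : _ = Num.sqrt A * Num.sqrt B *
   Num.sqrt (large_sieve_const R Pm M * large_sieve_const R Pm N) / P0); last by ring.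
rewrite ler_wpM2r ?invr_ge0 ?(ltW P0_gt0) //.
rewrite -!sqrtrM ?mulr_ge0 //.
have c0 : 0 <= 32 * h * Lg * Pm%:R ^+ 3 by rewrite !mulr_ge0 // exprn_ge0.
rewrite [leRHS](_ : _ = Num.sqrt ((32 * h * Lg * Pm%:R ^+ 3) ^+ 2 * (5 * W%:R * H ^+ 3))); last first.
  rewrite [RHS]sqrtrM ?sqr_ge0 // sqrtr_sqr (ger0_norm c0); ring.
apply: ler_wsqrtr.
have LL := ler_pM L10 L20 L1 L2.
have AB := ler_pM A0 B0 hA hB.
have := ler_pM (mulr_ge0 A0 B0) (mulr_ge0 L10 L20) AB LL.
move/le_trans; apply.
have q1 : M%:R <= Pm%:R ^+ 2 :> R by rewrite -natrX ler_nat.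
have q2 : N%:R <= 2 * Pm%:R ^+ 2 :> R by rewrite -natrX -natrM ler_nat.
have q3 : M%:R * N%:R <= W%:R * Pm%:R ^+ 2 :> R by rewrite -natrX -!natrM ler_nat.
have q4 : W%:R <= Pm%:R ^+ 2 :> R by rewrite -natrX ler_nat.
rewrite natrX.
set Q : R := Pm%:R ^+ 2 in q1 q2 q3 q4 *.
have Q0 : 0 <= Q by exact: sqr_ge0.
have key : M%:R * N%:R * ((M%:R + Q) * (N%:R + Q)) <= 5 * W%:R * Q ^+ 3.
  have : (M%:R + Q) * (N%:R + Q) <= 5 * Q ^+ 2.
    have m0 : 0 <= M%:R :> R by []. have n0 : 0 <= N%:R :> R by [].
    have : M%:R * N%:R <= Q * Q by apply: (le_trans q3); rewrite ler_wpM2r.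
    by nra.
  move/(ler_pM _ _ q3) => /(_ ltac:(by rewrite mulr_ge0) ltac:(by rewrite mulr_ge0 // addr_ge0)).
  by move/le_trans; apply; rewrite le_eqVlt; apply/orP; left; apply/eqP; ring.
have cc : 0 <= Lg ^+ 2 * H ^+ 3 * (32 * h) ^+ 2 by rewrite !mulr_ge0 ?sqr_ge0 // exprn_ge0.
have := ler_wpM2l cc key.
have e6 : (32 * h * Lg * Pm%:R ^+ 3) ^+ 2 * (5 * W%:R * H ^+ 3) =
   Lg ^+ 2 * H ^+ 3 * (32 * h) ^+ 2 * (5 * W%:R * Q ^+ 3) by rewrite /Q; ring.
rewrite e6; apply: le_trans.
by rewrite le_eqVlt; apply/orP; left; apply/eqP; ring.
Qed.

End TypeIIAverage.

(** * Primes congruent to 1 modulo a large prime *)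

Section PrimesAP.
Variable R : realType.

(** Only the powers of p contribute. *)
Lemma sum_vonMangoldt_dvd p y : prime p ->
  \sum_(1 <= n < y.+1) vonMangoldt R n * (p %| n)%N%:R <= ln y%:R.
Proof.
move=> pr; rewrite (sum_vonMangoldt y (fun n => (p %| n)%N%:R)).
have [yp|py] := ltnP y p.
  rewrite big_nat_cond big1 ?ln_nat_ge0 // => l /andP[/andP[l0 ly] pl].
  rewrite big1 // => k lk; case: (boolP (p %| l ^ k)%N) => [d|_]; last by rewrite mulr0.
  have := leq_trans (dvdn_leq _ d) lk; rewrite expn_gt0 (prime_gt0 pl) => /(_ isT).
  by rewrite leqNgt yp.
rewrite big_mkcond (bigD1_seq p) ?iota_uniq //=; last first.
  by rewrite mem_index_iota prime_gt0.
rewrite pr [X in _ + X]big1 ?addr0; last first.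
  move=> l lp; case: ifP => // pl; rewrite big1 // => k _.
  case: (boolP (p %| l ^ k)%N) => [|_]; last by rewrite mulr0.
  case: k => [|k]; first by rewrite expn0 dvdn1 => /eqP e; rewrite e in pr.
  by rewrite Euclid_dvdX // dvdn_prime2 // andbT eq_sym (negPf lp).
apply: le_trans (sum_pow_le R pr py); apply: ler_sum => k _.
by case: (_ %| _)%N; rewrite ?mulr1 // mulr0 ln_nat_ge0.
Qed.

Lemma sum_vonMangoldt_progression_ge p y : prime p ->
  (chebyshev_psi R y - ln y%:R) / (p.-1)%:R - `|\sum_(1 <= n < y.+1) vonMangoldt R n * dev_one R p n| <=
  \sum_(1 <= n < y.+1 | (n %% p == 1)%N) vonMangoldt R n.
Proof.
move=> pr; set E := \sum_(1 <= n < y.+1) vonMangoldt R n * dev_one R p n.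
have -> : \sum_(1 <= n < y.+1 | (n %% p == 1)%N) vonMangoldt R n =
  E + (chebyshev_psi R y - \sum_(1 <= n < y.+1) vonMangoldt R n * (p %| n)%N%:R) / (p.-1)%:R.
  rewrite /E /chebyshev_psi -sumrB big_distrl -big_split /= big_mkcond; apply: eq_bigr => n _.
  by rewrite /dev_one; case: (n %% p == 1)%N; case: (p %| n)%N => /=; ring.
have h1 := sum_vonMangoldt_dvd y pr.
have h2 : (chebyshev_psi R y - ln y%:R) / (p.-1)%:R <=
  (chebyshev_psi R y - \sum_(1 <= n < y.+1) vonMangoldt R n * (p %| n)%N%:R) / (p.-1)%:R.
  by rewrite ler_wpM2r ?invr_ge0 // lerD2l lerN2.
by have := ler_norm (- E); rewrite normrN; lra.
Qed.

Definition prime_count_progression (y p : nat) : nat :=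
  \sum_(1 <= q < y.+1 | prime q && (q %% p == 1)%N) 1.

(** A proper prime power l ^ k <= y has l <= s, and the powers of one
prime carry a total weight of at most ln y. *)
Lemma prime_count_progression_ge p y s : (y <= s * s)%N ->
  \sum_(1 <= n < y.+1 | (n %% p == 1)%N) vonMangoldt R n <=
  ((prime_count_progression y p)%:R + s%:R) * ln y%:R.
Proof.
move=> ys; have ly := ln_nat_ge0 R y.
rewrite big_mkcond (eq_bigr (fun n => vonMangoldt R n * (n %% p == 1)%N%:R)); last first.
  by move=> n _; case: ifP => _; rewrite ?mulr1 ?mulr0.
rewrite (sum_vonMangoldt y (fun n => (n %% p == 1)%N%:R)).
apply: (@le_trans _ _ (\sum_(1 <= l < y.+1 | prime l)
   (((l %% p == 1)%N%:R + (l <= s)%N%:R) * ln y%:R))).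
  rewrite big_nat_cond [leRHS]big_nat_cond; apply: ler_sum => l /andP[/andP[l0 ly'] pl].
  have h := sum_pow_le R pl ly'.
  have [ls|sl] := leqP l s.
    rewrite mulrDl mul1r -[leLHS]add0r; apply: lerD; first by rewrite mulr_ge0.
    apply: le_trans h; apply: ler_sum => k _.
    by case: (_ == _); rewrite ?mulr1 // mulr0 ln_nat_ge0.
  have y0 : (0 < y)%N by exact: leq_trans l0 ly'.
  rewrite big_mkcond (bigD1_seq 1%N) ?iota_uniq ?mem_index_iota //=.
  rewrite expn1 -ltnS ly' addr0 big1_seq ?addr0.
    rewrite mulrC; case: (_ == _) => /=; rewrite ?mul0r // !mul1r.
    by apply: ler_ln_nat.
  move=> k /andP[k1]; rewrite mem_index_iota => /andP[k0 _]; case: ifP => // lk.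
  have : (l ^ 2 <= y)%N.
    by apply: leq_trans lk; rewrite leq_exp2l ?(prime_gt1 pl) //; lia.
  by rewrite -mulnn => h2; exfalso; have := ltn_mul sl sl; lia.
rewrite -big_distrl /= ler_wpM2r // big_split /=; apply: lerD.
  rewrite /prime_count_progression natr_sum big_mkcondr /=.
  by apply: ler_sum => l _; case: (_ == _).
apply: (@le_trans _ _ (\sum_(1 <= l < (maxn y s).+1 | (l <= s)%N) 1)).
  rewrite big_mkcond [leLHS](big_nat_widen _ _ (maxn y s).+1) ?ltnS ?leq_maxl //.
  rewrite big_mkcond [leRHS]big_mkcond; apply: ler_sum => l _ /=.
  by case: (l < _)%N; case: (prime l); case: (l <= s)%N.
have := big_nat_widen 1 s.+1 (maxn y s).+1 xpredT (fun=> 1 : R).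
by rewrite ltnS leq_maxr /= => <- //; rewrite sumr_const_nat subn1.
Qed.

(** Chebyshev gives P / (8 w) primes up to P, of which at most P / (16 w) can
be smaller than P / (16 w). *)
Lemma large_primes_count P w : (1 < P)%N -> (0 < w)%N -> ln P%:R <= w%:R :> R ->
  P%:R / (16 * w%:R) <=
  \sum_(p < P.+1 | [&& prime p, (p <= P)%N & (P <= 16 * w * p)%N]) 1 :> R.
Proof.
move=> P1 w0 lw.
have w0R : 0 < w%:R :> R by rewrite ltr0n.
have h1 : P%:R / (8 * w%:R) <= (prime_pi P)%:R :> R.
  have a := chebyshev_psi_ge R P1; have b := chebyshev_psi_le_prime_pi R P.
  have c : (prime_pi P)%:R * ln P%:R <= (prime_pi P)%:R * w%:R :> R by rewrite ler_wpM2l.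
  rewrite ler_pdivrMr ?mulr_gt0 //; move: a b c; move: (chebyshev_psi R P) => X; nra.
have h2 : (prime_pi P)%:R <=
   \sum_(p < P.+1 | [&& prime p, (p <= P)%N & (P <= 16 * w * p)%N]) 1 +
   \sum_(1 <= l < P.+1 | (16 * w * l <= P)%N) 1 :> R.
  rewrite -(big_mkord (fun p => [&& prime p, (p <= P)%N & (P <= 16 * w * p)%N]) (fun=> 1)).
  rewrite big_ltn_cond //= /prime_pi natr_sum big_mkcond [X in _ <= X + _]big_mkcond.
  rewrite [X in _ <= _ + X]big_mkcond /= -big_split /=.
  rewrite big_nat_cond [leRHS]big_nat_cond; apply: ler_sum => l /andP[/andP[l0 lP] _].
  rewrite -ltnS lP /=; case: (prime l) => /=; last by case: ifP; rewrite add0r.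
  case: (leqP P (16 * w * l)) => h; last by rewrite (ltnW h) add0r.
  by case: ifP; rewrite ?addr0 // lerDl.
rewrite -(sum_div_widen P (fun=> 1)) ?muln_gt0 // sumr_const_nat subn1 /= in h2.
have h3 : (P %/ (16 * w))%:R <= P%:R / (16 * w%:R) :> R.
  rewrite ler_pdivlMr ?mulr_gt0 // -!natrM ler_nat; exact: leq_divM.
have e : P%:R / (8 * w%:R) = P%:R / (16 * w%:R) + P%:R / (16 * w%:R) :> R.
  by field; rewrite lt0r_neq0.
by move: h1 h2 h3; rewrite e; move: (P%:R / _) => X; lra.
Qed.

End PrimesAP.

Section PrimesAP.
Variable R : realType.

(** The product of the constants in the bounds for the number of dyadic blocks,
the depth of the recursion, the harmonic sums, ln (2 y) and 1 / P0. *)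
Definition error_factor : R := 41 ^+ 2 * 32 * 3 * 21 * 3 * 361 * 16.

Lemma error_factor_ge0 : 0 <= error_factor.
Proof. by do ?[exact: ler0n | apply: mulr_ge0 | apply: exprn_ge0]. Qed.

Variables (P w : nat).
Hypothesis w_gt0 : (0 < w)%N.
Hypothesis lnP : ln P%:R <= w%:R :> R.
Hypothesis Pw : (w ^ 40 <= P)%N.
Hypothesis P_gt1 : (1 < P)%N.

Let W := (w ^ 18)%N.
Let y := (W * P ^ 2)%N.
Let S := fun p => [&& prime p, (p <= P)%N & (P <= 16 * w * p)%N].
Let P0 : R := P%:R / (16 * w%:R).

Let w0 : 0 < w%:R :> R. Proof. by rewrite ltr0n. Qed.
Let w1 : 1 <= w%:R :> R. Proof. by rewrite ler1n. Qed.
Let Pp : 0 < P%:R :> R. Proof. by rewrite ltr0n ltnW. Qed.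
Let P1 : (0 < P)%N. Proof. exact: ltnW. Qed.
Let W0 : (0 < W)%N. Proof. by rewrite expn_gt0 w_gt0. Qed.
Let y0 : (0 < y)%N. Proof. by rewrite muln_gt0 W0 expn_gt0 P1. Qed.

Lemma lnw_le : ln w%:R <= w%:R :> R.
Proof. by rewrite ltW // ln_sublinear. Qed.

Lemma lny_le : ln y%:R <= 20 * w%:R :> R.
Proof.
rewrite /y /W natrM !natrX lnM ?posrE ?exprn_gt0 // !lnXn //.
rewrite -[ln _ *+ 18]mulr_natl -[ln _ *+ 2]mulr_natl; move: lnw_le lnP; lra.
Qed.

Lemma w_exp_le a b : (a <= b)%N -> w%:R ^+ a <= w%:R ^+ b :> R.
Proof. by move=> ab; rewrite ler_weXn2l. Qed.

Lemma WleP2 : (W <= P ^ 2)%N.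
Proof.
rewrite -(ler_nat R) /W !natrX.
have h : w%:R ^+ 40 <= P%:R :> R by rewrite -natrX ler_nat.
apply: le_trans (w_exp_le (_ : 18 <= 40)%N) _ => //.
by apply: (le_trans h); rewrite expr2 -[leLHS]mulr1 ler_pM2l // ler1n.
Qed.

Lemma harmP_le : harmonic_sum R (P ^ 2) <= 3 * w%:R.
Proof.
apply: (le_trans (harmonic_sum_le _ _)); first by rewrite expn_gt0 P1.
rewrite natrX lnXn // -[ln _ *+ _]mulr_natl; move: lnP w1; lra.
Qed.

Lemma harmW_le : harmonic_sum R W <= 19 * w%:R.
Proof.
apply: (le_trans (harmonic_sum_le _ W0)).
rewrite natrX lnXn // -[ln _ *+ _]mulr_natl; move: lnw_le w1; lra.
Qed.

Lemma trunc_log_le : (trunc_log 2 y).+1%:R <= 41 * w%:R :> R.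
Proof.
have h : (2 ^ trunc_log 2 y <= y)%N by exact: trunc_logP.
have : ln (2 ^ trunc_log 2 y)%:R <= ln y%:R :> R.
  by apply: ler_ln_nat => //; rewrite expn_gt0.
rewrite natrX lnXn // -[ln _ *+ _]mulr_natl => h2.
have h3 : (trunc_log 2 y)%:R * 2^-1 <= (trunc_log 2 y)%:R * ln 2 :> R.
  by rewrite ler_wpM2l // ln2_ge.
move: h2 h3 lny_le w1; rewrite -[(trunc_log 2 y).+1%:R]natr1; lra.
Qed.

Let Sprime p : S p -> prime p && (p <= P)%N.
Proof. by case/and3P=> -> ->. Qed.

Let P0_gt0 : 0 < P0.
Proof. by rewrite divr_gt0 // mulr_gt0. Qed.

Let S_ge p : S p -> P0 <= p%:R.
Proof.
by case/and3P=> _ _ h; rewrite /P0 ler_pdivrMr ?mulr_gt0 // mulrC -!natrM ler_nat.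
Qed.

Lemma sqrt_energy_le : Num.sqrt (5 * W%:R * harmonic_sum R W ^+ 3) <= 3 * 361 * w%:R ^+ 11.
Proof.
have c0 : 0 <= 3 * 361 * w%:R ^+ 11 :> R.
  exact: mulr_ge0 (mulr_ge0 (ler0n _ 3) (ler0n _ 361)) (exprn_ge0 _ (ltW w0)).
rewrite -[leRHS]ger0_norm // -sqrtr_sqr; apply: ler_wsqrtr.
have H0 := harmonic_sum_ge0 R W; have H1 := harmW_le.
have h3 : harmonic_sum R W ^+ 3 <= (19 * w%:R) ^+ 3.
  by apply: lerXn2r; rewrite // nnegrE ?mulr_ge0.
have W00 : 0 <= 5 * W%:R :> R by rewrite mulr_ge0.
apply: (le_trans (ler_wpM2l W00 h3)).
rewrite /W natrX.
have -> : 5 * w%:R ^+ 18 * (19 * w%:R) ^+ 3 = (5 * 19 ^+ 3) * w%:R ^+ 21 :> R by ring.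
have -> : (3 * 361 * w%:R ^+ 11) ^+ 2 = (3 * 361) ^+ 2 * w%:R ^+ 22 :> R by ring.
apply: ler_pM; rewrite ?exprn_ge0 ?mulr_ge0 ?exprn_ge0 //; last exact: w_exp_le.
by rewrite !exprS expr0; lra.
Qed.

Lemma typeII_avg :
  \sum_(p < P.+1 | S p) `|typeII R W W y p| <= error_factor * w%:R ^+ 16 * P%:R ^+ 2.
Proof.
pose b : R := 41 * w%:R * (32 * (3 * w%:R) * (21 * w%:R) * (3 * 361 * w%:R ^+ 11) * P%:R ^+ 3 / P0).
have P00 := ltW P0_gt0.
have b0 : 0 <= b.
  by do ?[exact: ler0n | apply: mulr_ge0 | apply: exprn_ge0]; rewrite invr_ge0.
have blk (j : 'I_(trunc_log 2 y).+1) : \sum_(p < P.+1 | S p)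
    `|\sum_(2 ^ j <= m < 2 ^ j + 2 ^ j) \sum_(1 <= k < (y %/ m).+1)
     vonMangoldt_gt R W m * moebius_upto_sum_gt R W k * dev_one R p (m * k)| <= b.
  have jy : (2 ^ j <= y)%N.
    by apply: leq_trans (trunc_logP (isT : 1 < 2)%N y0); rewrite leq_exp2l // -ltnS.
  have lj : ln (2 ^ j.+1)%:R <= 21 * w%:R :> R.
    rewrite expnS natrM lnM ?posrE ?ltr0n ?expn_gt0 //.
    have : ln (2 ^ j)%:R <= ln y%:R :> R by apply: ler_ln_nat => //; rewrite expn_gt0.
    by have := lny_le; have := ln2_le1 R; have := w1; lra.
  apply: (le_trans (typeII_block Sprime P0_gt0 S_ge P1 W0 WleP2 jy lj)).
  have H0 := harmonic_sum_ge0 R W; have h0 := harmonic_sum_ge0 R (P ^ 2).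
  apply: ler_pM => //.
  - by rewrite !mulr_ge0 ?sqrtr_ge0 ?exprn_ge0 ?invr_ge0.
  - apply: le_trans trunc_log_le; rewrite ler_nat; exact: ltn_ord.
  rewrite ler_wpM2r ?invr_ge0 // ler_wpM2r ?exprn_ge0 //.
  apply: ler_pM; rewrite ?sqrtr_ge0 ?sqrt_energy_le ?mulr_ge0 //.
  rewrite ler_wpM2r ?mulr_ge0 // ler_pM2l //.
  exact: harmP_le.
apply: (@le_trans _ _ (\sum_(j < (trunc_log 2 y).+1) b)).
  apply: (@le_trans _ _ (\sum_(j < (trunc_log 2 y).+1) \sum_(p < P.+1 | S p)
    `|\sum_(2 ^ j <= m < 2 ^ j + 2 ^ j) \sum_(1 <= k < (y %/ m).+1)
     vonMangoldt_gt R W m * moebius_upto_sum_gt R W k * dev_one R p (m * k)|)); last by apply: ler_sum => j _.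
  rewrite exchange_big /=; apply: ler_sum => p Sp; rewrite typeII_dyadic.
  exact: ler_norm_sum.
rewrite sumr_const card_ord -[leLHS]mulr_natl.
apply: (le_trans (ler_wpM2r b0 trunc_log_le)).
rewrite le_eqVlt; apply/orP; left; apply/eqP; rewrite /b /P0 /error_factor.
by field; rewrite !lt0r_neq0.
Qed.

(** The total is smaller than the sum of the main terms, of order w ^ 17 P ^ 2, by a
factor of order w. *)
Lemma error_sum_le :
  \sum_(p < P.+1 | S p) `|\sum_(1 <= n < y.+1) vonMangoldt R n * dev_one R p n| <=
  (error_factor + 96) * w%:R ^+ 16 * P%:R ^+ 2.
Proof.
pose c : R := 4 * W%:R + W%:R * (2 * ln y%:R + 4 * W%:R).
apply: (@le_trans _ _ (\sum_(p < P.+1 | S p) (c + `|typeII R W W y p|))).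
  apply: ler_sum => p Sp; apply: (@vaughan_bound R W W W0 y p); by case/andP: (Sprime Sp).
rewrite big_split /= mulrDl mulrDl addrC; apply: lerD; first exact: typeII_avg.
have ly0 := ln_nat_ge0 R y.
have c0 : 0 <= c by rewrite !(addr_ge0, mulr_ge0).
apply: (@le_trans _ _ (\sum_(p < P.+1) c)).
  by rewrite big_mkcond; apply: ler_sum => p _; case: ifP.
rewrite sumr_const card_ord -[leLHS]mulr_natl.
have hP : P.+1%:R <= 2 * P%:R :> R by rewrite -natrM ler_nat; lia.
have hw : w%:R ^+ 40 <= P%:R :> R by rewrite -natrX ler_nat.
have hc : c <= 48 * w%:R ^+ 37.
  rewrite /c /W natrX.
  have e1 : w%:R ^+ 18 <= w%:R ^+ 37 :> R by exact: w_exp_le.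
  have e2 : w%:R ^+ 19 <= w%:R ^+ 37 :> R by exact: w_exp_le.
  have e3 : w%:R ^+ 36 <= w%:R ^+ 37 :> R by exact: w_exp_le.
  have l1 : w%:R ^+ 18 * ln y%:R <= 20 * w%:R ^+ 19 :> R.
    have -> : 20 * w%:R ^+ 19 = w%:R ^+ 18 * (20 * w%:R) :> R by ring.
    by rewrite ler_wpM2l ?exprn_ge0 ?lny_le.
  have -> : 4 * w%:R ^+ 18 + w%:R ^+ 18 * (2 * ln y%:R + 4 * w%:R ^+ 18) =
    4 * w%:R ^+ 18 + 2 * (w%:R ^+ 18 * ln y%:R) + 4 * w%:R ^+ 36 :> R by ring.
  lra.
have e4 : w%:R ^+ 37 <= P%:R :> R by apply: le_trans hw; exact: w_exp_le.
have e5 : 1 <= w%:R ^+ 16 :> R by rewrite exprn_ege1.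
apply: (@le_trans _ _ (2 * P%:R * (48 * P%:R))).
  by apply: ler_pM => //; apply: (le_trans hc); rewrite ler_pM2l.
have : 0 <= P%:R ^+ 2 :> R by exact: exprn_ge0.
move=> q0; rewrite -mulrA.
have := ler_wpM2r q0 e5; rewrite mul1r => h.
have -> : 2 * (P%:R * (48 * P%:R)) = 96 * P%:R ^+ 2 :> R by ring.
by rewrite -mulrA ler_pM2l.
Qed.

Hypothesis w_large : 512 * (error_factor + 96) < w%:R.

(** If no admissible p had a small error, the errors would add up to more than
[error_sum_le] allows. For a p with small error, the sum of vonMangoldt over
n = 1 mod p is at least half of its main term, far more than
the contribution of the proper prime powers. *)
Theorem primes_in_progression : exists p, [/\ prime p, (p <= P)%N, (P <= 16 * w * p)%N &
  (P <= prime_count_progression y p)%N].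
Proof.
pose T : R := w%:R ^+ 18 * P%:R / 32.
have T0 : 0 < T by rewrite divr_gt0 // mulr_gt0 // exprn_gt0.
have [/existsP[p /andP[Sp hp]]|] := boolP [exists p : 'I_P.+1,
   S p && (`|\sum_(1 <= n < y.+1) vonMangoldt R n * dev_one R p n| < T)]; last first.
  rewrite negb_exists => /forallP h.
  have : \sum_(p < P.+1 | S p) T <=
    \sum_(p < P.+1 | S p) `|\sum_(1 <= n < y.+1) vonMangoldt R n * dev_one R p n|.
    apply: ler_sum => p Sp; have := h p; rewrite Sp /=.
    by rewrite -leNgt.
  move/le_trans => /(_ _ error_sum_le).
  have cnt := large_primes_count P_gt1 w_gt0 lnP.
  have -> : \sum_(p < P.+1 | S p) T = (\sum_(p < P.+1 | S p) 1) * T.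
    by rewrite big_distrl /=; apply: eq_bigr => p _; rewrite mul1r.
  have := ler_wpM2r (ltW T0) cnt.
  move=> h1 h2; have := le_trans h1 h2.
  have -> : P%:R / (16 * w%:R) * T = w%:R / 512 * (w%:R ^+ 16 * P%:R ^+ 2).
    by rewrite /T; field; rewrite lt0r_neq0.
  rewrite -[leRHS]mulrA ler_pM2r ?mulr_gt0 ?exprn_gt0 // => h3.
  by exfalso; move: w_large h3; move: (error_factor) => C; lra.
have /and3P[pr lp lp'] := Sp.
exists (p : nat); split => //.
have h := sum_vonMangoldt_progression_ge R y pr.
have hs : (y <= (w ^ 9 * P) * (w ^ 9 * P))%N.
  by rewrite mulnn expnMn -expnM.
have h2 := prime_count_progression_ge R p hs.
have ly := lny_le; have ly0 := ln_nat_ge0 R y.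
have hwP : w%:R ^+ 40 <= P%:R :> R by rewrite -natrX ler_nat.
have a3 : 1281 <= w%:R :> R by move: w_large error_factor_ge0; move: (error_factor) => C; lra.
have hy : y%:R / 16 <= chebyshev_psi R y - ln y%:R.
  have y1 : (1 < y)%N.
    rewrite /y (leq_trans _ (leq_pmull _ W0)) // (leq_trans P_gt1) //.
    by rewrite -mulnn leq_pmull.
  have := chebyshev_psi_ge R y1.
  have : 16 * (20 * w%:R) <= y%:R :> R.
    rewrite /y /W natrM !natrX.
    have a1 : w%:R <= w%:R ^+ 18 :> R by rewrite -{1}[w%:R]expr1; exact: w_exp_le.
    have a2 : w%:R <= P%:R :> R.
      by apply: le_trans hwP; rewrite -{1}[w%:R]expr1; exact: w_exp_le.
    rewrite [P%:R ^+ 2]expr2.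
    have a4 : w%:R * w%:R <= P%:R * P%:R :> R by apply: ler_pM.
    have a5 : w%:R * (w%:R * w%:R) <= w%:R ^+ 18 * (P%:R * P%:R) :> R.
      by apply: ler_pM => //; apply: mulr_ge0.
    apply: le_trans a5; move: (w%:R : R) w0 a3 => z z0 z1; nra.
  by move: (chebyshev_psi R y) (ln _ : R) ly => A B; move: (y%:R : R) => C; lra.
have hp1 : (0 < p.-1)%N by rewrite -subn1 subn_gt0 prime_gt1.
have h3 : w%:R ^+ 18 * P%:R / 16 <= (chebyshev_psi R y - ln y%:R) / (p.-1)%:R.
  rewrite ler_pdivlMr ?ltr0n //; apply: le_trans hy.
  rewrite /y /W natrM !natrX.
  have : (p.-1)%:R <= P%:R :> R by rewrite ler_nat (leq_trans (leq_pred _)).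
  move/(ler_wpM2l (ltW T0)); rewrite /T.
  by rewrite [P%:R ^+ 2]expr2 mulrA; move: (w%:R ^+ 18 * P%:R : R) => z; lra.
have h4 : T <= ((prime_count_progression y p)%:R + (w ^ 9 * P)%:R) * ln y%:R.
  apply: le_trans h2; apply: le_trans h; rewrite /T in hp *.
  by move: hp h3; move: (`|_| : R) (w%:R ^+ 18 * P%:R : R) (_ / (p.-1)%:R : R) => e z u; lra.
rewrite -(ler_nat R) leNgt; apply/negP => hlt.
have h5 : ((prime_count_progression y p)%:R + (w ^ 9 * P)%:R) * ln y%:R <=
   (P%:R + (w ^ 9 * P)%:R) * (20 * w%:R) :> R.
  by apply: ler_pM => //; rewrite ?addr_ge0 // lerD2r ltW.
have := le_trans h4 h5; rewrite /T natrM natrX; apply/negP; rewrite -ltNge.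
have -> : (P%:R + w%:R ^+ 9 * P%:R) * (20 * w%:R) =
   20 * (w%:R + w%:R ^+ 10) * P%:R :> R by ring.
rewrite [ltRHS]mulrAC ltr_pM2r //.
have a1 : w%:R <= w%:R ^+ 10 :> R by rewrite -{1}[w%:R]expr1; exact: w_exp_le.
have a6 : w%:R ^+ 11 <= w%:R ^+ 18 :> R by exact: w_exp_le.
have a7 : 1281 * w%:R ^+ 10 <= w%:R ^+ 11 :> R by rewrite [leRHS]exprS ler_wpM2r // exprn_ge0.
have a8 : 0 < w%:R ^+ 10 :> R by rewrite exprn_gt0.
move: (w%:R ^+ 10 : R) (w%:R ^+ 11 : R) (w%:R ^+ 18 : R) (w%:R : R) a1 a6 a7 a8 => b1 b2 b3 b4; lra.
Qed.

End PrimesAP.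

(** * Upper bound for log G *)

Section Omega.
Variable R : realType.

Lemma ln_succ_sub M : (0 < M)%N -> ln M.+1%:R - ln M%:R <= M%:R^-1 :> R.
Proof.
move=> M0; have m0 : 0 < M%:R :> R by rewrite ltr0n.
rewrite -ln_div ?posrE ?ltr0n //.
have -> : M.+1%:R / M%:R = 1 + M%:R^-1 :> R.
  by rewrite -natr1 mulrDl divff ?lt0r_neq0 // mul1r.
by apply: le_ln1Dx; apply: (lt_trans (ltrN10 R)); rewrite invr_gt0.
Qed.

(** A discrete form of the integral of psi(t) / t. *)
Lemma sum_vonMangoldt_ln_ratio M :
  \sum_(1 <= d < M.+1) vonMangoldt R d * (ln M%:R - ln d%:R) <= 4 * M%:R.
Proof.
elim: M => [|M IH]; first by rewrite big_geq // mulr0.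
rewrite big_nat_recr //= subrr mulr0 addr0.
have [->|M0] := posnP M; first by rewrite big_geq // mulr1.
have -> : \sum_(1 <= i < M.+1) vonMangoldt R i * (ln M.+1%:R - ln i%:R) =
  \sum_(1 <= i < M.+1) vonMangoldt R i * (ln M%:R - ln i%:R) +
  chebyshev_psi R M * (ln M.+1%:R - ln M%:R).
  by rewrite /chebyshev_psi big_distrl -big_split /=; apply: eq_bigr => i _; ring.
have -> : 4 * M.+1%:R = 4 * M%:R + 4 :> R by rewrite -natr1; ring.
apply: lerD => //.
have m0 : 0 < M%:R :> R by rewrite ltr0n.
apply: (@le_trans _ _ (4 * M%:R * M%:R^-1)); last by rewrite mulfK ?lt0r_neq0.
apply: ler_pM; rewrite ?chebyshev_psi_le ?ln_succ_sub //.
- by apply: sumr_ge0 => i _; exact: vonMangoldt_ge0.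
- by rewrite subr_ge0 ler_ln_nat.
Qed.

Lemma ln_le_vonMangoldt q : prime q -> ln q%:R <= vonMangoldt R q.
Proof.
move=> pq; have q0 := prime_gt0 pq.
rewrite /vonMangoldt big_mkcond (bigD1_seq q) ?iota_uniq ?mem_index_iota ?q0 ?ltnSn //= pq.
rewrite big_mkcond (bigD1_seq 1%N) ?iota_uniq ?mem_index_iota ?ltnS //= expn1 eqxx.
rewrite -addrA lerDl addr_ge0 //; apply: sumr_ge0 => i _; case: ifP => // _.
  exact: ln_nat_ge0.
by apply: sumr_ge0 => j _; exact: ln_nat_ge0.
Qed.

(** For q > sqrt M replace 1 by 2 vonMangoldt q / ln M and use
[sum_vonMangoldt_ln_ratio]; the other q are at most sqrt M in number. *)
Lemma sum_ln_ratio_primes M : (1 < M)%N ->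
  \sum_(1 <= q < M.+1 | prime q) (ln M%:R - ln q%:R) <=
  Num.sqrt M%:R * ln M%:R + 8 * M%:R / ln M%:R :> R.
Proof.
move=> M1; set s := Num.truncn (Num.sqrt M%:R : R).
have m0 : 0 < ln M%:R :> R by rewrite ln_gt0 // ltr1n.
have sM : s%:R <= Num.sqrt M%:R :> R by rewrite truncn_le // sqrtr_ge0.
have Ms : (M < s.+1 * s.+1)%N.
  rewrite -(ltr_nat R) natrM -expr2 -[ltLHS]sqr_sqrtr // ltr_pXn2r ?nnegrE ?sqrtr_ge0 //.
  by rewrite truncnS_gt.
apply: (@le_trans _ _ (\sum_(1 <= q < M.+1)
   ((q <= s)%N%:R * ln M%:R + 2 / ln M%:R * (vonMangoldt R q * (ln M%:R - ln q%:R))))).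
  rewrite big_mkcond big_nat_cond [leRHS]big_nat_cond.
  apply: ler_sum => q /andP[/andP[q0 qM] _].
  have lq : ln q%:R <= ln M%:R :> R by apply: ler_ln_nat.
  have lq0 := ln_nat_ge0 R q.
  have t2 : 0 <= 2 / ln M%:R * (vonMangoldt R q * (ln M%:R - ln q%:R)).
    by rewrite !mulr_ge0 ?vonMangoldt_ge0 ?subr_ge0 ?invr_ge0 // ltW.
  case: ifP => pq; last by rewrite addr_ge0 // mulr_ge0 // ltW.
  have [qs|sq] := leqP q s; first by rewrite mul1r; lra.
  rewrite mul0r add0r.
  have h : ln M%:R <= 2 * ln q%:R :> R.
    have : (M <= q * q)%N by apply: ltnW; apply: leq_trans Ms _; rewrite leq_mul.
    move/(ler_ln_nat R (ltnW M1)); rewrite natrM lnM ?posrE ?ltr0n //; lra.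
  have h1 : 1 <= 2 / ln M%:R * vonMangoldt R q.
    rewrite mulrAC ler_pdivlMr // mul1r; apply: (le_trans h).
    by rewrite ler_pM2l // ln_le_vonMangoldt.
  by rewrite mulrA -[leLHS]mul1r ler_wpM2r // subr_ge0.
rewrite big_split /= -big_distrl -big_distrr /=; apply: lerD.
  rewrite ler_wpM2r ?(ltW m0) //; apply: le_trans sM.
  apply: (@le_trans _ _ (\sum_(1 <= l < (maxn M s).+1 | (l <= s)%N) 1)).
    rewrite [leLHS](big_nat_widen _ _ (maxn M s).+1) ?ltnS ?leq_maxl //.
    rewrite big_mkcond [leRHS]big_mkcond; apply: ler_sum => l _ /=.
    by case: (l < _)%N; case: (l <= s)%N.
  have := big_nat_widen 1 s.+1 (maxn M s).+1 xpredT (fun=> 1 : R).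
  by rewrite ltnS leq_maxr /= => <- //; rewrite sumr_const_nat subn1.
have c0 : 0 <= 2 / ln M%:R :> R by rewrite divr_ge0 // ltW.
apply: (le_trans (ler_wpM2l c0 (sum_vonMangoldt_ln_ratio M))).
by rewrite le_eqVlt; apply/orP; left; apply/eqP; field; rewrite lt0r_neq0.
Qed.

Lemma sum_primes_iota n M (f : nat -> R) :
  \sum_(q <- primes n | (q <= M)%N) f q = \sum_(1 <= q < M.+1 | q \in primes n) f q.
Proof.
rewrite -big_filter -[RHS]big_filter; apply: perm_big.
apply: uniq_perm; rewrite ?filter_uniq ?primes_uniq ?iota_uniq // => q.
rewrite !mem_filter mem_index_iota ltnS andbC; case: (boolP (q \in primes n)) => //= h.
by rewrite mem_primes in h; case/andP: h => /prime_gt0 ->.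
Qed.

Lemma sum_ln_primes_le n : (0 < n)%N -> \sum_(q <- primes n) ln q%:R <= ln n%:R :> R.
Proof.
move=> n0; rewrite (@ln_logn R n n) ?n0 //=.
rewrite big_seq (eq_bigl (fun q => (q \in primes n) && (q <= n)%N)); last first.
  move=> q; case: (boolP (q \in primes n)) => //=; rewrite mem_primes.
  by case/and3P=> _ _ /dvdn_leq ->.
rewrite -big_seq_cond sum_primes_iota big_mkcond [leRHS]big_mkcond.
apply: ler_sum => q _; case: ifP => [|_].
  move=> h; have h' := h; rewrite mem_primes in h'; case/and3P: h' => -> _ _.
  rewrite -[leLHS]mul1r ler_wpM2r ?ln_nat_ge0 //.
  by rewrite ler1n logn_gt0.
by case: ifP => // _; rewrite mulr_ge0 ?ln_nat_ge0.
Qed.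

(** Write ln M as ln q + (ln M - ln q) for each prime q dividing n. The first parts
add up to at most ln n. The second ones are negative for q > M, and are
controlled by the sparsity of the primes for q <= M; this is what brings the
relative error down to 1 / ln M. *)
Lemma omega_le n M : (0 < n)%N -> (1 < M)%N ->
  (size (primes n))%:R * ln M%:R <=
  ln n%:R + (Num.sqrt M%:R * ln M%:R + 8 * M%:R / ln M%:R) :> R.
Proof.
move=> n0 M1.
have -> : (size (primes n))%:R * ln M%:R =
   \sum_(q <- primes n) ln q%:R + \sum_(q <- primes n) (ln M%:R - ln q%:R) :> R.
  rewrite -big_split /= (eq_bigr (fun=> ln M%:R)); last by move=> q _; rewrite addrC subrK.
  by rewrite big_const_seq count_predT iter_addr_0 mulr_natl.
apply: lerD; first exact: sum_ln_primes_le.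
apply: le_trans (sum_ln_ratio_primes M1).
apply: (@le_trans _ _ (\sum_(q <- primes n | (q <= M)%N) (ln M%:R - ln q%:R))).
  rewrite [leRHS]big_mkcond; apply: ler_sum => q _; case: ifP => //; move/negbT.
  rewrite -ltnNge => Mq; rewrite subr_le0; apply: ler_ln_nat; last exact: ltnW.
  exact: ltnW.
rewrite sum_primes_iota big_mkcond [leRHS]big_mkcond.
rewrite big_nat_cond [leRHS]big_nat_cond; apply: ler_sum => q /andP[/andP[q0 qM] _].
case: ifP => [h|_]; first by rewrite mem_primes in h; case/andP: h => ->.
by case: ifP => // _; rewrite subr_ge0 ler_ln_nat.
Qed.

Lemma lnG_le n : (0 < n)%N ->
  ln (G n)%:R <= ((size (primes n))%:R + 6) / 4 * ln n%:R :> R.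
Proof.
move=> n0; have := G_upper n0.
have G0 : (0 < G n)%N by rewrite card_gt0; apply/set0Pn; exists 1%G; rewrite inE sub1G.
move=> h.
have : ln (G n ^ 4)%:R <= ln (n ^ (size (primes n) + 6))%:R :> R.
  by apply: ler_ln_nat => //; rewrite expn_gt0 G0.
rewrite !natrX !lnXn ?ltr0n // -[_ *+ 4]mulr_natl -[_ *+ (_ + 6)]mulr_natl natrD.
by move: (ln (G n)%:R : R) (ln n%:R : R) ((size _)%:R : R) => a b c; lra.
Qed.

(** Use [omega_le] with M the integer part of L = ln x. *)
Lemma lnG_upper (x L l : R) n : L = ln x -> l = ln L -> (0 < n)%N -> n%:R <= x ->
  2 <= l -> 4 <= L -> l ^+ 2 <= Num.sqrt L -> 6 * l ^+ 2 <= L ->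
  ln (G n)%:R <= 4^-1 * (L ^+ 2 / l) + 9 * (L ^+ 2 / l ^+ 2).
Proof.
move=> eL el n0 nx l2 L4 h1 h2.
have x0 : 0 < x by apply: lt_le_trans nx; rewrite ltr0n.
have L0 : 0 < L by lra. have l0 : 0 < l by lra.
have nL : ln n%:R <= L by rewrite eL ler_ln ?posrE ?ltr0n.
apply: (le_trans (lnG_le n0)).
set om := (size (primes n))%:R : R.
have om0 : 0 <= om by [].
set M := Num.truncn L.
have ML : M%:R <= L by rewrite truncn_le ltW.
have LM : L < M%:R + 1 by rewrite natr1 truncnS_gt.
have M1 : (1 < M)%N by rewrite -(ltr_nat R); lra.
have M0 : 0 < M%:R :> R by rewrite ltr0n ltnW.
have lM : l - 1 <= ln M%:R.
  have : ln (L / 2) <= ln M%:R by rewrite ler_ln ?posrE ?divr_gt0 //; lra.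
  by rewrite ln_div ?posrE // -el; have := ln2_le1 R; lra.
have := omega_le n0 M1; rewrite -/om; clearbody om.
set m := ln M%:R in lM *.
have m0 : 0 < m by lra.
rewrite -ler_pdivlMr // => ho.
have i0 : 0 < l^-1 by rewrite invr_gt0.
have mi : m^-1 <= l^-1 + 2 * l^-1 ^+ 2.
  rewrite -[leLHS]mul1r ler_pdivrMr //.
  have e : l^-1 * l = 1 by rewrite mulVf // lt0r_neq0.
  apply: (@le_trans _ _ ((l^-1 + 2 * l^-1 ^+ 2) * (l - 1))).
    have -> : (l^-1 + 2 * l^-1 ^+ 2) * (l - 1) =
       l^-1 * l + l^-1 * (2 * (l^-1 * l) - 1) - 2 * l^-1 ^+ 2 by ring.
    rewrite e; have : l^-1 <= 2^-1 by rewrite lef_pV2 ?posrE.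
    by move: i0; move: (l^-1) => i i0; nra.
  by rewrite ler_wpM2l // addr_ge0 ?mulr_ge0 ?exprn_ge0 // ltW.
have mi2 : m^-1 <= 2 * l^-1.
  by have : l^-1 <= 2^-1 by [rewrite lef_pV2 ?posrE]; move: i0 mi; move: (l^-1) => i; nra.
have mi0 : 0 < m^-1 by rewrite invr_gt0.
have sq : Num.sqrt M%:R <= L / l ^+ 2.
  rewrite ler_pdivlMr ?exprn_gt0 //.
  apply: (@le_trans _ _ (Num.sqrt L * Num.sqrt L)).
    by apply: ler_pM; rewrite ?sqrtr_ge0 ?exprn_ge0 ?(ltW l0) //; apply: ler_wsqrtr.
  by rewrite -expr2 sqr_sqrtr // ltW.
have s6 : 6 <= L / l ^+ 2 by rewrite ler_pdivlMr ?exprn_gt0.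
have ho2 : om <= L * m^-1 + Num.sqrt M%:R + 8 * M%:R * m^-1 ^+ 2.
  apply: (le_trans ho).
  have -> : (ln n%:R + (Num.sqrt M%:R * m + 8 * M%:R / m)) / m =
     ln n%:R * m^-1 + Num.sqrt M%:R + 8 * M%:R * m^-1 ^+ 2.
    by field; rewrite lt0r_neq0.
  by rewrite !lerD2r ler_wpM2r // ltW.
have ho3 : 8 * M%:R * m^-1 ^+ 2 <= 8 * L * (2 * l^-1) ^+ 2.
  apply: ler_pM; rewrite ?exprn_ge0 ?mulr_ge0 ?(ltW mi0) //; first by lra.
  by rewrite !expr2; apply: ler_pM; rewrite // ltW.
have ho1 : L * m^-1 <= L * (l^-1 + 2 * l^-1 ^+ 2) by rewrite ler_wpM2l // ltW.
have tot : om + 6 <= L * l^-1 + 36 * (L * l^-1 ^+ 2).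
  rewrite -exprVn in sq; rewrite -exprVn in s6.
  have e4 : 8 * L * (2 * l^-1) ^+ 2 = 32 * (L * l^-1 ^+ 2) by ring.
  have e2 : L * (l^-1 + 2 * l^-1 ^+ 2) = L * l^-1 + 2 * (L * l^-1 ^+ 2) by ring.
  rewrite e4 in ho3; rewrite e2 in ho1.
  move: ho1 ho2 ho3 sq s6; move: (L * l^-1 ^+ 2) (L * l^-1) (L * m^-1) => a b c.
  by move: (8 * _ * _) (Num.sqrt M%:R) => d e *; lra.
apply: (@le_trans _ _ ((om + 6) / 4 * L)).
  by rewrite ler_wpM2l // divr_ge0 // addr_ge0.
have := ler_wpM2r (ltW L0) tot.
have -> : L ^+ 2 / l = L * l^-1 * L by ring.
have -> : L ^+ 2 / l ^+ 2 = L * l^-1 ^+ 2 * L by rewrite exprVn; ring.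
by lra.
Qed.

End Omega.

(** * Lower bound for log G *)

Section Lower.
Variable R : realType.

Lemma half_product_ge r : (r ^ 2 <= 4 * (r./2 * (r - r./2)) + 1)%N.
Proof.
move: (odd_double_half r); set t := r./2; rewrite -addnn => <-; rewrite -mulnn.
by case: (odd r); rewrite /= ?add0n ?add1n ?subSn ?leq_addr // addKn; nia.
Qed.

(** The product of r primes congruent to 1 mod p, with subgroups of order
p ^ (r / 2) in its p-torsion. *)
Lemma lnG_prime_product p y r : prime p -> (0 < y)%N -> (r <= prime_count_progression y p)%N ->
  exists n, [/\ (0 < n)%N, (n <= y ^ r)%N &
    (r%:R ^+ 2 - 1) / 4 * ln p%:R <= ln (G n)%:R :> R].
Proof.
move=> pp y0 hr.
pose S := [seq q <- index_iota 1 y.+1 | prime q && (q %% p == 1)%N].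
have sS : size S = prime_count_progression y p by rewrite /prime_count_progression -big_filter sum1_size.
pose s := take r S.
have ss : size s = r by rewrite size_takel // sS.
have us : uniq s by rewrite take_uniq // filter_uniq // iota_uniq.
have Ss q : q \in s -> [/\ prime q, (q %% p == 1)%N & (q <= y)%N].
  by move/mem_take; rewrite mem_filter mem_index_iota ltnS => /andP[/andP[-> ->] /andP[_ ->]].
have Hs q : q \in s -> prime q && (q %% p == 1)%N by move/Ss => [-> ->].
exists (\prod_(q <- s) q)%N; split.
- rewrite big_seq; elim/big_ind: _ => // [a b a0 b0|q qs]; first by rewrite muln_gt0 a0.
  by have [/prime_gt0] := Ss q qs.
- rewrite -ss; have {}Ss q : q \in s -> (q <= y)%N by case/Ss.
  elim: (s) Ss => [|q s' IH] H; first by rewrite big_nil.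
  rewrite big_cons /= expnS leq_mul ?H ?mem_head //.
  by apply: IH => z zs; apply: H; rewrite in_cons zs orbT.
have hd : (r./2 <= size s)%N by rewrite ss; lia.
have := G_lower pp us Hs hd; rewrite ss => h.
apply: (@le_trans _ _ (ln (p ^ (r./2 * (r - r./2)))%:R)); last first.
  by apply: ler_ln_nat => //; rewrite expn_gt0 prime_gt0.
rewrite natrX lnXn ?ltr0n ?prime_gt0 // -[ln _ *+ _]mulr_natl.
rewrite ler_wpM2r ?ln_nat_ge0 //.
have := half_product_ge r; rewrite -(ler_nat R) natrX natrD natrM.
by move: (r%:R ^+ 2 : R) ((_ * _)%N%:R : R) => a b; lra.
Qed.

(** The inequality (1 - 2 u) (1 + u) ^ 2 <= 1 with u = 30 lam / l gives
1 / Y ^ 2 >= (1 - 60 lam / l) / (4 l ^ 2); the rest is bookkeeping of the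
losses. *)
Lemma lower_bound_arith (L l lam Y : R) : 0 < L -> 1 <= lam -> 192 * lam <= l -> l ^+ 2 <= L ->
  2 * l <= Y -> Y <= 2 * l + 60 * lam ->
  L ^+ 2 / l / 16 - 6 * (L ^+ 2 * lam / l ^+ 2) <=
  ((L / Y - 1) ^+ 2 - 1) / 4 * (l - 7 * lam).
Proof.
move=> L0 lam1 ll lL Yl Yu.
have l0 : 0 < l by lra.
have Y0 : 0 < Y by lra.
set i := l^-1; have i0 : 0 < i by rewrite invr_gt0.
have li : l * i = 1 by rewrite mulfV // lt0r_neq0.
set j := Y^-1; have j0 : 0 < j by rewrite invr_gt0.
have Yj : Y * j = 1 by rewrite mulfV // lt0r_neq0.
have -> : ((L / Y - 1) ^+ 2 - 1) = (L * j) ^+ 2 - 2 * (L * j) by rewrite /j; ring.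
have -> : L ^+ 2 / l / 16 = (L * i) ^+ 2 * l / 16.
  by rewrite /i; field; rewrite lt0r_neq0.
have -> : L ^+ 2 * lam / l ^+ 2 = (L * i) ^+ 2 * lam.
  by rewrite /i; field; rewrite lt0r_neq0.
have u0 : 0 <= lam * i by rewrite mulr_ge0 ?(ltW i0) //; lra.
have hj : (i ^+ 2) / 4 * (1 - 60 * (lam * i)) <= j ^+ 2.
  have h1 : 1 <= (2 * l + 60 * lam) * j by rewrite -[leLHS]Yj ler_wpM2r // ltW.
  have e1 : (2 * l + 60 * lam) * j = 2 * (1 + 30 * (lam * i)) * (l * j).
    have -> : 2 * (1 + 30 * (lam * i)) * (l * j) = (2 * l + 60 * lam * (l * i)) * j by ring.
    by rewrite li mulr1.
  rewrite e1 in h1.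
  set u := lam * i in u0 h1 *.
  have lj0 : 0 < l * j by rewrite mulr_gt0.
  have h2 : 1 <= 4 * (1 + 30 * u) ^+ 2 * (l * j) ^+ 2.
    have : 1 * 1 <= (2 * (1 + 30 * u) * (l * j)) * (2 * (1 + 30 * u) * (l * j)).
      by apply: ler_pM.
    rewrite mul1r; lra.
  have h3 : (1 - 60 * u) * (1 + 30 * u) ^+ 2 <= 1 by nra.
  have h4 : 1 - 60 * u <= 4 * (l * j) ^+ 2.
    have d0 : 0 < (1 + 30 * u) ^+ 2 by rewrite exprn_gt0 //; lra.
    rewrite -(ler_pM2r d0); apply: (le_trans h3); lra.
  have -> : j ^+ 2 = i ^+ 2 / 4 * (4 * (l * j) ^+ 2).
    have -> : i ^+ 2 / 4 * (4 * (l * j) ^+ 2) = (l * i) ^+ 2 * j ^+ 2 by field.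
    by rewrite li expr1n mul1r.
  by rewrite ler_wpM2l // divr_ge0 // exprn_ge0 // ltW.
have hj1 : 2 * (L * j) <= L * i.
  have : 2 * j <= i.
    rewrite -[i]mul1r -ler_pdivrMr //.
    have -> : 2 * j / i = 2 * l * j by rewrite /i invrK; ring.
    by rewrite -[leRHS]Yj ler_wpM2r // ltW.
  by move/(ler_wpM2l (ltW L0)); lra.
set B0 := l - 7 * lam.
have B00 : 0 <= B0 by rewrite /B0; lra.
have s1 : (L * i) ^+ 2 / 4 * (1 - 60 * (lam * i)) <= (L * j) ^+ 2.
  have := ler_wpM2l (exprn_ge0 2 (ltW L0)) hj; rewrite !exprMn; lra.
have s2 : (L * i) ^+ 2 / 4 * (1 - 60 * (lam * i)) - L * i <= (L * j) ^+ 2 - 2 * (L * j) by lra.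
have := ler_wpM2r B00 s2 => s3.
have s4 : (L * i) * B0 <= (L * i) ^+ 2 * lam.
  have b : B0 <= l by rewrite /B0; lra.
  apply: (@le_trans _ _ (L * i * l)); first by rewrite ler_wpM2l // mulr_ge0 // ltW.
  have -> : L * i * l = L * (l * i) by ring.
  rewrite li mulr1.
  have : L * 1 <= L * (L * i ^+ 2 * lam).
    rewrite ler_wpM2l ?(ltW L0) //.
    have g : 1 <= L * i ^+ 2.
      have : l ^+ 2 * i ^+ 2 <= L * i ^+ 2 by rewrite ler_wpM2r // exprn_ge0 // ltW.
      by rewrite -exprMn li expr1n.
    by rewrite -[1]mul1r; apply: ler_pM.
  rewrite exprMn; lra.
have s5 : (L * i) ^+ 2 / 4 * (l - 67 * lam) <= (L * i) ^+ 2 / 4 * (1 - 60 * (lam * i)) * B0.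
  rewrite -[leRHS]mulrA ler_wpM2l //.
    by rewrite divr_ge0 // exprn_ge0 // mulr_ge0 // ltW.
  have -> : (1 - 60 * (lam * i)) * B0 = l - 7 * lam - 60 * lam * (l * i) + 420 * (lam * (lam * i)).
    by rewrite /B0; ring.
  rewrite li mulr1; have : 0 <= lam * (lam * i) by rewrite mulr_ge0 //; lra.
  lra.
have q0 : 0 <= (L * i) ^+ 2 by rewrite exprn_ge0 // mulr_ge0 // ltW.
have q1 : 0 <= (L * i) ^+ 2 * lam by rewrite mulr_ge0 //; lra.
lra.
Qed.

(** Apply [primes_in_progression] with P just above L = ln x and w just above 2 l, so
that ln y is 2 l + O(lam), and take as many of the primes q as keeps the
product below x. *)
Lemma lnG_lower (x L l lam : R) : 0 < x -> L = ln x -> l = ln L -> lam = ln l ->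
  1 <= lam -> 192 * lam <= l -> 1024 * (error_factor R + 96) <= l -> (3 * l) ^+ 40 <= L ->
  exists n, [/\ (0 < n)%N, n%:R <= x &
    L ^+ 2 / l / 16 - 6 * (L ^+ 2 * lam / l ^+ 2) <= ln (G n)%:R].
Proof.
move=> x0 eL el elam lam1 ll lC hL.
have C20 : 0 <= error_factor R := error_factor_ge0 R.
have l1 : 192 <= l by lra.
have l0 : 0 < l by lra.
have lL : l ^+ 2 <= L.
  apply: le_trans hL; apply: (@le_trans _ _ ((3 * l) ^+ 2)).
    by rewrite exprMn ler_peMl ?exprn_ge0 ?(ltW l0) //; lra.
  by rewrite ler_weXn2l //; lra.
have L0 : 0 < L by apply: lt_le_trans lL; rewrite exprn_gt0.
have lL1 : l <= L.
  by apply: le_trans lL; rewrite expr2 -[leLHS]mul1r ler_pM2r //; lra.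
pose P := (Num.truncn L).+1; pose w := (Num.truncn (2 * l)).+1.
have PL : L <= P%:R by rewrite ltW // truncnS_gt.
have PU : P%:R <= L + 1.
  by rewrite /P -natr1 lerD2r truncn_le ltW.
have wl : 2 * l <= w%:R by rewrite ltW // truncnS_gt.
have wU : w%:R <= 3 * l.
  have : (Num.truncn (2 * l))%:R <= 2 * l by rewrite truncn_le mulr_ge0 // ltW.
  by rewrite /w -natr1; lra.
have Pw : (w ^ 40 <= P)%N.
  rewrite -(ler_nat R) natrX; apply: le_trans PL; apply: le_trans hL.
  by rewrite lerXn2r ?nnegrE //; lra.
have wC : 512 * (error_factor R + 96) < w%:R by lra.
clear hL lC.
have P0 : 0 < P%:R :> R by rewrite ltr0n.
have w0 : 0 < w%:R :> R by rewrite ltr0n.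
have lP : l <= ln P%:R by rewrite el ler_ln ?posrE.
have lP1 : ln P%:R <= l + 1.
  have : ln P%:R <= ln (2 * L) by rewrite ler_ln ?posrE ?mulr_gt0 //; lra.
  by rewrite lnM ?posrE // -el; have := ln2_le1 R; lra.
have lw : ln w%:R <= lam + 2.
  have : ln w%:R <= ln (4 * l) by rewrite ler_ln ?posrE ?mulr_gt0 //; lra.
  rewrite lnM ?posrE // -elam.
  have -> : ln 4 = 2 * ln 2 :> R by rewrite (_ : 4 = 2 * 2 :> R); [rewrite lnM ?posrE //; ring | ring].
  by have := ln2_le1 R; lra.
have lw0 : 0 <= ln w%:R :> R by exact: ln_nat_ge0.
have [] := @primes_in_progression R P w.
- by [].
- lra.
- exact: Pw.
- by rewrite -(ltr_nat R); lra.
- exact: wC.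
move=> p [pp pP Pp cnt].
pose y := (w ^ 18 * P ^ 2)%N.
have y0 : (0 < y)%N by rewrite muln_gt0 !expn_gt0.
pose Y : R := ln y%:R.
have EY : Y = 18 * ln w%:R + 2 * ln P%:R.
  rewrite /Y /y natrM !natrX lnM ?posrE ?exprn_gt0 // !lnXn //.
  by rewrite -[_ *+ 18]mulr_natl -[_ *+ 2]mulr_natl.
have Yl : 2 * l <= Y by rewrite EY; lra.
have Yu : Y <= 2 * l + 60 * lam by rewrite EY; lra.
have Y0 : 0 < Y by lra.
have YL : Y <= L.
  apply: le_trans lL; rewrite expr2; apply: (@le_trans _ _ (3 * l)); first by lra.
  by rewrite ler_pM2r //; lra.
pose r := Num.truncn (L / Y).
have rU : r%:R <= L / Y by rewrite truncn_le divr_ge0 // ltW.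
have rL : L / Y - 1 <= r%:R.
  by rewrite lerBlDr natr1 ltW // truncnS_gt.
have rc : (r <= prime_count_progression y p)%N.
  apply: leq_trans cnt; rewrite -(ler_nat R); apply: le_trans PL; apply: (le_trans rU).
  by rewrite ler_pdivrMr // ler_peMr ?(ltW L0) //; lra.
have [n [n0 ny hG]] := lnG_prime_product pp y0 rc.
exists n; split=> //.
  have n0R : 0 < n%:R :> R by rewrite ltr0n.
  rewrite -ler_ln ?posrE // -eL.
  apply: (@le_trans _ _ (ln (y ^ r)%:R)); first exact: ler_ln_nat.
  by rewrite natrX lnXn ?ltr0n // -[_ *+ r]mulr_natl -/Y -ler_pdivlMr.
apply: le_trans hG.
have p0 : 0 < p%:R :> R by rewrite ltr0n prime_gt0.
have lnp : l - 7 * lam <= ln p%:R.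
  have : ln P%:R <= ln (16 * w * p)%:R :> R by exact: ler_ln_nat.
  rewrite !natrM lnM ?posrE ?mulr_gt0 // lnM ?posrE //.
  have -> : ln 16 = 4 * ln 2 :> R.
    have -> : 16 = 2 ^+ 4 :> R by ring.
    by rewrite lnXn // -[_ *+ 4]mulr_natl.
  by have := ln2_le1 R; lra.
apply: (le_trans (lower_bound_arith L0 lam1 ll lL Yl Yu)).
have LY1 : 1 <= L / Y by rewrite ler_pdivlMr // mul1r.
have a : (L / Y - 1) ^+ 2 <= r%:R ^+ 2.
  by rewrite lerXn2r ?nnegrE //; lra.
have B0 : 0 <= l - 7 * lam by lra.
apply: (@le_trans _ _ ((r%:R ^+ 2 - 1) / 4 * (l - 7 * lam))).
  by rewrite ler_wpM2r // ler_wpM2r // lerB.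
have r1 : (0 < r)%N by rewrite truncn_gt0.
by rewrite ler_wpM2l // divr_ge0 // subr_ge0 exprn_ege1 // ler1n.
Qed.

End Lower.

Unset Implicit Arguments.
Local Open Scope classical_set_scope.
Local Open Scope ring_scope.

(** * Maximal order of log G *)

Lemma near_ln_pow (R : realType) (c : R) (k : nat) :
  \forall u \near pinfty_nbhs R, c * ln u ^+ k <= u.
Proof.
exists (expR (Num.max 1 (`|c| * (k.+1)`!%:R))); split; first exact: num_real.
move=> u hu.
have u0 : 0 < u by apply: lt_trans hu; exact: expR_gt0.
have : Num.max 1 (`|c| * (k.+1)`!%:R) < ln u by rewrite -ltr_expR lnK.
rewrite gt_max => /andP[v1 vc].
set v := ln u in v1 vc *.
have v0 : 0 < v by apply: lt_trans v1.
have := @expR_ge1Dxn R v k (ltW v0).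
rewrite lnK // => h.
have f0 : 0 < (k.+1)`!%:R :> R by rewrite ltr0n fact_gt0.
apply: (@le_trans _ _ (v ^+ k.+1 / (k.+1)`!%:R)); last by lra.
rewrite ler_pdivlMr // exprS mulrAC ler_wpM2r ?exprn_ge0 ?(ltW v0) //.
apply: le_trans (ltW vc); rewrite ler_wpM2r ?(ltW f0) //.
exact: ler_norm.
Qed.

Lemma near_ln (R : realType) (Q : R -> Prop) :
  (\forall v \near pinfty_nbhs R, Q v) -> \forall u \near pinfty_nbhs R, Q (ln u).
Proof.
move=> [A [_ hA]]; exists (expR A); split; first exact: num_real.
move=> u hu; apply: hA; rewrite -ltr_expR lnK //.
by apply: lt_trans hu; exact: expR_gt0.
Qed.

Lemma near_ge (R : realType) (A : R) : \forall u \near pinfty_nbhs R, A <= u.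
Proof. by exists A; split; [exact: num_real | move=> u; exact: ltW]. Qed.

(** An explicit form of x being sufficiently large, in terms of the iterated
logarithms of x. *)
Definition large_enough (R : realType) (x : R) : Prop :=
  let L := ln x in let l := ln L in let lam := ln l in
  [/\ 0 < x, 1 <= lam, 192 * lam <= l, 1024 * (error_factor R + 96) <= l & (3 * l) ^+ 40 <= L].

Lemma near_large_enough (R : realType) :
  \forall x \near pinfty_nbhs R, large_enough R x.
Proof.
have h1 := near_ln _ _ (near_ln _ _ (near_ln _ _ (near_ge R 1))).
have h2 := near_ln _ _ (near_ln _ _ (near_ln_pow R 192 1)).
have h3 := near_ln _ _ (near_ln _ _ (near_ge R (1024 * (error_factor R + 96)))).
have h4 := near_ln _ _ (near_ln_pow R (3 ^+ 40) 40).
have h5 := near_ge R 1.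
near=> x.
have g1 : 1 <= ln (ln (ln x)) by near: x.
have g2 : 192 * ln (ln (ln x)) ^+ 1 <= ln (ln x) by near: x.
have g3 : 1024 * (error_factor R + 96) <= ln (ln x) by near: x.
have g4 : 3 ^+ 40 * ln (ln x) ^+ 40 <= ln x by near: x.
have g5 : 1 <= x by near: x.
rewrite expr1 in g2; rewrite -exprMn in g4.
by split => //; lra.
Unshelve. all: by end_near. Qed.

Lemma maxlogG_ge (R : realType) (x : R) n : (0 < n)%N -> n%:R <= x ->
  ln (G n)%:R <= maxlogG x.
Proof.
move=> n0 nx; have x0 : 0 <= x by apply: le_trans nx.
have : n \in index_iota 1 (Num.truncn x).+1.
  by rewrite mem_index_iota n0 ltnS truncn_ge_nat.
rewrite /maxlogG; elim: (index_iota _ _) => // m s IH.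
rewrite in_cons big_cons => /orP[/eqP <-|/IH h]; first by rewrite le_max lexx.
by rewrite le_max h orbT.
Qed.

Lemma maxlogG_le (R : realType) (x B : R) : 1 <= x ->
  (forall n, (0 < n)%N -> n%:R <= x -> ln (G n)%:R <= B) -> maxlogG x <= B.
Proof.
move=> x1 h; have x0 : 0 <= x by lra.
rewrite /maxlogG big_nat_cond.
elim/big_ind: _ => [|a b ha hb|n /andP[/andP[n0 n1] _]].
- exact: h.
- by rewrite ge_max ha.
by apply: h => //; apply: le_trans (_ : (Num.truncn x)%:R <= x); rewrite ?ler_nat // truncn_le.
Qed.

Lemma maxlogG_bounds (R : realType) (x : R) : large_enough R x ->
  let L := ln x in let l := ln L in
  L ^+ 2 / l / 16 - 6 * (L ^+ 2 * ln l / l ^+ 2) <= maxlogG x /\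
  maxlogG x <= 4^-1 * (L ^+ 2 / l) + 9 * (L ^+ 2 / l ^+ 2).
Proof.
move=> [x0 lam1 ll lC hL] L l; split.
  have [n [n0 nx h]] := lnG_lower x0 erefl erefl erefl lam1 ll lC hL.
  exact: le_trans h (maxlogG_ge _ _ _ n0 nx).
rewrite -/L -/l in lam1 ll lC hL.
have l1 : 192 <= l by lra.
have l40 : l ^+ 4 <= L.
  apply: le_trans hL; apply: (@le_trans _ _ ((3 * l) ^+ 4)).
    by rewrite exprMn ler_peMl ?exprn_ge0 //; lra.
  by rewrite ler_weXn2l //; lra.
have l20 : 6 <= l ^+ 2 by rewrite expr2; nra.
have l42 : 6 * l ^+ 2 <= L.
  by apply: le_trans l40; rewrite (exprD l 2 2) ler_wpM2r // exprn_ge0 //; lra.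
have L4 : 4 <= L by lra.
apply: maxlogG_le => [|n n0 nx].
  by rewrite leNgt; apply/negP => x1; have := @ln_le0 R x (ltW x1); rewrite -/L; lra.
apply: (lnG_upper erefl erefl n0 nx) => //; rewrite -?/L -?/l //; try lra.
rewrite -[leLHS]ger0_norm ?exprn_ge0 //; last by lra.
by rewrite -sqrtr_sqr; apply: ler_wsqrtr; rewrite -exprM.
Qed.

Theorem theorem1p5 (R : realType) :
  (@maxlogG R =Theta_ (pinfty_nbhs R) (fun x : R => ln x ^+ 2 / ln (ln x)))
  /\
  exists E1 E2 : R -> R,
    [/\ E1 =O_ (pinfty_nbhs R)
          (fun x : R => ln x ^+ 2 * ln (ln (ln x)) / ln (ln x) ^+ 2),
        E2 =O_ (pinfty_nbhs R) (fun x : R => ln x ^+ 2 / ln (ln x) ^+ 2)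
      & \forall x \near pinfty_nbhs R,
          16^-1 * (ln x ^+ 2 / ln (ln x)) + E1 x <= maxlogG x
          /\ maxlogG x <= 4^-1 * (ln x ^+ 2 / ln (ln x)) + E2 x].
Proof.
have near_large := near_large_enough R.
split; last first.
  exists (fun x => - 6 * (ln x ^+ 2 * ln (ln (ln x)) / ln (ln x) ^+ 2)),
         (fun x => 9 * (ln x ^+ 2 / ln (ln x) ^+ 2)); split.
  - apply/eqO_exP; exists 6 => //; near=> x.
    by rewrite normrM normrN normr_nat.
  - apply/eqO_exP; exists 9 => //; near=> x.
    by rewrite normrM normr_nat.
  near=> x; have hx : large_enough R x by near: x.
  by have [h1 h2] := maxlogG_bounds _ _ hx; split => //; lra.
rewrite eqThetaE bigThetaE eqOmegaO.
have main x : large_enough R x ->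
   [/\ 0 <= ln x ^+ 2 / ln (ln x),
      ln x ^+ 2 / ln (ln x) <= 100 * maxlogG x &
      maxlogG x <= 10 * (ln x ^+ 2 / ln (ln x))].
  move=> hx; have [h1 h2] := maxlogG_bounds _ _ hx.
  case: hx => _ lam1 ll _ _.
  set L := ln x in h1 h2 lam1 ll *; set l := ln L in h1 h2 lam1 ll *.
  set lam := ln l in h1 lam1 ll *.
  have l0 : 0 < l by lra.
  have g0 : 0 <= L ^+ 2 / l by rewrite divr_ge0 ?sqr_ge0 // ltW.
  have e1 : L ^+ 2 * lam / l ^+ 2 = L ^+ 2 / l * (lam / l).
    by field; rewrite lt0r_neq0.
  have e2 : L ^+ 2 / l ^+ 2 = L ^+ 2 / l * l^-1.
    by field; rewrite lt0r_neq0.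
  have q1 : lam / l <= 192^-1 by rewrite ler_pdivrMr //; lra.
  have q2 : l^-1 <= 1 by rewrite invf_le1 //; lra.
  rewrite e1 in h1; rewrite e2 in h2.
  have w1 := ler_wpM2l g0 q1; have w2 := ler_wpM2l g0 q2.
  by split => //; lra.
split.
  apply/eqO_exP; exists 10 => //; near=> x.
  have hx : large_enough R x by near: x.
  have [g0 m1 m2] := main x hx.
  by rewrite (ger0_norm g0) ger0_norm //; lra.
apply/eqO_exP; exists 100 => //; near=> x.
have hx : large_enough R x by near: x.
have [g0 m1 m2] := main x hx.
by rewrite (ger0_norm g0) ger0_norm //; lra.
Unshelve. all: by end_near. Qed.
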